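(* The derivation $\delta_2'$ of the algebra $\mathcal{A}_{G^+(\mathbb{Q})}=\mathcal{M}\rtimes G^+(\mathbb{Q})$, given by $\delta_2'(f\,U_\gamma^* )=\left(X(\mu_\gamma)-\tfrac12\mu_\gamma^2\right)f\,U_\gamma^*$ for $f\in\mathcal{M}$, $\gamma\in G^+(\mathbb{Q})$, is inner and implemented by the weight $4$ modular form $\omega_4=-\frac{E_4}{72}$: $$\delta_2'(a)=[a,\omega_4],\qquad\forall\,a\in\mathcal{A}_{G^+(\mathbb{Q})}.$$
   Context: $G^+(\mathbb{Q})=\mathrm{GL}^+(2,\mathbb{Q})$. For $\alpha=\begin{pmatrix}a&b\\c&d\end{pmatrix}\in\mathrm{GL}^+(2,\mathbb{R})$ and $f$ on the upper half-plane, $f|_k\alpha(z)=\det(\alpha)^{k/2}f\left(\frac{az+b}{cz+d}\right)(cz+d)^{-k}$; $f|\alpha$ means $k$ is the weight of $f$ (extended linearly). $\mathcal{M}=\bigcup_N\bigoplus_{k\ge0}\mathcal{M}_k(\Gamma(N))$ is the algebra of modular forms of all levels (weight $0$: constants). The crossed product $\mathcal{A}_{G^+(\mathbb{Q})}$ consists of finite sums $\sum fU_\gamma^*$, $f\in\mathcal{M}$, $\gamma\in G^+(\mathbb{Q})$, with product $fU_\alpha^*\cdot gU_\beta^*=(f\cdot g|\alpha)\,U_{\beta\alpha}^*$; $\mathcal{M}$ is the subalgebra of elements $fU_1^*$. $Y(f)=\frac k2f$ for $f\in\mathcal{M}_k$; $X=\frac1{2\pi i}\frac{d}{dz}-\frac1{2\pi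 i}\frac{d}{dz}(\log\eta^4)\cdot Y$ with $\eta$ the Dedekind eta function ($\eta^{24}=q\prod_{n\ge1}(1-q^n)^{24}$, $q=e^{2\pi iz}$); $\mu_\gamma=\frac1{2\pi i}\frac{d}{dz}\log\frac{\eta^4|\gamma}{\eta^4}$ (weight $2$ slash), a weight $2$ modular form. $E_4=1+240\sum_{n\ge1}n^3\frac{q^n}{1-q^n}$. *)

(* Defs.v *)
From HB Require Import structures.
From mathcomp Require Import all_boot all_order all_algebra.
From mathcomp Require Import all_classical all_reals all_analysis.
From mathcomp Require Import complex finmap.
(* The notations of [monalg] clash with those of MathComp-Analysis. *)
From mathcomp Require monalg.
Import -(notations) monalg.

Set Implicit Arguments.
Unset Strict Implicit.
Unset Printing Implicit Defensive.

Import Order.TTheory GRing.Theory Num.Theory numFieldNormedType.Exports.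

Local Open Scope classical_set_scope.
Local Open Scope complex_scope.
Local Open Scope ring_scope.

(* [R[i]] itself carries no topology; seen as a [numFieldType] it does. *)
Definition Cx (R : realType) : numClosedFieldType := R[i].

Definition upper (R : realType) := {z : R[i] | 0 < complex.Im z}.

HB.instance Definition _ (R : realType) := Choice.on (upper R).

Lemma Im_i_gt0 (R : realType) : 0 < complex.Im ('i%C : R[i]).
Proof. exact: ltr01. Qed.

(* The base point also serves as the junk value in [moebius]; pointedness
   makes [upper R -> Cx R] a ring under the pointwise operations. *)
HB.instance Definition _ (R : realType) :=
  isPointed.Build (upper R) (exist _ 'i%C (Im_i_gt0 R)).

Definition hfun (R : realType) := upper R -> Cx R.

HB.instance Definition _ (R : realType) := GRing.NzRing.on (hfun R).

Section AnalysisOnUpper.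
Context {R : realType}.
Implicit Types (f : hfun R) (z : upper R).

(* Extension by zero, so that complex differentiation on the field [Cx R]
   applies; the upper half-plane is open, so only values of [f] matter. *)
Definition ext0 f : Cx R -> Cx R :=
  fun w => if insub w is Some z then f z else 0.

Definition holomorphic f := forall z, derivable (ext0 f) (val z) 1.

Definition deriv_upper f : hfun R := fun z => derive1 (ext0 f) (val z).

(* d/dz log f, read as the logarithmic derivative f'/f *)
Definition dlog f : hfun R := fun z => deriv_upper f z / f z.

Definition cexp (w : Cx R) : Cx R :=
  (expR (complex.Re w))%:C *
  (cos (complex.Im w) +i* sin (complex.Im w)).

Definition two_pi_i : Cx R := (2 * pi)%:C * 'i%C.

Definition nome z : Cx R := cexp (two_pi_i * val z).

Definition const_hfun (c : Cx R) : hfun R := fun=> c.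

(* [eta ^+ 24] is q \prod_(n >= 1) (1 - q ^ n) ^ 24 *)
Definition eta : hfun R := fun z =>
  cexp (two_pi_i * val z / 24) *
  lim ((fun m => \prod_(1 <= n < m) (1 - nome z ^+ n)) @ \oo).

Definition eta4 : hfun R := fun z => eta z ^+ 4.

Definition E4 : hfun R := fun z =>
  1 + 240 *
  lim ((fun m => \sum_(1 <= n < m)
                   n%:R ^+ 3 * nome z ^+ n / (1 - nome z ^+ n)) @ \oo).

End AnalysisOnUpper.

Section Slash.
Context {R : realType}.

Definition autfactor (a : 'M[R]_2) (z : upper R) : Cx R :=
  (a 1 0)%:C * val z + (a 1 1)%:C.

(* For [0 < \det a] the image is in the upper half-plane, so the default of
   [insubd] is not reached; only such [a] are used. *)
Definition moebius (a : 'M[R]_2) (z : upper R) : upper R :=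
  insubd (point : upper R)
    (((a 0 0)%:C * val z + (a 0 1)%:C) / autfactor a z : Cx R).

Definition slash (k : nat) (a : 'M[R]_2) (f : hfun R) : hfun R := fun z =>
  (\det a `^ (k%:R / 2))%:C * f (moebius a z) / autfactor a z ^+ k.

End Slash.

(* Principal congruence subgroup; [Gamma 1] is SL(2,Z). *)
Definition Gamma (N : nat) : set 'M[int]_2 :=
  [set g | \det g = 1 /\
           forall i j, (N%:Z %| g i j - (1%:M : 'M[int]_2) i j)%Z].

Section ModularForms.
Context {R : realType}.
Implicit Types (f : hfun R).

Definition bounded_at_infty f :=
  exists B Y : R, forall z : upper R, Y < complex.Im (val z) ->
    `|f z| <= B%:C.

(* Holomorphy at the cusps is the boundedness of f|g at i\infty for every g
   in SL(2,Z). *)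
Definition modular_form (N k : nat) f :=
  [/\ holomorphic f,
      forall g, Gamma N g -> slash k (map_mx intr g) f = f
    & forall g, Gamma 1 g -> bounded_at_infty (slash k (map_mx intr g) f)].

End ModularForms.

(* Direct sum over the weights: the coefficient [p`_k] is the component of
   weight k, and the product of polynomials is the graded product. *)
Definition graded (R : realType) := {poly hfun R}.

HB.instance Definition _ (R : realType) := GRing.NzRing.on (graded R).

Section GradedForms.
Context {R : realType}.
Implicit Types (p : graded R) (f : hfun R).

Definition of_weight (k : nat) f : graded R := f *: 'X^k.

Definition gslash (a : 'M[R]_2) p : graded R :=
  \poly_(k < size p) slash k a p`_k.

(* The algebra M = \bigcup_N \bigoplus_k M_k(Gamma(N)) *)
Definition modular_forms : set (graded R) :=
  [set p | exists2 N : nat, (0 < N)%N & forall k, modular_form N k p`_k].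

Definition Yop p : graded R :=
  \poly_(k < size p) (const_hfun (k%:R / 2) * p`_k).

(* X raises weights by 2, hence the factor 'X^2. *)
Definition Xop p : graded R :=
  (\poly_(k < size p) (const_hfun two_pi_i^-1 * deriv_upper p`_k)
   - (const_hfun two_pi_i^-1 * dlog eta4) *: Yop p) * 'X^2.

End GradedForms.

(* G^+(Q) = GL^+(2,Q) *)
Definition GLQ := {a : 'M[rat]_2 | 0 < \det a}.

HB.instance Definition _ := Choice.on GLQ.

Lemma GLQ_mul_subproof (a b : GLQ) : 0 < \det (val a *m val b).
Proof. by rewrite det_mulmx mulr_gt0 ?(valP a) ?(valP b). Qed.

Definition GLQ_mul (a b : GLQ) : GLQ :=
  exist _ (val a *m val b) (GLQ_mul_subproof a b).

Lemma GLQ_one_subproof : 0 < \det (1%:M : 'M[rat]_2).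
Proof. by rewrite det1 ltr01. Qed.

Definition GLQ_one : GLQ := exist _ 1%:M GLQ_one_subproof.

Local Notation "<< z *g k >>" := (monalg.mkmalgU k z) : ring_scope.
Local Notation "a @_ g" := (monalg.mcoeff g a)
  (at level 3, g at level 2, left associativity) : ring_scope.

Section CrossedProduct.
Context {R : realType}.

Definition GLQ_real (g : GLQ) : 'M[R]_2 := map_mx ratr (val g).

(* Finite sums of f U_g^*, written [<< f *g g >>]. Coefficients are graded
   functions on the upper half-plane; [crossed] cuts out the sums whose
   coefficients are modular forms. *)
Definition precrossed := monalg.malg GLQ (graded R).

Implicit Types (a b : precrossed).

Definition crossed : set precrossed :=
  [set a | forall g, modular_forms a@_g].

(* f U_g^* . h U_k^* = (f . h|g) U_(k g)^* *)
Definition cmul a b : precrossed :=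
  \sum_(g <- monalg.msupp a) \sum_(h <- monalg.msupp b)
     << a@_g * gslash (GLQ_real g) b@_h *g GLQ_mul h g >>.

Lemma gslash0 (m : 'M[R]_2) : gslash m 0 = 0.
Proof. by rewrite /gslash size_poly0 poly_def big_ord0. Qed.

Lemma cmulUU (p q : graded R) (g h : GLQ) :
  cmul << p *g g >> << q *g h >> = << p * gslash (GLQ_real g) q *g GLQ_mul h g >>.
Proof.
rewrite /cmul !monalg.msuppU; case: (p =P 0) => [->|_].
  by rewrite big_seq_fset0 mul0r monalgU0.
rewrite big_seq_fset1 !monalg.mcoeffUU; case: (q =P 0) => [->|_].
  by rewrite big_seq_fset0 gslash0 mulr0 monalgU0.
by rewrite big_seq_fset1 monalg.mcoeffUU.
Qed.

Definition commutator a b : precrossed := cmul a b - cmul b a.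

(* The inclusion f |-> f U_1^* *)
Definition inclM (p : graded R) : precrossed := << p *g GLQ_one >>.

Definition cscale (c : Cx R) a : precrossed := (const_hfun c)%:P *: a.

Definition derivation_of (A : set precrossed) (d : precrossed -> precrossed) :=
  [/\ forall a, A a -> A (d a),
      forall a b, A a -> A b -> d (a + b) = d a + d b,
      forall c a, A a -> d (cscale c a) = cscale c (d a)
    & forall a b, A a -> A b -> d (cmul a b) = cmul (d a) b + cmul a (d b)].

Definition mu_fun (g : GLQ) : hfun R := fun z =>
  two_pi_i^-1 *
  dlog (fun w => slash 2 (GLQ_real g) eta4 w / eta4 w) z.

Definition mu (g : GLQ) : graded R := of_weight 2 (mu_fun g).

Definition delta2' a : precrossed :=
  \sum_(g <- monalg.msupp a)
     << (Xop (mu g) - (const_hfun 2^-1)%:P * mu g ^+ 2) * a@_g *g g >>.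

Lemma delta2'U (p : graded R) (g : GLQ) :
  delta2' << p *g g >> =
  << (Xop (mu g) - (const_hfun 2^-1)%:P * mu g ^+ 2) * p *g g >>.
Proof.
rewrite /delta2' monalg.msuppU; case: eqP => [->|_].
  by rewrite big_seq_fset0 mulr0 monalgU0.
by rewrite big_seq_fset1 monalg.mcoeffUU.
Qed.

End CrossedProduct.

Section Omega.
Context {R : realType}.

Definition omega4_fun : hfun R := fun z => - (E4 z / 72).

Definition omega4 : graded R := of_weight 4 omega4_fun.

End Omega.

(* Main.v *)
(* Put D = (1/2 i pi) d/dz and phi = E_2/6 = D(log eta^4).  Ramanujan's identity
   D(E_2) = (E_2^2 - E_4)/12 reads omega_4 = D(phi) - phi^2/2, and
   mu_g = phi|g - phi up to the affine correction of phi|g, so that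
   X(mu_g) - mu_g^2/2 = omega_4|g - omega_4: this is the coefficient at U_g^* of
   the commutator with omega_4, and the cocycle form of the right-hand side
   gives the Leibniz rule.

   Ramanujan's identity follows from u_m u_n = u_(m+n) (1 + u_m + u_n), where
   u_n = q^n/(1 - q^n), summed with the weights m^2 + m n + n^2.  The invariance
   of E_4 under z |-> -1/z comes from its expansion as a lattice sum.  The
   partial fractions of the cubic Lambert kernel h(t) = \sum_n n^3 t^n are
   obtained by iterating the duplication formula h(t) + h(-t) = 16 h(t^2) and
   passing to the limit by dominated convergence. *)
Require Import Defs.
From mathcomp Require Import all_boot all_order all_algebra.
From mathcomp Require Import all_classical all_reals all_analysis.
From mathcomp Require Import complex finmap.
From mathcomp Require Import ring lra zify.
From mathcomp Require monalg.
Import -(notations) monalg.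

Set Implicit Arguments.
Unset Strict Implicit.
Unset Printing Implicit Defensive.

Import Order.TTheory GRing.Theory Num.Theory numFieldNormedType.Exports.

Local Open Scope classical_set_scope.
Local Open Scope complex_scope.
Local Open Scope ring_scope.

Local Notation "<< z *g k >>" := (monalg.mkmalgU k z) : ring_scope.
Local Notation "a @_ g" := (monalg.mcoeff g a)
  (at level 3, g at level 2, left associativity) : ring_scope.

(** The analysis is carried by explicit estimates on partial sums and products. Derivatives pass
    through a limit because their remainders are bounded by C |h|^2 with C independent of the index,
    and exchanges of limits rest on domination by a fixed summable sequence. As the norm of [Cx R]
    takes its values in [Cx R], estimates are written with the real-valued modulus [cabs].

    The constant term of E_4 comes from the row m = 0 of the lattice sum, where the duplication
    formula meets the pole of h at 1; iterating it there produces the value 1/120 = zeta(-3).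

    That the derivation preserves the crossed product is a separate point: omega_4|g - omega_4 has
    to be modular of some level for every rational g. Clearing denominators leads to an integral
    matrix A; omega_4|A is invariant under Gamma(det A), and its behaviour at any cusp is reduced to
    that of omega_4 at i oo by making the matrix upper triangular modulo SL(2,Z). *)

Section ComplexAnalysis.
Context {R : realType}.
Implicit Types (z w : Cx R) (b : nat -> R).

(** * Real-valued modulus, convergence and dominated series in the complex plane *)

Definition cabs z : R := complex.Re `|z|.

Lemma cabsE z : `|z| = (cabs z)%:C.
Proof. by rewrite /cabs RRe_real // normr_real. Qed.

Lemma cabs_ge0 z : 0 <= cabs z.
Proof. by rewrite -lecR -cabsE normr_ge0. Qed.

Lemma cabsD z w : cabs (z + w) <= cabs z + cabs w.
Proof. by rewrite -lecR rmorphD /= -!cabsE ler_normD. Qed.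

Lemma cabsM z w : cabs (z * w) = cabs z * cabs w.
Proof. by apply: complexI; rewrite rmorphM /= -!cabsE normrM. Qed.

Lemma cabsX z n : cabs (z ^+ n) = cabs z ^+ n.
Proof. by apply: complexI; rewrite rmorphXn /= -!cabsE normrX. Qed.

Lemma cabsV z : cabs z^-1 = (cabs z)^-1.
Proof. by apply: complexI; rewrite fmorphV /= -!cabsE normfV. Qed.

Lemma cabsN z : cabs (- z) = cabs z.
Proof. by rewrite /cabs normrN. Qed.

Lemma cabsB z w : cabs (z - w) <= cabs z + cabs w.
Proof. by rewrite -(cabsN w) cabsD. Qed.

Lemma cabsC z w : cabs (z - w) = cabs (w - z).
Proof. by rewrite -cabsN opprB. Qed.

Lemma cabs0 : cabs 0 = 0.
Proof. by rewrite /cabs normr0. Qed.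

Lemma cabs1 : cabs 1 = 1.
Proof. by rewrite /cabs normr1. Qed.

Lemma cabs_eq0 z : (cabs z == 0) = (z == 0).
Proof. by rewrite -(inj_eq (@complexI R)) -cabsE normr_eq0. Qed.

Lemma cabs_gt0 z : (0 < cabs z) = (z != 0).
Proof. by rewrite lt_neqAle cabs_ge0 andbT eq_sym cabs_eq0. Qed.

Lemma cabs_real (x : R) : cabs x%:C = `|x|.
Proof. by rewrite /cabs normc_def /= expr0n /= addr0 sqrtr_sqr. Qed.

Lemma cabs_nat n : cabs n%:R = n%:R.
Proof. by rewrite /cabs normr_nat -(rmorph_nat (real_complex R)). Qed.

Lemma cabs_sqr z : cabs z ^+ 2 = complex.Re z ^+ 2 + complex.Im z ^+ 2.
Proof. by apply: complexI; rewrite rmorphXn /= -cabsE -add_Re2_Im2. Qed.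

Lemma cabs_Re z : `|complex.Re z| <= cabs z.
Proof. by rewrite -lecR -cabsE normc_ge_Re. Qed.

Lemma cabs_Im z : `|complex.Im z| <= cabs z.
Proof.
rewrite -ler_sqr ?nnegrE ?cabs_ge0 ?normr_ge0 // cabs_sqr real_normK ?num_real //.
by rewrite lerDr sqr_ge0.
Qed.

Lemma cabs_le_ReIm z : cabs z <= `|complex.Re z| + `|complex.Im z|.
Proof.
rewrite -ler_sqr ?nnegrE ?cabs_ge0 ?addr_ge0 // cabs_sqr sqrrD.
rewrite !real_normK ?num_real // -addrA lerD2l addrC lerDl.
by rewrite mulrn_wge0 // mulr_ge0.
Qed.

Lemma cabs_sum (I : Type) (r : seq I) (P : pred I) (F : I -> Cx R) :
  cabs (\sum_(i <- r | P i) F i) <= \sum_(i <- r | P i) cabs (F i).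
Proof.
elim/big_rec2: _ => [|i y x _ le_xy]; first by rewrite cabs0.
by rewrite (le_trans (cabsD _ _)) // lerD2l.
Qed.

(** A positive radius in [Cx R] is real, so convergence there amounts to convergence of a real
    distance, to which squeezing and comparison apply. *)
Lemma cvg_cabsP (T : Type) (F : set_system T) (FF : Filter F)
    (f : T -> Cx R) (l : Cx R) :
  f @ F --> l <-> (fun x => cabs (f x - l)) @ F --> (0 : R).
Proof.
split => [/cvgrPdist_lt fl|/cvgrPdist_lt fl].
  apply/cvgrPdist_lt => e e0; have /fl : 0 < e%:C by rewrite ltcR.
  apply: filterS => x; rewrite cabsE ltcR cabsC.
  by rewrite sub0r normrN (ger0_norm (cabs_ge0 _)).
apply/cvgrPdist_lt => e e0.
have eE : (complex.Re e)%:C = e by rewrite RRe_real // gtr0_real.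
have := fl (complex.Re e); rewrite -ltcR eE => /(_ e0).
apply: filterS => x; rewrite sub0r normrN ger0_norm ?cabs_ge0 //.
by rewrite cabsE -eE ltcR cabsC.
Qed.

Lemma cvg_cabs_le (T : Type) (F : set_system T) (FF : Filter F)
    (f : T -> Cx R) (l : Cx R) (g : T -> R) :
  (\forall x \near F, cabs (f x - l) <= g x) -> g @ F --> (0 : R) ->
  f @ F --> l.
Proof.
move=> fg g0; apply/cvg_cabsP.
apply: (squeeze_cvgr _ (cvg_cst 0) g0).
by apply: filterS fg => x ->; rewrite cabs_ge0.
Qed.

Lemma cvg_cabs (T : Type) (F : set_system T) (FF : Filter F)
    (f : T -> Cx R) (l : Cx R) :
  f @ F --> l -> (cabs \o f) @ F --> cabs l.
Proof.
move=> /cvg_cabsP fl; apply/cvgrPdist_le => e e0.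
move/cvgrPdist_le : fl => /(_ e e0); apply: filterS => x.
rewrite sub0r normrN ger0_norm ?cabs_ge0 // => le_e.
rewrite (le_trans _ le_e)//= ler_norml; have := cabsD (f x - l) l.
have := cabsD (l - f x) (f x); rewrite !subrK (cabsC l); lra.
Qed.

Lemma cabs_lim_le (f : nat -> Cx R) l (c : R) :
  f @ \oo --> l -> (\forall n \near \oo, cabs (f n) <= c) -> cabs l <= c.
Proof. by move=> /cvg_cabs fl fc; apply: (cvgr_to_le fl). Qed.

Lemma cvg_ReIm (f : nat -> Cx R) (x y : R) :
  (fun n => complex.Re (f n)) @ \oo --> x ->
  (fun n => complex.Im (f n)) @ \oo --> y ->
  f @ \oo --> (x +i* y : Cx R).
Proof.
move=> fx fy.
apply: (@cvg_cabs_le _ _ _ _ _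
  (fun n => `|complex.Re (f n) - x| + `|complex.Im (f n) - y|)).
  apply: nearW => n; apply: le_trans (cabs_le_ReIm _) _.
  by case: (f n).
rewrite -[0]addr0; apply: cvgD; rewrite -[0](@normr0 _ R).
  by apply: cvg_norm; rewrite -(subrr x); apply: cvgB => //; apply: cvg_cst.
by apply: cvg_norm; rewrite -(subrr y); apply: cvgB => //; apply: cvg_cst.
Qed.

(** The real and imaginary parts are absolutely convergent real series. *)
Lemma dominated_series_cvg (a : nat -> Cx R) b :
  cvgn (series b) -> (forall n, cabs (a n) <= b n) -> cvgn (series a).
Proof.
move=> bc ab; have b0 n : 0 <= b n by apply: le_trans (ab n); apply: cabs_ge0.
have ReE n : complex.Re (series a n) = series (fun k => complex.Re (a k)) n.
  rewrite /series /=; elim: n => [|n IHn]; first by rewrite !big_geq.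
  by rewrite !big_nat_recr //= -IHn; case: (\sum_(_ <= _ < _) _); case: (a n).
have ImE n : complex.Im (series a n) = series (fun k => complex.Im (a k)) n.
  rewrite /series /=; elim: n => [|n IHn]; first by rewrite !big_geq.
  by rewrite !big_nat_recr //= -IHn; case: (\sum_(_ <= _ < _) _); case: (a n).
have Rec : cvgn (series (fun k => complex.Re (a k))).
  apply: normed_cvg; apply: series_le_cvg bc => n //=.
  by apply: le_trans (ab n); apply: cabs_Re.
have Imc : cvgn (series (fun k => complex.Im (a k))).
  apply: normed_cvg; apply: series_le_cvg bc => n //=.
  by apply: le_trans (ab n); apply: cabs_Im.
apply/cvg_ex; eexists; apply: cvg_ReIm.
- by under eq_fun do rewrite ReE; exact: Rec.
- by under eq_fun do rewrite ImE; exact: Imc.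
Qed.

Lemma series_tail_small b (e : R) : cvgn (series b) -> 0 < e ->
  \forall K \near \oo, forall m, (K <= m)%N -> \sum_(K <= k < m) b k < e.
Proof.
move=> /cauchy_cvgP /cauchy_seriesP /(_ e) bc /bc [[/= U V] [HU [N _ NV]] UV].
near=> K => m Km; apply: le_lt_trans (ler_norm _) _.
apply: (UV (K, m)); split => /=.
  by near: K.
apply: NV => /=; apply: leq_trans Km.
by near: K; exact: nbhs_infty_ge.
Unshelve. all: by end_near. Qed.

Lemma cvg_sum_nat (T : Type) (F : set_system T) (FF : Filter F) (V : normedModType (Cx R))
    (f : nat -> T -> V) (l : nat -> V) m n :
  (forall k, (m <= k < n)%N -> f k @ F --> l k) ->
  (fun x => \sum_(m <= k < n) f k x) @ F --> \sum_(m <= k < n) l k.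
Proof.
elim: n => [|n IHn] fl.
  by under eq_fun do rewrite big_geq //; rewrite big_geq //; apply: cvg_cst.
have [mn|nm] := leqP m n; last first.
  by under eq_fun do rewrite big_geq //; rewrite big_geq //; apply: cvg_cst.
under eq_fun do rewrite big_nat_recr //=; rewrite big_nat_recr //=.
apply: cvgD; last by apply: fl; rewrite mn /=.
by apply: IHn => k /andP[mk kn]; apply: fl; rewrite mk ltnW.
Qed.

(** Dominated convergence for sums whose length also varies. Cut at a fixed K: the head converges
    termwise, the rest is below the tail of [b], and the partial sum of [A] at K is close to [l]. *)
Lemma tannery (a : nat -> nat -> Cx R) (A : nat -> Cx R) b
    (p : nat -> nat) (l : Cx R) :
  cvgn (series b) ->
  (\forall n \near \oo, forall k, (k < p n)%N -> cabs (a n k) <= b k) ->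
  (forall k, (fun n => a n k) @ \oo --> A k) ->
  (forall k, \forall n \near \oo, (k <= p n)%N) ->
  series A @ \oo --> l ->
  (fun n => \sum_(0 <= k < p n) a n k) @ \oo --> l.
Proof.
move=> bc ab aA pinf Al; apply/cvg_cabsP/cvgrPdist_lt => e e0.
have e3 : 0 < e / 3 by rewrite divr_gt0.
have [K [HK1 HK2]] : exists K, (forall m, (K <= m)%N -> \sum_(K <= k < m) b k < e / 3) /\
    cabs (series A K - l) < e / 3.
  have H1 := series_tail_small bc e3.
  have H2 : \forall K \near \oo, cabs (series A K - l) < e / 3.
    move/cvg_cabsP/cvgrPdist_lt : Al => /(_ _ e3); apply: filterS => x.
    by rewrite sub0r normrN ger0_norm // cabs_ge0.
  by have [K _ HK] := filterI H1 H2; exists K; apply: HK => /=.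
have H3 : \forall n \near \oo, cabs (\sum_(0 <= k < K) a n k - series A K) < e / 3.
  have : (fun n => \sum_(0 <= k < K) a n k) @ \oo --> series A K.
    by apply: cvg_sum_nat => k _; apply: aA.
  move/cvg_cabsP/cvgrPdist_lt => /(_ _ e3); apply: filterS => x.
  by rewrite sub0r normrN ger0_norm // cabs_ge0.
near=> n.
rewrite sub0r normrN ger0_norm ?cabs_ge0 //.
have Kp : (K <= p n)%N by near: n; apply: pinf.
have Hs1 : cabs (\sum_(0 <= i < K) a n i - series A K) < e / 3 by near: n.
have Hab : forall k, (k < p n)%N -> cabs (a n k) <= b k by near: n.
rewrite (@big_cat_nat _ _ _ K) //=.
set s1 := \sum_(0 <= i < K) _; set s2 := \sum_(K <= i < _) _.
have -> : s1 + s2 - l = (s1 - series A K) + s2 + (series A K - l) by ring.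
apply: le_lt_trans (cabsD _ _) _; apply: le_lt_trans (lerD (cabsD _ _) (lexx _)) _.
have : cabs (s1 - series A K) < e / 3 by [].
have : cabs s2 < e / 3.
  apply: le_lt_trans (cabs_sum _ _ _) _; apply: le_lt_trans (HK1 _ Kp).
  rewrite !big_nat; apply: ler_sum => k /andP[_ kp].
  exact: Hab.
lra.
Unshelve. all: by end_near. Qed.

(** The criterion behind the derivatives of the exponential, of the Lambert series and of the Euler
    product: a quadratic bound on the remainder can be summed over a series and survives a limit. *)
Lemma is_derive_quadratic (f : Cx R -> Cx R) (x d : Cx R) (C : R) :
  (\forall h \near (0 : Cx R), cabs (f (x + h) - f x - h * d) <= C * cabs h ^+ 2) ->
  is_derive x (1 : Cx R) f d.
Proof.
move=> fC.
have : (fun h : Cx R => h^-1 *: ((f \o shift x) (h *: 1) - f x)) @ (0 : Cx R)^' --> d.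
  apply: (@cvg_cabs_le _ _ _ _ _ (fun h : Cx R => C * cabs h)).
    near=> h; have h0 : h != 0 by near: h; exact: nbhs_dnbhs_neq.
    have -> : h^-1 *: ((f \o shift x) (h *: 1) - f x) - d =
        h^-1 * (f (x + h) - f x - h * d).
      rewrite /= -[h *: 1]/(h * 1) mulr1 (addrC h x) -[_ *: _]/(_ * _).
      by rewrite [RHS]mulrBr (mulKf h0).
    rewrite cabsM cabsV ler_pdivrMl ?cabs_gt0 // mulrCA -expr2.
    by near: h; apply: nbhs_dnbhs.
  rewrite -[X in _ --> X](mulr0 C); apply: cvgMr.
  rewrite -cabs0; apply: cvg_cabs; apply: cvg_within.
move=> fd; apply: DeriveDef; last exact/cvg_lim.
by apply/cvg_ex; exists d.
Unshelve. all: by end_near. Qed.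

(** * The complex exponential and its derivative *)

Lemma cexpD z w : cexp (z + w) = cexp z * cexp w.
Proof.
case: z w => [a b] [c d]; rewrite /cexp /= expRD cosD sinD.
apply/eqP; rewrite eq_complex /=; apply/andP; split; apply/eqP; ring.
Qed.

Lemma cexp0 : cexp (0 : Cx R) = 1.
Proof. by rewrite /cexp /= expR0 cos0 sin0 mul1r. Qed.

Lemma cexp_neq0 z : cexp z != 0.
Proof.
apply/eqP => z0; have := cexpD z (- z).
by rewrite subrr cexp0 z0 mul0r => /eqP; rewrite oner_eq0.
Qed.

Lemma cexpMn z n : cexp (n%:R * z) = cexp z ^+ n.
Proof.
elim: n => [|n IHn]; first by rewrite mul0r cexp0 expr0.
by rewrite -natr1 mulrDl mul1r cexpD IHn exprSr.
Qed.

Lemma cabs_cexp z : cabs (cexp z) = expR (complex.Re z).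
Proof.
rewrite /cexp cabsM cabs_real ger0_norm ?expR_ge0 //.
suff -> : cabs (cos (complex.Im z) +i* sin (complex.Im z)) = 1 by rewrite mulr1.
apply/eqP; rewrite -(@eqrXn2 _ 2) // ?cabs_ge0 // cabs_sqr /=.
by rewrite cos2Dsin2 expr1n.
Qed.

Lemma sin_mvt (x : R) : 0 <= x -> exists2 c, 0 <= c <= x & sin x = x * cos c.
Proof.
move=> x0; have [|c cx] := @MVT_segment R sin cos 0 x x0 (fun y _ => is_derive_sin y).
  by apply: continuous_subspaceT => y; exact: continuous_sin.
rewrite sin0 !subr0 => ->; exists c; last by rewrite mulrC.
by move: cx; rewrite in_itv.
Qed.

Lemma sin_le (x : R) : 0 <= x -> `|sin x| <= x.
Proof.
move=> x0; have [c _ ->] := sin_mvt x0.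
by rewrite normrM ger0_norm // ler_piMr // cos_max.
Qed.

Lemma sin_abs_le (x : R) : `|sin x| <= `|x|.
Proof.
case: (leP 0 x) => [x0|x0]; first by rewrite (ger0_norm x0) sin_le.
by rewrite -normrN -sinN (ltr0_norm x0) sin_le // oppr_ge0 ltW.
Qed.

Lemma cos_quadratic (x : R) : `|cos x - 1| <= x ^+ 2.
Proof.
have -> : cos x - 1 = - (sin (x / 2) ^+ 2 *+ 2).
  rewrite {1}[x]splitr cosD -!expr2.
  by have := cos2Dsin2 (x / 2); set c := cos _; set s := sin _; lra.
rewrite normrN normrMn normrX.
have := sin_abs_le (x / 2); rewrite normrM (@ger0_norm _ 2^-1) ?invr_ge0 // => H.
have : `|sin (x / 2)| ^+ 2 <= (`|x| / 2) ^+ 2.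
  by rewrite lerXn2r ?nnegrE ?divr_ge0.
rewrite exprMn (real_normK (num_real x)); have := sqr_ge0 x; lra.
Qed.

Lemma sin_quadratic (x : R) : `|x| <= 1 -> `|sin x - x| <= x ^+ 2.
Proof.
wlog x0 : x / 0 <= x => [hw|x1].
  case: (leP 0 x) => [/hw//|x0 x1]; have := hw (- x).
  rewrite normrN sinN oppr_ge0 (ltW x0) sqrrN => /(_ isT x1).
  by rewrite -opprD normrN.
have [c /andP[c0 cx] ->] := sin_mvt x0.
have -> : x * cos c - x = x * (cos c - 1) by ring.
rewrite normrM; move: x1; rewrite ger0_norm // => x1.
apply: le_trans (_ : x * c ^+ 2 <= _); first by rewrite ler_wpM2l ?cos_quadratic.
have c1 := le_trans cx x1.
rewrite [leRHS]expr2 ler_wpM2l // expr2; apply: le_trans cx.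
by rewrite ler_piMl.
Qed.

(** Both bounds come from 1 + t <= exp t: at t = x for the lower one, and at t = -x, in the form (1
    - x) exp x <= 1, for the upper one. *)
Lemma expR_quadratic (x : R) : `|x| <= 1 / 2 -> `|expR x - 1 - x| <= 2 * x ^+ 2.
Proof.
move=> x2; have xlt : x < 1 by apply: le_lt_trans (ler_norm _) _; lra.
have H1 := expR_ge1Dx x; have := expR_ge1Dx (- x); rewrite expRN => H2.
rewrite ger0_norm; last lra.
have [xa xb] : - (1/2) <= x /\ x <= 1/2 by apply/andP; rewrite -ler_norml.
have e0 := expR_gt0 x.
have H3 : (1 - x) * expR x <= 1.
  by rewrite -ler_pdivlMr // div1r; lra.
have -> : expR x - 1 - x = (expR x * (1 - x) - (1 - x ^+ 2)) / (1 - x) by field; lra.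
rewrite ler_pdivrMr; last lra.
have := sqr_ge0 x; nra.
Qed.

Lemma cexp_quadratic w : cabs w <= 1 / 2 ->
  cabs (cexp w - 1 - w) <= 20 * cabs w ^+ 2.
Proof.
move=> w2; set x := complex.Re w; set y := complex.Im w.
have hx : `|x| <= 1 / 2 by apply: le_trans w2; apply: cabs_Re.
have hy : `|y| <= 1 / 2 by apply: le_trans w2; apply: cabs_Im.
have := expR_quadratic hx; have := cos_quadratic y; have hy1 : `|y| <= 1 by lra.
have := sin_quadratic hy1.
rewrite cabs_sqr -/x -/y => hs hc he.
apply: le_trans (cabs_le_ReIm _) _.
have -> : complex.Re (cexp w - 1 - w) =
   (expR x - 1 - x) * cos y + x * (cos y - 1) + (cos y - 1).
  by rewrite /cexp; case: (w) @x @y {hx hy hs hc he hy1} => a b /=; ring.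
have -> : complex.Im (cexp w - 1 - w) =
   (expR x - 1 - x) * sin y + x * sin y + (sin y - y).
  by rewrite /cexp; case: (w) @x @y {hx hy hs hc he hy1} => a b /=; ring.
have M (a b : R) : `|a * b| <= `|a| * `|b| by rewrite normrM.
have xx : x ^+ 2 = `|x| ^+ 2 by rewrite real_normK ?num_real.
have yy : y ^+ 2 = `|y| ^+ 2 by rewrite real_normK ?num_real.
have hcy := cos_max y; have hsy := sin_max y; have hsy' := sin_abs_le y.
have T (a b c : R) : `|a + b + c| <= `|a| + `|b| + `|c|.
  by apply: le_trans (ler_normD _ _) _; rewrite lerD2r ler_normD.
apply: le_trans (lerD (T _ _ _) (T _ _ _)) _.
rewrite !normrM.
have h1 : `|expR x - 1 - x| * `|cos y| <= 2 * x ^+ 2.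
  by apply: le_trans he; rewrite ler_piMr.
have h2 : `|expR x - 1 - x| * `|sin y| <= 2 * x ^+ 2.
  by apply: le_trans he; rewrite ler_piMr.
have h3 : `|x| * `|cos y - 1| <= y ^+ 2.
  apply: le_trans (_ : 1 * y ^+ 2 <= _); last by rewrite mul1r.
  by apply: ler_pM => //; lra.
have h4 : `|x| * `|sin y| <= x ^+ 2 + y ^+ 2.
  apply: le_trans (_ : `|x| * `|y| <= _); first by rewrite ler_wpM2l.
  rewrite xx yy; nra.
(* The six terms add up to at most 5 x^2 + 4 y^2; the constant 20 is only a crude bound. *)
have := sqr_ge0 x; have := sqr_ge0 y; lra.
Qed.

Lemma is_derive_cexp z : is_derive z (1 : Cx R) (@cexp R) (cexp z).
Proof.
apply: (@is_derive_quadratic _ _ _ (cabs (cexp z) * 20)).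
have : \forall h \near (0 : Cx R), cabs h < 1 / 2.
  have /cvg_cabsP/cvgrPdist_lt : id @ (0 : Cx R) --> (0 : Cx R) by exact: cvg_id.
  move=> /(_ (1/2)) []; first by rewrite divr_gt0.
  move=> e /= e0 He; exists e => // w /He; rewrite sub0r normrN subr0.
  by rewrite ger0_norm // cabs_ge0.
apply: filterS => h /ltW /cexp_quadratic h2.
have -> : cexp (z + h) - cexp z - h * cexp z = cexp z * (cexp h - 1 - h).
  by rewrite cexpD; ring.
by rewrite cabsM -mulrA ler_wpM2l ?cabs_ge0.
Qed.

End ComplexAnalysis.

(** * The finite convolution identity behind Ramanujan's formula *)

Section FiniteConvolution.
Context {K : numFieldType}.
Implicit Types (u : nat -> K) (m n N M : nat).

Lemma sum_triangle (g : nat -> nat -> K) M :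
  \sum_(0 <= m < M) \sum_(0 <= n < M - m) g m n =
  \sum_(0 <= N < M) \sum_(0 <= m < N.+1) g m (N - m)%N.
Proof.
elim: M => [|M IHM]; first by rewrite !big_geq.
rewrite [RHS]big_nat_recr //= -IHM.
rewrite (eq_big_nat _ _ (F2 := fun m => \sum_(0 <= n < M - m) g m n + g m (M - m)%N)).
  by rewrite big_split /=; congr (_ + _); rewrite big_nat_recr //= subnn (big_geq (leqnn 0)) addr0.
by move=> m /andP[_ mM]; rewrite subSn // big_nat_recr.
Qed.

Lemma sum_square (g : nat -> nat -> K) M : (forall m n, g m n = g n m) ->
  \sum_(0 <= m < M) \sum_(0 <= n < M) g m n =
  2 * \sum_(0 <= N < M) \sum_(0 <= m < N) g m N + \sum_(0 <= N < M) g N N.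
Proof.
move=> gC; elim: M => [|M IHM]; first by rewrite !big_geq // mulr0 addr0.
rewrite big_nat_recr //= [in X in _ + X]big_nat_recr //=.
under eq_bigr do rewrite big_nat_recr //=.
rewrite big_split /= IHM !big_nat_recr //=.
rewrite [\sum_(0 <= i < M) g M i](eq_bigr (fun m => g m M)) => [|m _]; last by rewrite gC.
ring.
Qed.

(** A symmetric form whose values at (m, N) and (m, N - m) differ by exactly 2 m N: subtracting the
    triangle m + n < M from the square then leaves products (m u_m)(N u_N), which assemble into the
    square of \sum_n n u_n. *)
Definition ramanujan_weight m n : K := m%:R ^+ 2 + n%:R ^+ 2 + m%:R * n%:R.

Lemma sum_ramanujan_weight N : (0 < N)%N ->
  \sum_(1 <= m < N) ramanujan_weight m (N - m) =
  (5 * N%:R ^+ 3 - 6 * N%:R ^+ 2 + N%:R) / 6.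
Proof.
move=> N0.
rewrite (eq_big_nat _ _ (F2 := fun m => N%:R ^+ 2 - N%:R * m%:R + m%:R ^+ 2)); last first.
  by move=> m /andP[_ /ltnW mN]; rewrite /ramanujan_weight natrB //; ring.
have H n : (0 < n)%N -> \sum_(1 <= m < n) (N%:R ^+ 2 - N%:R * m%:R + m%:R ^+ 2) =
   N%:R ^+ 2 * (n%:R - 1) - N%:R * n%:R * (n%:R - 1) / 2
   + (n%:R - 1) * n%:R * (2 * n%:R - 1) / 6 :> K.
  elim: n => // [] [_ _|n IHn _]; first by rewrite big_geq //; field.
  by rewrite big_nat_recr //= IHn // -[n.+2%:R]natr1; field.
by rewrite H //; field.
Qed.

(* The truncation error [m + n >= M] of the square sum is expressed by sums
   over a single index. *)
Lemma ramanujan_finite u M : u 0%N = 0 ->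
  (forall m n, (0 < m)%N -> (0 < n)%N ->
     u m * u n = u (m + n)%N * (1 + u m + u n)) ->
  \sum_(0 <= m < M) \sum_(M - m <= n < M) ramanujan_weight m n * (u m * u n) =
  2 * (\sum_(0 <= n < M) n%:R * u n) ^+ 2
  + \sum_(0 <= n < M) n%:R ^+ 2 * u n ^+ 2
  - \sum_(0 <= n < M) (5 * n%:R ^+ 3 - 6 * n%:R ^+ 2 + n%:R) / 6 * u n.
Proof.
move=> u0 uu; pose f := ramanujan_weight.
pose g m n := f m n * (u m * u n).
have fC m n : f m n = f n m by rewrite /f /ramanujan_weight; ring.
have gC m n : g m n = g n m by rewrite /g fC mulrC [u m * _]mulrC mulrC.
have sq : \sum_(0 <= m < M) \sum_(0 <= n < M) g m n =
    \sum_(0 <= m < M) \sum_(0 <= n < M - m) g m n +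
    \sum_(0 <= m < M) \sum_(M - m <= n < M) g m n.
  rewrite -big_split /=; apply: eq_bigr => m _.
  by rewrite -big_cat_nat //= leq_subr.
have -> : \sum_(0 <= m < M) \sum_(M - m <= n < M) f m n * (u m * u n) =
   \sum_(0 <= m < M) \sum_(0 <= n < M) g m n -
   \sum_(0 <= m < M) \sum_(0 <= n < M - m) g m n.
  by rewrite sq addrC addKr.
rewrite sum_triangle (sum_square M gC).
(* By the functional equation an antidiagonal gives [u N] times its total weight, plus two sums
   exchanged by m <-> N - m, hence twice one of them. *)
have inner N : \sum_(0 <= m < N.+1) g m (N - m)%N =
   (5 * N%:R ^+ 3 - 6 * N%:R ^+ 2 + N%:R) / 6 * u N +
   2 * \sum_(0 <= m < N) f m (N - m)%N * (u m * u N).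
  case: N => [|N].
    by rewrite big_nat1 big_geq // /g u0 !mulr0 addr0.
  rewrite big_nat_recr //= {2}/g subnn u0 !mulr0 addr0.
  rewrite !(big_ltn (ltn0Sn N)) {1}/g u0 !mul0r !mulr0 !add0r.
  rewrite -sum_ramanujan_weight // mulr_suml mulr_sumr.
  have -> : \sum_(1 <= i < N.+1) g i (N.+1 - i)%N =
     \sum_(1 <= i < N.+1) (f i (N.+1 - i)%N * u N.+1 + f i (N.+1 - i)%N * (u i * u N.+1)
       + f (N.+1 - i)%N i * (u (N.+1 - i)%N * u N.+1)).
    apply: eq_big_nat => i /andP[i0 iN].
    rewrite /g uu ?subn_gt0 // subnKC 1?ltnW // (fC (N.+1 - i)%N); ring.
  rewrite !big_split /= -addrA; congr (_ + _).
  rewrite -mulr_sumr mulr_natl mulr2n; congr (_ + _).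
  rewrite [LHS]big_nat_rev /=; apply: eq_big_nat => i /andP[i0 iN].
  by rewrite !add1n subSS subKn // ltnW.
rewrite [X in _ + _ - X](eq_bigr _ (fun N _ => inner N)) big_split /=.
have -> : (\sum_(0 <= n < M) n%:R * u n) ^+ 2 =
   \sum_(0 <= m < M) \sum_(0 <= n < M) (m%:R * u m) * (n%:R * u n).
  by rewrite expr2 mulr_suml; apply: eq_bigr => m _; rewrite mulr_sumr.
rewrite sum_square; last by move=> m n; rewrite mulrC.
rewrite -[X in _ - (_ + X)]mulr_sumr.
have -> : \sum_(0 <= N < M) \sum_(0 <= m < N) g m N =
  \sum_(0 <= N < M) \sum_(0 <= m < N) f m (N - m)%N * (u m * u N) +
  2 * \sum_(0 <= N < M) \sum_(0 <= m < N) (m%:R * u m) * (N%:R * u N).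
  rewrite mulr_sumr -big_split /=; apply: eq_bigr => N _.
  rewrite mulr_sumr -big_split /=; apply: eq_big_nat => m /andP[_ /ltnW mN].
  by rewrite /g /f /ramanujan_weight natrB //; ring.
have -> : \sum_(0 <= N < M) g N N = 3 * \sum_(0 <= n < M) n%:R ^+ 2 * u n ^+ 2.
  by rewrite mulr_sumr; apply: eq_bigr => N _; rewrite /g /f /ramanujan_weight; ring.
have -> : \sum_(0 <= N < M) N%:R * u N * (N%:R * u N) =
   \sum_(0 <= n < M) n%:R ^+ 2 * u n ^+ 2.
  by apply: eq_bigr => N _; ring.
ring.
Qed.

End FiniteConvolution.

(** * Lambert series, their termwise derivatives, and Ramanujan's identity *)

Section SeriesDerivative.
Context {R : realType}.

(** Bernoulli's inequality provides s < 1 with r <= s^(p+1). Then k^p r^k <= (k s^k)^p s^k, and k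
    s^k <= 1 / (1 - s) because s^k is below each term of the geometric sum. *)
Lemma cvg_series_natX_geometric (p : nat) (r : R) : 0 <= r < 1 ->
  cvgn (series (fun k => k%:R ^+ p * r ^+ k)).
Proof.
move=> /andP[r0 r1].
pose s : R := 1 - (1 - r) / p.+1%:R.
have p0 : 0 < p.+1%:R :> R by rewrite ltr0n.
have t0 : 0 < (1 - r) / p.+1%:R by rewrite divr_gt0 // subr_gt0.
have t1 : (1 - r) / p.+1%:R <= 1.
  by rewrite ler_pdivrMr // mul1r (le_trans (_ : _ <= 1)) ?ler1n //; lra.
have s0 : 0 <= s by rewrite subr_ge0.
have s1 : s < 1 by rewrite ltrBlDr ltrDl.
have rs : r <= s ^+ p.+1.
  have B n (x : R) : 0 <= x <= 1 -> 1 - n%:R * x <= (1 - x) ^+ n.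
    move=> /andP[x0 x1]; elim: n => [|n IHn]; first by rewrite mul0r subr0 expr0.
    rewrite exprS; apply: le_trans (_ : (1 - x) * (1 - n%:R * x) <= _).
      have : 0 <= n%:R * x ^+ 2 by rewrite mulr_ge0 ?sqr_ge0.
      by rewrite -natr1; nra.
    by rewrite ler_wpM2l // subr_ge0.
  have := B p.+1 ((1 - r) / p.+1%:R); rewrite (ltW t0) t1 => /(_ isT).
  by rewrite mulrCA divff ?gt_eqF // mulr1 opprB addrCA subrr addr0.
have ks k : k%:R * s ^+ k <= (1 - s)^-1.
  rewrite -[leRHS]mul1r ler_pdivlMr ?subr_gt0 //.
  have -> : k%:R * s ^+ k = \sum_(0 <= i < k) s ^+ k.
    by rewrite sumr_const_nat subn0 mulr_natl.
  apply: le_trans (_ : (\sum_(0 <= i < k) s ^+ i) * (1 - s) <= _).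
    rewrite ler_wpM2r ?subr_ge0 ?(ltW s1) // !big_nat; apply: ler_sum => i /andP[_ ik].
    by rewrite ler_wiXn2l ?(ltW s1) // ltnW.
  rewrite big_mkord mulrC -opprB mulNr -subrX1 opprB.
  by rewrite lerBlDr lerDl exprn_ge0.
apply: (@series_le_cvg _ _ (fun k => (1 - s)^-1 ^+ p * s ^+ k)).
- by move=> k; rewrite mulr_ge0 // exprn_ge0.
- by move=> k; rewrite mulr_ge0 // exprn_ge0 // invr_ge0 subr_ge0 ltW.
- move=> k; apply: le_trans (_ : k%:R ^+ p * (s ^+ p.+1) ^+ k <= _).
    by rewrite ler_wpM2l ?exprn_ge0 // lerXn2r ?nnegrE ?exprn_ge0.
  rewrite -exprM mulSn exprD mulrCA [_ * (s ^+ _)]mulrC -[(p * k)%N]mulnC exprM -exprMn.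
  rewrite mulrC [s ^+ k * k%:R]mulrC.
  rewrite ler_wpM2r ?exprn_ge0 // lerXn2r ?nnegrE ?mulr_ge0 ?exprn_ge0 //.
  by rewrite invr_ge0 subr_ge0 ltW.
- apply: is_cvg_geometric_series; by rewrite ger0_norm.
Qed.

Lemma near_cabs_lt (e : R) : 0 < e -> \forall h \near (0 : Cx R), cabs h < e.
Proof.
move=> e0; have /cvg_cabsP/cvgrPdist_lt /(_ _ e0) : id @ (0 : Cx R) --> (0 : Cx R).
  exact: cvg_id.
by apply: filterS => h; rewrite subr0 sub0r normrN ger0_norm // cabs_ge0.
Qed.

(** Since C does not depend on n, the quadratic remainder bound passes to the limit at each fixed
    h. *)
Lemma lim_is_derive (F : nat -> Cx R -> Cx R) (d : nat -> Cx R) (x D : Cx R)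
    (f : Cx R -> Cx R) (C e : R) : 0 < e ->
  (forall n h, cabs h < e ->
     cabs (F n (x + h) - F n x - h * d n) <= C * cabs h ^+ 2) ->
  (forall h, cabs h < e -> F ^~ (x + h) @ \oo --> f (x + h)) ->
  d @ \oo --> D -> is_derive x (1 : Cx R) f D.
Proof.
move=> e0 FC Ff dD; apply: (@is_derive_quadratic _ _ _ _ C).
have := near_cabs_lt e0; apply: filterS => h he.
apply: (@cabs_lim_le _ (fun n => F n (x + h) - F n x - h * d n)).
  apply: cvgB; last exact: cvgMr.
  apply: cvgB; first exact: Ff.
  by have := Ff 0; rewrite cabs0 addr0; apply.
by apply: nearW => n; apply: FC.
Qed.

Lemma partial_sum_le_lim (M : nat -> R) N : (forall n, 0 <= M n) ->
  cvgn (series M) -> series M N <= limn (series M).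
Proof.
move=> M0 Mc; apply: nondecreasing_cvgn_le => //.
by apply/nondecreasing_seqP => n; rewrite /series /= big_nat_recr //= lerDl.
Qed.

Lemma series_is_derive (f : nat -> Cx R -> Cx R) (d : nat -> Cx R)
    (M : nat -> R) (x : Cx R) (e : R) : 0 < e ->
  (forall n h, cabs h < e ->
     cabs (f n (x + h) - f n x - h * d n) <= M n * cabs h ^+ 2) ->
  (forall n, 0 <= M n) -> cvgn (series M) ->
  (forall h, cabs h < e -> cvgn (series (f ^~ (x + h)))) ->
  cvgn (series d) ->
  is_derive x (1 : Cx R) (fun w => limn (series (f ^~ w))) (limn (series d)).
Proof.
move=> e0 fM M0 Mc fc dc.
apply: (@lim_is_derive (fun N w => series (f ^~ w) N) (series d) _ _ _
  (limn (series M)) e) => // N h he.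
have -> : series (f ^~ (x + h)) N - series (f ^~ x) N - h * series d N =
   \sum_(0 <= n < N) (f n (x + h) - f n x - h * d n).
  by rewrite /series /= mulr_sumr -!sumrB.
apply: le_trans (cabs_sum _ _ _) _.
apply: le_trans (_ : (\sum_(0 <= n < N) M n) * cabs h ^+ 2 <= _).
  by rewrite mulr_suml ler_sum // => n _; apply: fM.
by rewrite ler_wpM2r ?exprn_ge0 ?cabs_ge0 //; apply: partial_sum_le_lim.
Qed.

(** The factor r on the left stands for r^(n-1) on the right: it avoids a truncated exponent and
    leaves r^n, summable against powers of n. The factor r^2 of the next lemma has the same
    purpose. *)
Lemma powB_linear (q w : Cx R) (r : R) n : cabs q <= r -> cabs w <= r ->
  r * cabs (w ^+ n - q ^+ n) <= n%:R * r ^+ n * cabs (w - q).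
Proof.
move=> qr wr; have r0 : 0 <= r by apply: le_trans qr; apply: cabs_ge0.
elim: n => [|n IHn]; first by rewrite subrr cabs0 mulr0 !mul0r.
have -> : w ^+ n.+1 - q ^+ n.+1 = w * (w ^+ n - q ^+ n) + (w - q) * q ^+ n.
  by rewrite !exprS; ring.
apply: le_trans (ler_wpM2l r0 (cabsD _ _)) _.
rewrite mulrDr !cabsM cabsX.
have h1 : r * (cabs w * cabs (w ^+ n - q ^+ n)) <= r * (n%:R * r ^+ n * cabs (w - q)).
  by rewrite mulrCA ler_pM ?mulr_ge0 ?cabs_ge0.
have h2 : r * (cabs (w - q) * cabs q ^+ n) <= r * (cabs (w - q) * r ^+ n).
  by rewrite ler_wpM2l // ler_wpM2l ?cabs_ge0 // lerXn2r ?nnegrE ?cabs_ge0.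
apply: le_trans (lerD h1 h2) _.
by rewrite le_eqVlt; apply/orP; left; apply/eqP; rewrite exprS -natr1; ring.
Qed.

Lemma powB_quadratic (q w : Cx R) (r : R) n : cabs q <= r -> cabs w <= r ->
  r ^+ 2 * cabs (w ^+ n - q ^+ n - (w - q) * (n%:R * q ^+ n.-1)) <=
  n%:R ^+ 2 * r ^+ n * cabs (w - q) ^+ 2.
Proof.
move=> qr wr; have r0 : 0 <= r by apply: le_trans qr; apply: cabs_ge0.
elim: n => [|n IHn].
  by rewrite !mul0r mulr0 subr0 subrr cabs0 mulr0 expr0n /= !mul0r.
pose T := w ^+ n - q ^+ n - (w - q) * (n%:R * q ^+ n.-1).
have -> : w ^+ n.+1 - q ^+ n.+1 - (w - q) * (n.+1%:R * q ^+ n.+1.-1) =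
   w * T + (w - q) ^+ 2 * (n%:R * q ^+ n.-1).
  by rewrite /T -natr1; case: (n) => [|m] /=; rewrite ?exprS ?mulr0n; ring.
apply: le_trans (ler_wpM2l (sqr_ge0 r) (cabsD _ _)) _.
rewrite mulrDr cabsM (cabsM (_ ^+ 2)) (cabsM n%:R) !cabsX cabs_nat.
have h1 : r ^+ 2 * (cabs w * cabs T) <= r * (n%:R ^+ 2 * r ^+ n * cabs (w - q) ^+ 2).
  by rewrite mulrCA ler_pM ?mulr_ge0 ?exprn_ge0 ?cabs_ge0.
have h2 : r ^+ 2 * (cabs (w - q) ^+ 2 * (n%:R * cabs q ^+ n.-1)) <=
   n%:R * r ^+ n.+1 * cabs (w - q) ^+ 2.
  case: (n) => [|m /=]; first by rewrite !mul0r !mulr0.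
  rewrite mulrCA [leRHS]mulrC ler_wpM2l ?sqr_ge0 // mulrCA ler_wpM2l //.
  rewrite -[m.+2]add2n exprD ler_wpM2l ?sqr_ge0 //.
  by rewrite lerXn2r ?nnegrE ?cabs_ge0.
apply: le_trans (lerD h1 h2) _.
have -> : r * (n%:R ^+ 2 * r ^+ n * cabs (w - q) ^+ 2) +
   n%:R * r ^+ n.+1 * cabs (w - q) ^+ 2 =
   (n%:R ^+ 2 + n%:R) * (r ^+ n.+1 * cabs (w - q) ^+ 2) by rewrite (exprS r); ring.
rewrite -mulrA ler_wpM2r ?mulr_ge0 ?exprn_ge0 ?cabs_ge0 //.
by rewrite -natr1; have : 0 <= n%:R :> R by []; lra.
Qed.

(** At n = 0 the denominator vanishes and the term is 0, so sums may start at index 0. *)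
Definition lambert (q : Cx R) (n : nat) : Cx R := q ^+ n / (1 - q ^+ n).

Definition lambert_sum k (q : Cx R) : Cx R :=
  limn (series (fun n => n%:R ^+ k * lambert q n)).

Definition lambert_dsum k (q : Cx R) : Cx R :=
  limn (series (fun n => n%:R ^+ k * (n%:R * q ^+ n.-1 / (1 - q ^+ n) ^+ 2))).

Lemma cabs_1BX (q : Cx R) (r : R) n : cabs q <= r -> r < 1 -> (0 < n)%N ->
  1 - r <= cabs (1 - q ^+ n).
Proof.
move=> qr r1 n0; have r0 : 0 <= r by apply: le_trans qr; apply: cabs_ge0.
have := cabsD (1 - q ^+ n) (q ^+ n); rewrite subrK cabs1 cabsX.
have : cabs q ^+ n <= r.
  apply: le_trans (qr); case: n n0 => // n _; rewrite exprS ler_piMr ?cabs_ge0 //.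
  by rewrite exprn_ile1 ?cabs_ge0 // (le_trans qr (ltW r1)).
lra.
Qed.

Lemma qX_neq1 (q : Cx R) n : cabs q < 1 -> (0 < n)%N -> 1 - q ^+ n != 0.
Proof.
move=> q1 n0; rewrite -cabs_gt0; apply: lt_le_trans (cabs_1BX (lexx _) q1 n0).
by rewrite subr_gt0.
Qed.

Lemma lambert0 q : lambert q 0 = 0.
Proof. by rewrite /lambert subrr invr0 mulr0. Qed.

Lemma lambert_bound (q : Cx R) (r : R) n : cabs q <= r -> r < 1 ->
  cabs (lambert q n) <= r ^+ n / (1 - r).
Proof.
move=> qr r1; have r0 : 0 <= r by apply: le_trans qr; apply: cabs_ge0.
case: n => [|n]; first by rewrite lambert0 cabs0 divr_ge0 // subr_ge0 ltW.
have H := cabs_1BX qr r1 (ltn0Sn n).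
rewrite /lambert cabsM cabsX cabsV ler_pM ?exprn_ge0 ?invr_ge0 ?cabs_ge0 //.
  by rewrite lerXn2r ?nnegrE ?cabs_ge0.
by rewrite lef_pV2 ?posrE ?subr_gt0 // (lt_le_trans _ H) // subr_gt0.
Qed.

Lemma cvg_lambert k (q : Cx R) : cabs q < 1 ->
  cvgn (series (fun n => n%:R ^+ k * lambert q n)).
Proof.
move=> q1; apply: (@dominated_series_cvg _ _
   (fun n => (1 - cabs q)^-1 * (n%:R ^+ k * cabs q ^+ n))).
  apply: (@is_cvg_seriesZ _ (fun n => n%:R ^+ k * cabs q ^+ n) (1 - cabs q)^-1).
  by apply: cvg_series_natX_geometric; rewrite cabs_ge0.
move=> n; rewrite cabsM cabsX cabs_nat mulrCA [_^-1 * _]mulrC.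
by rewrite ler_wpM2l ?exprn_ge0 // lambert_bound.
Qed.

Lemma cvg_lambert_dsum k (q : Cx R) : cabs q < 1 ->
  cvgn (series (fun n => n%:R ^+ k * (n%:R * q ^+ n.-1 / (1 - q ^+ n) ^+ 2))).
Proof.
move=> q1; pose r := (cabs q + 1) / 2.
have q0 := cabs_ge0 q.
have r0 : 0 < r by rewrite /r; lra.
have r1 : r < 1 by rewrite /r; lra.
have qr : cabs q <= r by rewrite /r; lra.
apply: (@dominated_series_cvg _ _
   (fun n => (r^-1 * (1 - r)^-1 ^+ 2) * (n%:R ^+ k.+1 * r ^+ n))).
  apply: (@is_cvg_seriesZ _ (fun n => n%:R ^+ k.+1 * r ^+ n)).
  by apply: cvg_series_natX_geometric; rewrite (ltW r0).
case=> [|n]; first by rewrite mulr0n (exprS _ k) !(mul0r, mulr0) cabs0.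
have H := cabs_1BX qr r1 (ltn0Sn n).
rewrite !(cabsX, cabsM, cabsV) cabs_nat.
have -> : r^-1 * (1 - r)^-1 ^+ 2 * (n.+1%:R ^+ k.+1 * r ^+ n.+1) =
  n.+1%:R ^+ k * (n.+1%:R * r ^+ n / (1 - r) ^+ 2).
  by rewrite !exprS expr0; field; rewrite !lt0r_neq0 // subr_gt0.
rewrite ler_wpM2l ?exprn_ge0 // ler_pM ?mulr_ge0 ?invr_ge0 ?exprn_ge0 ?cabs_ge0 //.
  by rewrite ler_wpM2l // lerXn2r ?nnegrE ?cabs_ge0 // ltW.
have r10 : 0 < 1 - r by rewrite subr_gt0.
rewrite lef_pV2 ?posrE ?exprn_gt0 ?(lt_le_trans r10 H) //.
by rewrite lerXn2r ?nnegrE ?cabs_ge0 // ltW.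
Qed.

Lemma lambert_quadratic (q w : Cx R) (r : R) n : 0 < r < 1 ->
  cabs q <= r -> cabs w <= r ->
  cabs (lambert w n - lambert q n
        - (w - q) * (n%:R * q ^+ n.-1 / (1 - q ^+ n) ^+ 2)) <=
  2 / (r ^+ 2 * (1 - r) ^+ 3) * (n%:R ^+ 2 * r ^+ n) * cabs (w - q) ^+ 2.
Proof.
move=> /andP[r0 r1] qr wr; case: n => [|n].
  by rewrite !lambert0 !(mul0r, mulr0, subrr) cabs0 expr0n /= !(mul0r, mulr0).
have := powB_linear n.+1 qr wr; have := powB_quadratic n.+1 qr wr.
have Hq := cabs_1BX qr r1 (ltn0Sn n); have Hw := cabs_1BX wr r1 (ltn0Sn n).
have q0 := qX_neq1 (le_lt_trans qr r1) (ltn0Sn n).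
have w0 := qX_neq1 (le_lt_trans wr r1) (ltn0Sn n).
have r10 : 0 < 1 - r by rewrite subr_gt0.
set N := n.+1; set d := w ^+ N - q ^+ N; set h := w - q.
set e := N%:R * q ^+ N.-1; set H := cabs h.
move=> H2 H1.
(* The remainder splits exactly into the second-order remainder of w^N over (1 - q^N)^2 and a term
   quadratic in d = w^N - q^N. *)
have -> : lambert w N - lambert q N - h * (e / (1 - q ^+ N) ^+ 2) =
   (d - h * e) / (1 - q ^+ N) ^+ 2 + d ^+ 2 / ((1 - q ^+ N) ^+ 2 * (1 - w ^+ N)).
  by rewrite /lambert /d; field; rewrite q0 w0.
apply: le_trans (cabsD _ _) _.
rewrite !(cabsX, cabsM, cabsV).
have Hd : cabs d <= N%:R * r ^+ N * H / r by rewrite ler_pdivlMr // mulrC.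
have He : cabs (d - h * e) <= N%:R ^+ 2 * r ^+ N * H ^+ 2 / r ^+ 2.
  by rewrite ler_pdivlMr ?exprn_gt0 // mulrC.
have H0 : 0 <= H by apply: cabs_ge0.
have iV (a : R) : 1 - r <= a -> a^-1 <= (1 - r)^-1.
  by move=> ra; rewrite lef_pV2 ?posrE // (lt_le_trans r10 ra).
have iq := iV _ Hq; have iw := iV _ Hw.
have B1 : cabs (d - h * e) / cabs (1 - q ^+ N) ^+ 2 <=
   N%:R ^+ 2 * r ^+ N * H ^+ 2 / r ^+ 2 * (1 - r)^-1 ^+ 2.
  rewrite ler_pM ?invr_ge0 ?exprn_ge0 ?cabs_ge0 // -exprVn.
  by rewrite lerXn2r ?nnegrE ?invr_ge0 ?cabs_ge0 ?(ltW r10).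
have B2 : cabs d ^+ 2 / (cabs (1 - q ^+ N) ^+ 2 * cabs (1 - w ^+ N)) <=
   (N%:R * r ^+ N * H / r) ^+ 2 * ((1 - r)^-1 ^+ 2 * (1 - r)^-1).
  have p0 : 0 <= N%:R * r ^+ N * H / r by rewrite !mulr_ge0 ?invr_ge0 ?exprn_ge0 ?(ltW r0).
  rewrite invfM -exprVn.
  rewrite ler_pM ?mulr_ge0 ?exprn_ge0 ?invr_ge0 ?cabs_ge0 ?lerXn2r ?nnegrE ?cabs_ge0 //.
  rewrite ler_pM ?exprn_ge0 ?invr_ge0 ?cabs_ge0 //.
  by rewrite lerXn2r ?nnegrE ?invr_ge0 ?cabs_ge0 ?(ltW r10).
apply: le_trans (lerD B1 B2) _.
set s := r ^+ N.
have s0 : 0 <= s by rewrite exprn_ge0 // ltW.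
have s1 : s <= 1 by rewrite exprn_ile1 // ltW.
have -> : N%:R ^+ 2 * s * H ^+ 2 / r ^+ 2 * (1 - r)^-1 ^+ 2 +
   (N%:R * s * H / r) ^+ 2 * ((1 - r)^-1 ^+ 2 * (1 - r)^-1) =
   (1 / (r ^+ 2 * (1 - r) ^+ 3) * (N%:R ^+ 2 * H ^+ 2)) * (s * (1 - r) + s ^+ 2).
  by field; rewrite !lt0r_neq0.
have -> : 2 / (r ^+ 2 * (1 - r) ^+ 3) * (N%:R ^+ 2 * s) * H ^+ 2 =
  (1 / (r ^+ 2 * (1 - r) ^+ 3) * (N%:R ^+ 2 * H ^+ 2)) * (2 * s).
  by field; rewrite !lt0r_neq0.
have rr0 : 0 <= r ^+ 2 * (1 - r) ^+ 3 by rewrite mulr_ge0 // exprn_ge0 // ltW.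
apply: ler_wpM2l; first by rewrite mulr_ge0 ?divr_ge0 // mulr_ge0 ?sqr_ge0.
clear -s0 s1 r0 r1; nra.
Qed.

Lemma mid_radius (q : Cx R) : cabs q < 1 ->
  exists2 r : R, 0 < r < 1 & exists2 e : R, 0 < e &
    cabs q <= r /\ forall h, cabs h < e -> cabs (q + h) <= r.
Proof.
move=> q1; have q0 := cabs_ge0 q; exists ((cabs q + 1) / 2).
  by apply/andP; split; lra.
exists ((1 - cabs q) / 2); first by lra.
split; first by lra.
by move=> h hq; apply: le_trans (cabsD _ _) _; lra.
Qed.

Lemma is_derive_lambert_sum k (q : Cx R) : cabs q < 1 ->
  is_derive q (1 : Cx R) (lambert_sum k) (lambert_dsum k q).
Proof.
move=> q1; have [r /andP[r0 r1] [e e0 [qr hr]]] := mid_radius q1.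
apply: (@series_is_derive (fun n w => n%:R ^+ k * lambert w n) _
  (fun n => 2 / (r ^+ 2 * (1 - r) ^+ 3) * (n%:R ^+ (k + 2) * r ^+ n)) _ e) => //.
- move=> n h he; have wr := hr h he.
  have := @lambert_quadratic q (q + h) r n; rewrite r0 r1 => /(_ isT qr wr).
  rewrite [q + h - q]addrC addKr => H.
  have -> : n%:R ^+ k * lambert (q + h) n - n%:R ^+ k * lambert q n -
    h * (n%:R ^+ k * (n%:R * q ^+ n.-1 / (1 - q ^+ n) ^+ 2)) =
    n%:R ^+ k * (lambert (q + h) n - lambert q n -
      h * (n%:R * q ^+ n.-1 / (1 - q ^+ n) ^+ 2)) by ring.
  rewrite cabsM cabsX cabs_nat exprD.
  apply: le_trans (ler_wpM2l _ H) _; first by rewrite exprn_ge0.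
  by rewrite le_eqVlt; apply/orP; left; apply/eqP; ring.
- have r10 : 0 <= 1 - r by rewrite subr_ge0 ltW.
  by move=> n; rewrite !mulr_ge0 ?invr_ge0 ?mulr_ge0 ?exprn_ge0 ?(ltW r0).
- apply: (@is_cvg_seriesZ _ (fun n => n%:R ^+ (k + 2) * r ^+ n)).
  by apply: cvg_series_natX_geometric; rewrite (ltW r0).
- by move=> h he; apply: cvg_lambert; apply: le_lt_trans r1; apply: hr.
- exact: cvg_lambert_dsum.
Qed.

Lemma lambert_mul (q : Cx R) m n : cabs q < 1 -> (0 < m)%N -> (0 < n)%N ->
  lambert q m * lambert q n =
  lambert q (m + n)%N * (1 + lambert q m + lambert q n).
Proof.
move=> q1 m0 n0; have mn0 : (0 < m + n)%N by rewrite addn_gt0 m0.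
have := qX_neq1 q1 mn0; have := qX_neq1 q1 m0; have := qX_neq1 q1 n0.
by rewrite /lambert exprD => h1 h2 h3; field; rewrite h1 h2 h3.
Qed.

(* Ramanujan's q dE_2/dq = (E_2^2 - E_4)/12, with E_2 = 1 - 24 S_1,
   E_4 = 1 + 240 S_3 and S_k = \sum_n n^k q^n/(1 - q^n). *)
Lemma ramanujan_E2 (q : Cx R) : cabs q < 1 ->
  q * lambert_dsum 1 q =
  5 / 6 * lambert_sum 3 q + 1 / 6 * lambert_sum 1 q - 2 * lambert_sum 1 q ^+ 2.
Proof.
move=> q1; have q0 := cabs_ge0 q.
pose S k := lambert_sum k q; pose u n := lambert q n.
have Sc k : series (fun n => n%:R ^+ k * u n) @ \oo --> S k by exact: cvg_lambert.
(* As u_n + u_n^2 = q^n / (1 - q^n)^2, the squares give q dS_1/dq - S_2. This S_2 cancels the one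
   coming from the term -6 N^2 of the total weight. *)
have Tc : (fun M => \sum_(0 <= n < M) n%:R ^+ 2 * u n ^+ 2) @ \oo -->
   q * lambert_dsum 1 q - S 2.
  have -> : (fun M => \sum_(0 <= n < M) n%:R ^+ 2 * u n ^+ 2) =
     (fun M => q * series (fun n => n%:R ^+ 1 * (n%:R * q ^+ n.-1 / (1 - q ^+ n) ^+ 2)) M
        - series (fun n => n%:R ^+ 2 * u n) M).
    apply/funext => M; rewrite /series /= mulr_sumr -sumrB; apply: eq_bigr => n _.
    case: n => [|n]; first by rewrite expr0n /= !(mul0r, mulr0) subr0.
    have := qX_neq1 q1 (ltn0Sn n); rewrite /u /lambert /= exprS => h.
    by field.
  apply: cvgB; last exact: Sc.
  apply: cvgMr.
  have H := @cvg_lambert_dsum 1 q q1.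
  exact: H.
pose err M := \sum_(0 <= m < M) \sum_(M - m <= n < M)
   @ramanujan_weight (Cx R) m n * (u m * u n).
have errE M : err M = 2 * (series (fun n => n%:R ^+ 1 * u n) M * series (fun n => n%:R ^+ 1 * u n) M)
  + \sum_(0 <= n < M) n%:R ^+ 2 * u n ^+ 2
  - (5 / 6 * series (fun n => n%:R ^+ 3 * u n) M - series (fun n => n%:R ^+ 2 * u n) M
     + 1 / 6 * series (fun n => n%:R ^+ 1 * u n) M).
  rewrite /err ramanujan_finite; last 2 first.
  - exact: lambert0.
  - by move=> m n; apply: lambert_mul.
  rewrite expr2; congr (_ - _).
  rewrite /series /= !mulr_sumr -sumrB -big_split /=.
  by apply: eq_bigr => n _; field.
have err_lim : err @ \oo --> 2 * (S 1%N * S 1%N) + (q * lambert_dsum 1 q - S 2)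
   - (5 / 6 * S 3 - S 2 + 1 / 6 * S 1%N).
  rewrite (funext errE); apply: cvgB.
    by apply: cvgD; [apply: cvgMr; apply: cvgM; exact: Sc|exact: Tc].
  apply: cvgD; last by apply: cvgMr; exact: Sc.
  by apply: cvgB; [apply: cvgMr; exact: Sc|exact: Sc].
(* Each term of the error has m + n >= M, hence is O(M^2 |q|^M), and there are at most M^2 terms. *)
have err0 : err @ \oo --> (0 : Cx R).
  apply: (@cvg_cabs_le _ _ _ _ _ _
     (fun M => 3 * (1 - cabs q)^-1 ^+ 2 * (M%:R ^+ 4 * cabs q ^+ M))).
    apply: nearW => M; rewrite subr0.
    apply: le_trans (cabs_sum _ _ _) _.
    have B m n : (m < M)%N -> (M - m <= n < M)%N ->
       cabs (@ramanujan_weight (Cx R) m n * (u m * u n)) <=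
       3 * (1 - cabs q)^-1 ^+ 2 * (M%:R ^+ 2 * cabs q ^+ M).
      move=> mM /andP[Mn nM].
      have hm := lambert_bound m (lexx (cabs q)) q1.
      have hn := lambert_bound n (lexx (cabs q)) q1.
      have mMR : m%:R <= M%:R :> R by rewrite ler_nat ltnW.
      have nMR : n%:R <= M%:R :> R by rewrite ler_nat ltnW.
      have hw : cabs (@ramanujan_weight (Cx R) m n) <= 3 * M%:R ^+ 2.
        rewrite /ramanujan_weight -!natrX -natrM -!natrD cabs_nat.
        rewrite !natrD natrM !natrX; have : 0 <= m%:R :> R by []; have : 0 <= n%:R :> R by [].
        nra.
      rewrite cabsM (cabsM (u m)); apply: le_trans (_ : 3 * M%:R ^+ 2 *
         ((cabs q ^+ m / (1 - cabs q)) * (cabs q ^+ n / (1 - cabs q))) <= _).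
        apply: ler_pM; rewrite ?mulr_ge0 ?cabs_ge0 //.
        by apply: ler_pM; rewrite ?cabs_ge0.
      have -> : 3 * M%:R ^+ 2 *
         ((cabs q ^+ m / (1 - cabs q)) * (cabs q ^+ n / (1 - cabs q))) =
         3 * (1 - cabs q)^-1 ^+ 2 * (M%:R ^+ 2 * cabs q ^+ (m + n)).
        by rewrite exprD; ring.
      rewrite ler_wpM2l //; first by rewrite mulr_ge0 ?sqr_ge0.
      rewrite ler_wpM2l ?sqr_ge0 // ler_wiXn2l ?(ltW q1) //.
      by rewrite -leq_subLR.
    apply: le_trans (_ : \sum_(0 <= m < M) M%:R *
        (3 * (1 - cabs q)^-1 ^+ 2 * (M%:R ^+ 2 * cabs q ^+ M)) <= _).
      rewrite !big_nat; apply: ler_sum => m /andP[_ mM].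
      apply: le_trans (cabs_sum _ _ _) _.
      apply: le_trans (_ : \sum_(M - m <= n < M)
        (3 * (1 - cabs q)^-1 ^+ 2 * (M%:R ^+ 2 * cabs q ^+ M)) <= _).
        by rewrite !big_nat; apply: ler_sum => n; apply: B.
      rewrite sumr_const_nat -[leLHS]mulr_natl ler_wpM2r //.
        by rewrite !mulr_ge0 ?exprn_ge0 // invr_ge0 subr_ge0 ltW.
      by rewrite ler_nat leq_subr.
    rewrite sumr_const_nat subn0 -[leLHS]mulr_natl.
    by rewrite le_eqVlt; apply/orP; left; apply/eqP; ring.
  rewrite -[X in _ --> X](mulr0 (3 * (1 - cabs q)^-1 ^+ 2)); apply: cvgMr.
  by apply: cvg_series_cvg_0; apply: cvg_series_natX_geometric; rewrite q0.
have E : 2 * (S 1%N * S 1%N) + (q * lambert_dsum 1 q - S 2)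
   - (5 / 6 * S 3 - S 2 + 1 / 6 * S 1%N) = 0.
  exact: (cvg_unique _ err_lim err0).
rewrite /S in E.
have -> : q * lambert_dsum 1 q = 2 * (lambert_sum 1 q * lambert_sum 1 q) + (q * lambert_dsum 1 q - lambert_sum 2 q)
   - (5 / 6 * lambert_sum 3 q - lambert_sum 2 q + 1 / 6 * lambert_sum 1 q)
   + 5 / 6 * lambert_sum 3 q + 1 / 6 * lambert_sum 1 q - 2 * lambert_sum 1 q ^+ 2.
  by field.
by rewrite E; ring.
Qed.

End SeriesDerivative.

(** * The Euler product: convergence, non-vanishing and logarithmic derivative *)

Section EulerProduct.
Context {R : realType}.
Implicit Types (q w : Cx R) (e : nat -> Cx R).

(** One more factor changes the error by (P - 1) e_n, of size at most (s + s^2) |e_n|; since s <= 1,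
    this is absorbed by the double product in (s + |e_n|)^2. *)
Lemma prod_linear_approx (e : nat -> Cx R) m n :
  \sum_(m <= k < n) cabs (e k) <= 1 ->
  cabs (\prod_(m <= k < n) (1 + e k) - 1 - \sum_(m <= k < n) e k) <=
  (\sum_(m <= k < n) cabs (e k)) ^+ 2.
Proof.
have [mn|nm] := leqP m n; last first.
  by rewrite !big_geq ?(ltnW nm) // subrr subr0 cabs0 expr0n.
elim: n mn => [|n IHn]; first by rewrite leqn0 => /eqP->; rewrite !big_geq // subrr subr0 cabs0 expr0n.
rewrite leq_eqVlt => /predU1P[<-|]; first by rewrite !big_geq // subrr subr0 cabs0 expr0n.
rewrite ltnS => mn; rewrite !big_nat_recr //=.
have s0 : 0 <= \sum_(m <= k < n) cabs (e k) by apply: sumr_ge0 => k _; apply: cabs_ge0.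
have t0 := cabs_ge0 (e n).
set s := \sum_(_ <= _ < _) cabs _ in s0 *.
set P := \prod_(_ <= _ < _) _; set S := \sum_(_ <= _ < _) e _.
move=> le1; have /(IHn mn) : s <= 1 by lra.
rewrite -/s -/P -/S => H.
have -> : P * (1 + e n) - 1 - (S + e n) = (P - 1 - S) + (P - 1) * e n by ring.
have HS : cabs S <= s by apply: cabs_sum.
have HP : cabs (P - 1) <= s + s ^+ 2.
  have -> : P - 1 = (P - 1 - S) + S by ring.
  by apply: le_trans (cabsD _ _) _; lra.
apply: le_trans (cabsD _ _) _; rewrite cabsM.
have : cabs (P - 1) * cabs (e n) <= (s + s ^+ 2) * cabs (e n) by rewrite ler_wpM2r.
have : 0 <= s * (1 - s) * cabs (e n) by rewrite !mulr_ge0 //; lra.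
have := sqr_ge0 (cabs (e n)); move: H.
by set a := cabs (P - 1 - S); set b := cabs (P - 1) * _; clear; nra.
Qed.

Definition euler_prod q : Cx R :=
  lim ((fun m => \prod_(1 <= n < m) (1 - q ^+ n)) @ \oo).

Lemma sum_geometric_le (r : R) n : 0 <= r < 1 ->
  \sum_(1 <= k < n) r ^+ k <= (1 - r)^-1.
Proof.
move=> /andP[r0 r1]; rewrite -[leRHS]mul1r ler_pdivlMr ?subr_gt0 //.
apply: le_trans (_ : (\sum_(0 <= i < n) r ^+ i) * (1 - r) <= _).
  rewrite ler_wpM2r ?subr_ge0 ?(ltW r1) //.
  case: n => [|n]; first by rewrite !big_geq.
  by rewrite (big_ltn (ltn0Sn n)) lerDr expr0.
rewrite big_mkord mulrC -opprB mulNr -subrX1 opprB.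
by rewrite lerBlDr lerDl exprn_ge0.
Qed.

Lemma euler_partial_le q n : cabs q < 1 ->
  cabs (\prod_(1 <= k < n) (1 - q ^+ k)) <= expR ((1 - cabs q)^-1).
Proof.
move=> q1; apply: le_trans (_ : expR (\sum_(1 <= k < n) cabs q ^+ k) <= _); last first.
  by rewrite ler_expR sum_geometric_le // cabs_ge0.
elim: n => [|n IHn]; first by rewrite !big_geq // cabs1 expR0.
case: n IHn => [|n] IHn; first by rewrite !big_geq // cabs1 expR0.
rewrite !(@big_nat_recr _ _ _ n.+1) //= cabsM expRD ler_pM ?cabs_ge0 //.
apply: le_trans (expR_ge1Dx _); apply: le_trans (cabsB _ _) _.
by rewrite cabs1 cabsX.
Qed.

(** For 0 <= x <= |q| one has 1 - x >= exp(- x / (1 - |q|)). The resulting bound is positive and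
    uniform in n, which keeps the infinite product away from 0. *)
Lemma euler_partial_ge q n : cabs q < 1 ->
  expR (- ((1 - cabs q)^-1 ^+ 2)) <= cabs (\prod_(1 <= k < n) (1 - q ^+ k)).
Proof.
move=> q1; have q0 := cabs_ge0 q; have r0 : 0 < 1 - cabs q by rewrite subr_gt0.
apply: le_trans (_ : expR (- ((\sum_(1 <= k < n) cabs q ^+ k) / (1 - cabs q))) <= _).
  rewrite ler_expR lerN2 expr2 ler_wpM2r ?invr_ge0 ?(ltW r0) //.
  by rewrite sum_geometric_le // q0.
elim: n => [|n IHn]; first by rewrite !big_geq // mul0r oppr0 cabs1 expR0.
case: n IHn => [|n] IHn; first by rewrite !big_geq // mul0r oppr0 cabs1 expR0.
rewrite !(@big_nat_recr _ _ _ n.+1) //= cabsM mulrDl opprD expRD.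
rewrite ler_pM ?expR_ge0 //.
set x := cabs q ^+ n.+1.
have x0 : 0 <= x by rewrite exprn_ge0.
have xq : x <= cabs q by rewrite /x exprS ler_piMr // exprn_ile1 // ltW.
apply: le_trans (_ : 1 - x <= _); last first.
  have := cabsD (1 - q ^+ n.+1) (q ^+ n.+1); rewrite subrK cabs1 cabsX -/x; lra.
rewrite expRN -div1r ler_pdivrMr ?expR_gt0 //.
have := expR_ge1Dx (x / (1 - cabs q)); set E := expR _ => HE.
have : (1 - cabs q) * (x / (1 - cabs q)) = x by rewrite mulrC divfK // gt_eqF.
have : 0 <= x / (1 - cabs q) by rewrite divr_ge0 // ltW.
set y := x / _ in HE * => y0 yx.
have : (1 - x) * (1 + y) <= (1 - x) * E by rewrite ler_wpM2l //; lra.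
nra.
Qed.

(** The partial products are the partial sums of their increments - P_m q^m, which are dominated by
    a geometric series because the P_m are bounded. *)
Lemma cvg_euler_prod q : cabs q < 1 ->
  (fun m => \prod_(1 <= n < m) (1 - q ^+ n)) @ \oo --> euler_prod q.
Proof.
move=> q1; have q0 := cabs_ge0 q.
pose P m := \prod_(1 <= n < m) (1 - q ^+ n).
have E m : P m = P 0%N + series (fun m => P m.+1 - P m) m.
  by rewrite /series /= telescope_sumr // addrC subrK.
suff : cvgn (series (fun m => P m.+1 - P m)).
  move=> /cvg_ex[l hl]; apply/cvg_ex; exists (P 0%N + l).
  rewrite (_ : (fun _ => _) = (fun m => P 0%N + series (fun m => P m.+1 - P m) m)).
    by apply: cvgD; [exact: cvg_cst|exact: hl].
  by apply/funext => m; exact: E.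
pose B := expR ((1 - cabs q)^-1) + 1.
apply: (@dominated_series_cvg _ _ (fun m => B * (m%:R ^+ 0 * cabs q ^+ m))).
  apply: (@is_cvg_seriesZ _ (fun m => m%:R ^+ 0 * cabs q ^+ m)).
  by apply: cvg_series_natX_geometric; rewrite q0.
move=> m; rewrite expr0 mul1r.
have B0 : 0 <= B by rewrite /B addr_ge0 // expR_ge0.
case: m => [|m]; first by rewrite /P !big_geq // subrr cabs0 expr0 mulr1.
rewrite /P big_nat_recr //= mulrBr mulr1 addrC addKr cabsN cabsM cabsX.
rewrite ler_wpM2r ?exprn_ge0 //.
by apply: le_trans (euler_partial_le _ q1) _; rewrite /B lerDl.
Qed.

Lemma euler_prod_neq0 q : cabs q < 1 -> euler_prod q != 0.
Proof.
move=> q1; rewrite -cabs_gt0.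
apply: lt_le_trans (expR_gt0 (- ((1 - cabs q)^-1 ^+ 2))) _.
have /cvg_cabs := cvg_euler_prod q1 => H.
apply: (cvgr_to_ge H); apply: nearW => n /=; exact: euler_partial_ge.
Qed.

(** The opposite of the logarithmic derivative of [euler_prod], term by term. *)
Definition euler_dlog q : Cx R :=
  limn (series (fun n => n%:R * q ^+ n.-1 / (1 - q ^+ n))).

Lemma cvg_euler_dlog q : cabs q < 1 ->
  cvgn (series (fun n => n%:R * q ^+ n.-1 / (1 - q ^+ n))).
Proof.
move=> q1; have [r /andP[r0 r1] [_ _ [qr _]]] := mid_radius q1.
apply: (@dominated_series_cvg _ _
   (fun n => (r^-1 * (1 - r)^-1) * (n%:R ^+ 1 * r ^+ n))).
  apply: (@is_cvg_seriesZ _ (fun n => n%:R ^+ 1 * r ^+ n)).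
  by apply: cvg_series_natX_geometric; rewrite (ltW r0).
case=> [|n]; first by rewrite mulr0n expr1 !(mul0r, mulr0) cabs0.
have H := cabs_1BX qr r1 (ltn0Sn n).
rewrite !(cabsX, cabsM, cabsV) cabs_nat expr1.
have -> : r^-1 * (1 - r)^-1 * (n.+1%:R * r ^+ n.+1) =
  n.+1%:R * r ^+ n / (1 - r).
  by rewrite exprS; field; rewrite !lt0r_neq0 // subr_gt0.
have r10 : 0 < 1 - r by rewrite subr_gt0.
apply: ler_pM; rewrite ?mulr_ge0 ?invr_ge0 ?exprn_ge0 ?cabs_ge0 //.
  by rewrite ler_wpM2l // lerXn2r ?nnegrE ?cabs_ge0 // ltW.
by rewrite lef_pV2 ?posrE ?(lt_le_trans r10 H).
Qed.

Lemma mul_euler_dlog q : cabs q < 1 -> q * euler_dlog q = lambert_sum 1 q.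
Proof.
move=> q1.
have H := @cvg_euler_dlog q q1.
have : series (fun n => n%:R ^+ 1 * lambert q n) @ \oo --> q * euler_dlog q.
  have -> : series (fun n => n%:R ^+ 1 * lambert q n) =
     (fun M => q * series (fun n => n%:R * q ^+ n.-1 / (1 - q ^+ n)) M).
    apply/funext => M; rewrite /series /= mulr_sumr; apply: eq_bigr => -[|n] _.
      by rewrite mulr0n expr1 !(mul0r, mulr0).
    by rewrite /lambert expr1 /= exprS; ring.
  by apply: cvgMr; exact: H.
by move=> /cvg_lim <-.
Qed.

Lemma is_derive_euler_prod q : cabs q < 1 ->
  is_derive q (1 : Cx R) euler_prod (- (euler_prod q * euler_dlog q)).
Proof.
move=> q1; have [r /andP[r0 r1] [e e0 [qr hr]]] := mid_radius q1.
have r10 : 0 < 1 - r by rewrite subr_gt0.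
pose P q m := \prod_(1 <= n < m) (1 - q ^+ n).
pose D := series (fun n => n%:R * q ^+ n.-1 / (1 - q ^+ n)).
pose C1 := limn (series (fun n => (r^-1 / (1 - r)) * (n%:R ^+ 1 * r ^+ n))).
pose C2 := limn (series (fun n => (r^-1 ^+ 2 / (1 - r)) * (n%:R ^+ 2 * r ^+ n))).
have rn0 k n : 0 <= n%:R ^+ k * r ^+ n by rewrite mulr_ge0 ?exprn_ge0 // ltW.
have c1 n : 0 <= (r^-1 / (1 - r)) * (n%:R ^+ 1 * r ^+ n).
  by rewrite mulr_ge0 // divr_ge0 ?invr_ge0 ?(ltW r0) ?(ltW r10).
have c2 n : 0 <= (r^-1 ^+ 2 / (1 - r)) * (n%:R ^+ 2 * r ^+ n).
  by rewrite mulr_ge0 // divr_ge0 ?exprn_ge0 ?invr_ge0 ?(ltW r0) ?(ltW r10).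
have cv k (c : R) : cvgn (series (fun n => c * (n%:R ^+ k * r ^+ n))).
  apply: (@is_cvg_seriesZ _ (fun n => n%:R ^+ k * r ^+ n)).
  by apply: cvg_series_natX_geometric; rewrite (ltW r0).
have C1E N : \sum_(0 <= n < N) (r^-1 / (1 - r)) * (n%:R ^+ 1 * r ^+ n) <= C1.
  exact: (@partial_sum_le_lim _ _ N c1 (cv _ _)).
have C2E N : \sum_(0 <= n < N) (r^-1 ^+ 2 / (1 - r)) * (n%:R ^+ 2 * r ^+ n) <= C2.
  exact: (@partial_sum_le_lim _ _ N c2 (cv _ _)).
have C10 : 0 <= C1 by apply: le_trans (C1E 0%N); rewrite big_geq.
pose B := expR ((1 - cabs q)^-1).
(* The radius is small enough that the deviations [ee k] below have total modulus at most C1 |h| <=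
   1, as the product estimate demands. *)
pose e' := Num.min e (1 + C1)^-1.
have C11 : 0 < 1 + C1 by lra.
have e'0 : 0 < e' by rewrite lt_min e0 invr_gt0.
apply: (@lim_is_derive _ (fun N w => P w N) (fun N => - (P q N * D N)) _ _ _
   (B * (C1 ^+ 2 + C2)) e') => //; last 2 first.
- move=> h he; apply: cvg_euler_prod; apply: le_lt_trans (hr h _) r1.
  by apply: lt_le_trans he _; rewrite ge_min lexx.
- apply: cvgN; apply: cvgM; first exact: cvg_euler_prod.
  exact: cvg_euler_dlog.
move=> N h he.
have wr : cabs (q + h) <= r.
  by apply: hr; apply: lt_le_trans he _; rewrite ge_min lexx.
have hC : (1 + C1) * cabs h <= 1.
  rewrite mulrC -ler_pdivlMr // div1r; apply: ltW; apply: lt_le_trans he _.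
  by rewrite ge_min lexx orbT.
pose w := q + h; have wq : w - q = h by rewrite /w addrC addKr.
(* 1 + [ee k] is the ratio of the k-th factors at w and at q, so the increment of the product
   becomes a product close to 1. *)
pose ee k := (q ^+ k - w ^+ k) / (1 - q ^+ k).
have ee0 : ee 0%N = 0 by rewrite /ee !expr0 subrr mul0r.
have prodE : P w N = P q N * \prod_(1 <= k < N) (1 + ee k).
  rewrite /P -big_split /=; apply: eq_big_nat => k /andP[k0 _].
  by have := qX_neq1 q1 k0; rewrite /ee => hq; field.
have abs_d k : (0 < k)%N -> (cabs (1 - q ^+ k))^-1 <= (1 - r)^-1.
  move=> k0; have := cabs_1BX qr r1 k0 => H.
  by rewrite lef_pV2 ?posrE // (lt_le_trans r10 H).
have sum1 : \sum_(1 <= k < N) cabs (ee k) <= C1 * cabs h.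
  apply: le_trans (_ : (\sum_(0 <= k < N)
      (r^-1 / (1 - r)) * (k%:R ^+ 1 * r ^+ k)) * cabs h <= _); last first.
    by rewrite ler_wpM2r ?cabs_ge0.
  rewrite mulr_suml; case: (N) => [|N']; first by rewrite !big_geq.
  rewrite (big_ltn (ltn0Sn N')); apply: ler_wpDl.
    by rewrite mulr_ge0 ?cabs_ge0.
  rewrite !big_nat; apply: ler_sum => k /andP[k0 _].
  rewrite /ee cabsM cabsV cabsC.
  have := powB_linear k qr wr; rewrite -/w wq => H.
  have -> : r^-1 / (1 - r) * (k%:R ^+ 1 * r ^+ k) * cabs h =
     (k%:R * r ^+ k * cabs h / r) / (1 - r) by rewrite expr1; ring.
  apply: ler_pM; rewrite ?cabs_ge0 ?invr_ge0 ?cabs_ge0 //.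
    by rewrite ler_pdivlMr // mulrC.
  exact: abs_d.
have sum2 : cabs (\sum_(1 <= k < N) ee k + h * D N) <= C2 * cabs h ^+ 2.
  have -> : \sum_(1 <= k < N) ee k = \sum_(0 <= k < N) ee k.
    case: (N) => [|N']; first by rewrite !big_geq.
    by rewrite [RHS](big_ltn (ltn0Sn N')) ee0 add0r.
  rewrite /D /series /= mulr_sumr -big_split /=.
  apply: le_trans (cabs_sum _ _ _) _.
  apply: le_trans (_ : (\sum_(0 <= k < N)
      (r^-1 ^+ 2 / (1 - r)) * (k%:R ^+ 2 * r ^+ k)) * cabs h ^+ 2 <= _); last first.
    by rewrite ler_wpM2r ?exprn_ge0 ?cabs_ge0.
  rewrite mulr_suml; apply: ler_sum => k _.
  case: k => [|k].
    rewrite ee0 !mul0r mulr0 addr0 cabs0.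
    exact: mulr_ge0 (c2 0%N) (exprn_ge0 2 (cabs_ge0 h)).
  have := powB_quadratic k.+1 qr wr; rewrite -/w wq => H.
  have -> : ee k.+1 + h * (k.+1%:R * q ^+ k.+1.-1 / (1 - q ^+ k.+1)) =
     - ((w ^+ k.+1 - q ^+ k.+1 - h * (k.+1%:R * q ^+ k.+1.-1)) / (1 - q ^+ k.+1)).
    by rewrite /ee; ring.
  rewrite cabsN cabsM cabsV.
  have -> : r^-1 ^+ 2 / (1 - r) * (k.+1%:R ^+ 2 * r ^+ k.+1) * cabs h ^+ 2 =
     (k.+1%:R ^+ 2 * r ^+ k.+1 * cabs h ^+ 2 / r ^+ 2) / (1 - r).
    by rewrite exprVn; ring.
  apply: ler_pM; rewrite ?cabs_ge0 ?invr_ge0 ?cabs_ge0 //.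
    by rewrite ler_pdivlMr ?exprn_gt0 // mulrC.
  exact: abs_d.
have h0 := cabs_ge0 h.
have sum1le : \sum_(1 <= k < N) cabs (ee k) <= 1.
  by apply: le_trans sum1 _; nra.
have appr := prod_linear_approx sum1le.
rewrite -/w prodE.
set Pr := \prod_(1 <= k < N) (1 + ee k) in appr *.
set S := \sum_(1 <= k < N) ee k in appr sum2 *.
have -> : P q N * Pr - P q N - h * (- (P q N * D N)) =
   P q N * ((Pr - 1 - S) + (S + h * D N)) by ring.
rewrite cabsM -mulrA; apply: ler_pM; rewrite ?cabs_ge0 ?euler_partial_le //.
apply: le_trans (cabsD _ _) _; rewrite mulrDl; apply: lerD => //.
apply: le_trans appr _; rewrite -exprMn lerXn2r ?nnegrE ?mulr_ge0 //.
by apply: sumr_ge0 => k _; apply: cabs_ge0.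
Qed.

End EulerProduct.

(** * The cubic Lambert kernel and its double series *)

Section EisensteinSeries.
Context {R : realType}.
Implicit Types (t q w x z : Cx R).

(* [cubic t] is the closed form of [\sum_n n^3 t^n]; it vanishes at the pole
   [t = 1] by the convention [0^-1 = 0]. *)
Definition cubic t : Cx R := t * (1 + 4 * t + t ^+ 2) / (1 - t) ^+ 4.

Lemma cubic_dup t : t ^+ 2 != 1 -> cubic t + cubic (- t) = 16 * cubic (t ^+ 2).
Proof.
move=> t1; have h0 : 1 - t ^+ 2 != 0 by rewrite subr_eq0 eq_sym.
have : (1 - t) * (1 + t) != 0 by rewrite -subr_sqr expr1n.
rewrite mulf_eq0 negb_or => /andP[h1 h2].
by rewrite /cubic opprK; field; rewrite h0 h1 h2.
Qed.

Lemma cubic1 : cubic 1 = 0.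
Proof. by rewrite /cubic subrr expr0n invr0 mulr0. Qed.

Lemma cubicN1 : cubic (-1) = 1 / 8.
Proof. by rewrite /cubic opprK; field. Qed.

Lemma cubic_partial t M : (1 - t) ^+ 4 * \sum_(0 <= n < M) n%:R ^+ 3 * t ^+ n =
  t * (1 + 4 * t + t ^+ 2) -
  t ^+ M * (M%:R ^+ 3 * (1 - t) ^+ 3 + 3 * M%:R ^+ 2 * t * (1 - t) ^+ 2
    + 3 * M%:R * t * (1 + t) * (1 - t) + t * (1 + 4 * t + t ^+ 2)).
Proof.
elim: M => [|M IHM]; first by rewrite big_geq // expr0; ring.
by rewrite big_nat_recr //= mulrDr IHM -[M.+1%:R]natr1 (exprS t M); ring.
Qed.

Lemma cvg_natX_geometric0 k q : cabs q < 1 ->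
  (fun n => n%:R ^+ k * q ^+ n) @ \oo --> (0 : Cx R).
Proof.
move=> q1; apply: (@cvg_cabs_le _ _ _ _ _ _ (fun n => n%:R ^+ k * cabs q ^+ n)).
  by apply: nearW => n; rewrite subr0 cabsM !cabsX cabs_nat.
apply: cvg_series_cvg_0; apply: cvg_series_natX_geometric.
by rewrite cabs_ge0.
Qed.

Lemma cvg_cubic t : cabs t < 1 ->
  series (fun n => n%:R ^+ 3 * t ^+ n) @ \oo --> cubic t.
Proof.
move=> t1; have h1 : 1 - t != 0 by have := @qX_neq1 _ t 1 t1 isT; rewrite expr1.
have -> : series (fun n => n%:R ^+ 3 * t ^+ n) = (fun M => (1 - t) ^- 4 *
   (t * (1 + 4 * t + t ^+ 2) - ((1 - t) ^+ 3 * (M%:R ^+ 3 * t ^+ M) +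
     3 * t * (1 - t) ^+ 2 * (M%:R ^+ 2 * t ^+ M)
    + 3 * t * (1 + t) * (1 - t) * (M%:R ^+ 1 * t ^+ M)
    + t * (1 + 4 * t + t ^+ 2) * (M%:R ^+ 0 * t ^+ M)))).
  apply/funext => M; apply: (@mulfI _ ((1 - t) ^+ 4)); first by rewrite expf_neq0.
  by rewrite /series /= cubic_partial mulVKf ?expf_neq0 // expr0 expr1; ring.
have -> : cubic t = (1 - t) ^- 4 * (t * (1 + 4 * t + t ^+ 2) - 0).
  by rewrite subr0 mulrC.
apply: cvgMr; apply: cvgB; first exact: cvg_cst.
rewrite -[X in _ --> X](addr0 0); apply: cvgD; last first.
  rewrite -[X in _ --> X](mulr0 (t * (1 + 4 * t + t ^+ 2))).
  by apply: cvgMr; apply: cvg_natX_geometric0.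
rewrite -[X in _ --> X](addr0 0); apply: cvgD; last first.
  rewrite -[X in _ --> X](mulr0 (3 * t * (1 + t) * (1 - t))).
  by apply: cvgMr; apply: cvg_natX_geometric0.
rewrite -[X in _ --> X](addr0 0); apply: cvgD.
  rewrite -[X in _ --> X](mulr0 ((1 - t) ^+ 3)).
  by apply: cvgMr; apply: cvg_natX_geometric0.
rewrite -[X in _ --> X](mulr0 (3 * t * (1 - t) ^+ 2)).
by apply: cvgMr; apply: cvg_natX_geometric0.
Qed.

Lemma cabs_cubic_le t : cabs t <= 1 -> cabs (cubic t) <= 6 * cabs t / cabs (1 - t) ^+ 4.
Proof.
move=> t1; rewrite /cubic !(cabsX, cabsM, cabsV) [_ * cabs (1 + _ + _)]mulrC.
rewrite ler_wpM2r ?invr_ge0 ?exprn_ge0 ?cabs_ge0 // ler_wpM2r ?cabs_ge0 //.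
apply: le_trans (cabsD _ _) _; apply: le_trans (lerD (cabsD _ _) (lexx _)) _.
have := cabs_ge0 t; rewrite cabs1 cabsM cabsX cabs_nat; nra.
Qed.

(** Both sides are the double sum of n^3 q^(m n). The square partial sums [D] are evaluated once by
    rows and once by columns, each time by dominated convergence. *)
Lemma cubic_lambert q : cabs q < 1 ->
  series (fun m => cubic (q ^+ m.+1)) @ \oo --> lambert_sum 3 q.
Proof.
move=> q1; have q0 := cabs_ge0 q; set r := cabs q in q1 q0 *.
have r10 : 0 < 1 - r by rewrite subr_gt0.
have qm m : cabs (q ^+ m.+1) <= r ^+ m.+1 by rewrite cabsX.
have rm m : r ^+ m.+1 <= r by rewrite exprS ler_piMr // exprn_ile1 // ltW.
have qm1 m : cabs (q ^+ m.+1) < 1 by apply: le_lt_trans (qm m) (le_lt_trans (rm m) q1).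
have Ac : cvgn (series (fun m => cubic (q ^+ m.+1))).
  apply: (@dominated_series_cvg _ _ (fun m => 6 * r / (1 - r) ^+ 4 * (m%:R ^+ 0 * r ^+ m))).
    apply: (@is_cvg_seriesZ _ (fun m => m%:R ^+ 0 * r ^+ m)).
    by apply: cvg_series_natX_geometric; rewrite q0.
  move=> m; apply: le_trans (cabs_cubic_le (ltW (qm1 m))) _.
  have H := cabs_1BX (lexx r) q1 (ltn0Sn m).
  rewrite expr0 mul1r.
  have -> : 6 * r / (1 - r) ^+ 4 * r ^+ m = 6 * r ^+ m.+1 / (1 - r) ^+ 4.
    by rewrite (exprS r m); ring.
  apply: ler_pM.
  - by rewrite mulr_ge0 ?cabs_ge0.
  - by rewrite invr_ge0 exprn_ge0 // cabs_ge0.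
  - by rewrite ler_wpM2l.
  rewrite lef_pV2 ?posrE ?exprn_gt0 ?(lt_le_trans r10 H) //.
  by rewrite lerXn2r ?nnegrE ?cabs_ge0 // ltW.
(* Since (m + 1)(n + 1) >= m + n + 1, the double family is dominated by a product of geometric
   terms, summable in either order. *)
have rmn m n : (r ^+ m.+1) ^+ n.+1 <= r ^+ m * r ^+ n.+1.
  rewrite -exprM mulSn exprD mulrC ler_wpM2r ?exprn_ge0 //.
  by rewrite ler_wiXn2l ?(ltW q1) // leq_pmulr.
pose D M := \sum_(0 <= m < M) \sum_(0 <= n < M) n%:R ^+ 3 * (q ^+ m.+1) ^+ n.
have sc := @cvg_series_natX_geometric _ 3 r _.
have r01 : 0 <= r < 1 by rewrite q0.
have D1 : D @ \oo --> limn (series (fun m => cubic (q ^+ m.+1))).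
  apply: (@tannery _ (fun M m => \sum_(0 <= n < M) n%:R ^+ 3 * (q ^+ m.+1) ^+ n)
     (fun m => cubic (q ^+ m.+1))
     (fun m => limn (series (fun n => n%:R ^+ 3 * r ^+ n)) * (m%:R ^+ 0 * r ^+ m)) id).
  - apply: (@is_cvg_seriesZ _ (fun m => m%:R ^+ 0 * r ^+ m)).
    exact: cvg_series_natX_geometric.
  - apply: nearW => M m _; apply: le_trans (cabs_sum _ _ _) _.
    apply: le_trans (_ : (\sum_(0 <= n < M) n%:R ^+ 3 * r ^+ n) * (m%:R ^+ 0 * r ^+ m) <= _).
      rewrite mulr_suml; apply: ler_sum => -[|n] _.
        by rewrite !expr0n /= !mul0r cabs0.
      rewrite expr0 mul1r cabsM !cabsX cabs_nat -mulrA ler_wpM2l ?exprn_ge0 //.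
      by rewrite [leRHS]mulrC rmn.
    rewrite ler_wpM2r ?mulr_ge0 ?exprn_ge0 //.
    apply: (@partial_sum_le_lim _ (fun n => n%:R ^+ 3 * r ^+ n)); last exact: sc.
    by move=> n; rewrite mulr_ge0 ?exprn_ge0.
  - by move=> m; apply: cvg_cubic.
  - by move=> k; exact: nbhs_infty_ge.
  - exact: Ac.
have D2 : D @ \oo --> lambert_sum 3 q.
  rewrite (_ : D = fun M => \sum_(0 <= n < M) \sum_(0 <= m < M) n%:R ^+ 3 * (q ^+ m.+1) ^+ n).
    apply: (@tannery _ (fun M n => \sum_(0 <= m < M) n%:R ^+ 3 * (q ^+ m.+1) ^+ n)
     (fun n => n%:R ^+ 3 * lambert q n)
     (fun n => (1 - r)^-1 * (n%:R ^+ 3 * r ^+ n)) id).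
    + apply: (@is_cvg_seriesZ _ (fun m => m%:R ^+ 3 * r ^+ m)).
      exact: cvg_series_natX_geometric.
    + apply: nearW => M n _; apply: le_trans (cabs_sum _ _ _) _.
      case: n => [|n].
        rewrite big1 => [|m _]; last by rewrite expr0n /= !mul0r cabs0.
        by rewrite expr0n /= mul0r mulr0.
      apply: le_trans (_ : \sum_(0 <= m < M) r ^+ m * (n.+1%:R ^+ 3 * r ^+ n.+1) <= _).
        apply: ler_sum => m _; rewrite cabsM !cabsX cabs_nat mulrCA.
        by rewrite ler_wpM2l ?exprn_ge0.
      rewrite -mulr_suml ler_wpM2r ?mulr_ge0 ?exprn_ge0 //.
      rewrite -[leRHS]mul1r ler_pdivlMr // big_mkord mulrC -opprB mulNr -subrX1 opprB.
      by rewrite lerBlDr lerDl exprn_ge0.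
    + case=> [|n].
        rewrite (_ : (fun _ => _) = fun=> 0).
          by rewrite expr0n mul0r; apply: cvg_cst.
        by apply/funext => M; rewrite big1 // => m _; rewrite expr0n mul0r.
      have h1 := qX_neq1 q1 (ltn0Sn n).
      have -> : (fun M => \sum_(0 <= m < M) n.+1%:R ^+ 3 * (q ^+ m.+1) ^+ n.+1) =
         (fun M => n.+1%:R ^+ 3 * lambert q n.+1 * (1 - M%:R ^+ 0 * (q ^+ n.+1) ^+ M)).
        apply/funext => M; rewrite expr0 mul1r; elim: M => [|M IHM].
          by rewrite big_geq // expr0 subrr mulr0.
        rewrite big_nat_recr //= IHM /lambert (exprAC q M.+1 n.+1) (exprS (q ^+ n.+1)).
        by field.
      rewrite -[X in _ --> X]mulr1; apply: cvgMr; rewrite -[X in _ --> X]subr0.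
      by apply: cvgB; [exact: cvg_cst|exact: cvg_natX_geometric0].
    + by move=> k; exact: nbhs_infty_ge.
    + exact: cvg_lambert.
  by apply/funext => M; rewrite /D exchange_big.
have E : limn (series (fun m => cubic (q ^+ m.+1))) = lambert_sum 3 q.
  exact: (cvg_unique _ D1 D2).
rewrite -E; exact: Ac.
Qed.

(** * The kernel on roots of [cis x] and iterated duplication *)

Definition cis x : Cx R := cexp (two_pi_i * x).

Lemma two_pi_i_neq0 : two_pi_i != 0 :> Cx R.
Proof.
apply/eqP => /(congr1 (@complex.Im R)) /=.
by rewrite mulr1 mul0r addr0 => /eqP; rewrite mulf_eq0 pnatr_eq0 /= gt_eqF // pi_gt0.
Qed.

Lemma cisD x w : cis (x + w) = cis x * cis w.
Proof. by rewrite /cis mulrDr cexpD. Qed.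

Lemma cisMn x n : cis (n%:R * x) = cis x ^+ n.
Proof. by rewrite /cis mulrCA cexpMn. Qed.

Lemma cis_neq0 x : cis x != 0.
Proof. exact: cexp_neq0. Qed.

Lemma ReIm_two_pi_i x :
  complex.Re (two_pi_i * x) = - (2 * pi * complex.Im x) /\
  complex.Im (two_pi_i * x) = 2 * pi * complex.Re x.
Proof. by case: x => a b; rewrite /two_pi_i /=; split; ring. Qed.

Lemma cabs_cis x : cabs (cis x) = expR (- (2 * pi * complex.Im x)).
Proof. by rewrite /cis cabs_cexp (ReIm_two_pi_i x).1. Qed.

Lemma cabs_cis_lt1 x : 0 < complex.Im x -> cabs (cis x) < 1.
Proof.
move=> x0; rewrite cabs_cis -[ltRHS]expR0 ltr_expR oppr_lt0.
by rewrite mulr_gt0 // mulr_gt0 // pi_gt0.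
Qed.

Lemma cabs_cis_le1 x : 0 <= complex.Im x -> cabs (cis x) <= 1.
Proof.
move=> x0; rewrite cabs_cis -[leRHS]expR0 ler_expR oppr_le0.
by rewrite mulr_ge0 // mulr_ge0 // pi_ge0.
Qed.

Lemma cis1 : cis 1 = 1.
Proof.
rewrite /cis /cexp (ReIm_two_pi_i 1).1 (ReIm_two_pi_i 1).2 /= mulr0 oppr0 mulr1.
rewrite expR0 mulr_natl cos2pi.
have -> : sin (pi *+ 2) = 0 :> R by rewrite mulr2n sinDpi sinpi oppr0.
by rewrite mul1r.
Qed.

Lemma cis_half : cis (1 / 2) = -1.
Proof.
have E : two_pi_i * (1 / 2) = (0 +i* pi : Cx R).
  rewrite /two_pi_i; have -> : (1 / 2 : Cx R) = (1 / 2 : R)%:C.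
    by rewrite rmorphM /= fmorphV /= rmorph1 rmorph_nat.
  by apply/eqP; rewrite eq_complex /=; apply/andP; split; apply/eqP; field.
rewrite /cis E /cexp /= expR0 cospi sinpi mul1r.
by apply/eqP; rewrite eq_complex /= oppr0 !eqxx.
Qed.

Lemma cisn n : cis n%:R = 1.
Proof. by rewrite -[n%:R]mulr1 cisMn cis1 expr1n. Qed.

(** The distance from [cis w] to the pole 1 is separated into a contribution of Im w and one of Re
    w, each of which is then bounded below on its own. *)
Lemma sqr_cabs_1Bcis w :
  cabs (1 - cis w) ^+ 2 =
  (1 - expR (- (2 * pi * complex.Im w))) ^+ 2 +
  4 * expR (- (2 * pi * complex.Im w)) * sin (pi * complex.Re w) ^+ 2.
Proof.
rewrite cabs_sqr /cis /cexp (ReIm_two_pi_i w).1 (ReIm_two_pi_i w).2.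
set u := complex.Re w; set rho := expR _.
have -> : 2 * pi * u = pi * u + pi * u by ring.
rewrite cosD sinD /=.
have := cos2Dsin2 (pi * u); set c := cos _; set s := sin _ => cs.
have -> : c * c = 1 - s ^+ 2 by rewrite -cs; ring.
have cs' : c ^+ 2 = 1 - s ^+ 2 by rewrite -cs; ring.
transitivity ((1 - rho * (1 - s ^+ 2 - s * s)) ^+ 2 + rho ^+ 2 * (4 * s ^+ 2 * c ^+ 2)).
  by ring.
by rewrite cs'; ring.
Qed.

Lemma cis_neq1 (u : R) : 0 < u < 1 -> cis u%:C != 1.
Proof.
move=> /andP[u0 u1]; apply/eqP => e1; have := sqr_cabs_1Bcis u%:C.
rewrite e1 subrr cabs0 /= mulr0 oppr0 expR0 subrr !expr0n /= add0r mulr1.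
move/eqP; rewrite eq_sym mulf_eq0 pnatr_eq0 /= sqrf_eq0 gt_eqF //.
by rewrite sin_gt0_pi // mulr_gt0 ?pi_gt0 //= -[ltRHS]mulr1 ltr_pM2l ?pi_gt0.
Qed.

Lemma cis_neq1_upper x : 0 < complex.Im x -> cis x != 1.
Proof.
by move=> /cabs_cis_lt1 H; apply/eqP => e; move: H; rewrite e cabs1 ltxx.
Qed.

(** The sum of the kernel over the 2^j-th roots of [cis x]. After division by 16^j its term of index
    k tends to the partial fraction 6 / (2 pi i (x + k))^4. *)
Definition cubic_sum j x : Cx R :=
  \sum_(0 <= k < 2 ^ j) cubic (cis ((x + k%:R) / (2 ^ j)%:R)).

Lemma two_expn_neq0 j : (2 ^ j)%:R != 0 :> Cx R.
Proof. by rewrite pnatr_eq0 -lt0n expn_gt0. Qed.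

(** The indices k and k + 2^j give opposite roots, the shape to which duplication applies. *)
Lemma cubic_sumS j x : cubic_sum j.+1 x =
  \sum_(0 <= k < 2 ^ j) (cubic (cis ((x + k%:R) / (2 ^ j.+1)%:R)) +
                         cubic (- cis ((x + k%:R) / (2 ^ j.+1)%:R))).
Proof.
rewrite /cubic_sum {1}expnS mul2n -addnn.
rewrite (@big_cat_nat _ _ _ (2 ^ j)) //= ?leq_addr // big_split /=; congr (_ + _).
rewrite -{1}[(2 ^ j)%N]add0n big_addn addnK; apply: eq_bigr => k _; congr cubic.
have -> : (x + (k + 2 ^ j)%:R) / (2 ^ j.+1)%:R = (x + k%:R) / (2 ^ j.+1)%:R + 1 / 2.
  by rewrite expnS natrM natrD; have := two_expn_neq0 j; move=> h; field.
by rewrite cisD cis_half mulrN1.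
Qed.

Lemma cis_halve j x : cis (x / (2 ^ j.+1)%:R) ^+ 2 = cis (x / (2 ^ j)%:R).
Proof.
rewrite -cisMn; congr cis; rewrite expnS natrM.
by have := two_expn_neq0 j; move=> h; field.
Qed.

Lemma cubic_sum_upper j x : cis x != 1 -> cubic_sum j x = 16 ^+ j * cubic (cis x).
Proof.
move=> x1; elim: j => [|j IHj].
  by rewrite /cubic_sum expn0 big_nat1 addr0 divr1 expr0 mul1r.
rewrite cubic_sumS exprS -mulrA -IHj /cubic_sum mulr_sumr.
apply: eq_bigr => k _; rewrite cubic_dup cis_halve //.
apply: contra_neq x1 => e1.
have : cis ((x + k%:R) / (2 ^ j)%:R) ^+ (2 ^ j) = 1 by rewrite e1 expr1n.
by rewrite -cisMn mulrC divfK ?two_expn_neq0 // cisD cisn mulr1.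
Qed.

(** Duplication fails only for the pair 1, -1, which contributes 0 + 1/8. Hence c_(j+1) = 16 c_j +
    1/8 with c_0 = 0, whose solution is (16^j - 1) / 120. *)
Lemma cubic_sum0 j : cubic_sum j 0 = (16 ^+ j - 1) / 120.
Proof.
elim: j => [|j IHj].
  rewrite /cubic_sum expn0 big_nat1 addr0 mul0r /cis mulr0 cexp0 cubic1 expr0.
  by rewrite subrr mul0r.
rewrite cubic_sumS; have j0 : (0 < 2 ^ j)%N by rewrite expn_gt0.
rewrite big_ltn // addr0 mul0r {1 2}/cis mulr0 cexp0 cubic1 cubicN1.
rewrite (eq_big_nat _ _ (F2 := fun k => 16 * cubic (cis ((0 + k%:R) / (2 ^ j)%:R)))).
  rewrite -mulr_sumr; move: IHj; rewrite /cubic_sum big_ltn // addr0 mul0r.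
  by rewrite {1}/cis mulr0 cexp0 cubic1 add0r => ->; rewrite exprS; field.
move=> k /andP[k0 kj]; rewrite cubic_dup cis_halve //.
have -> : (0 + k%:R) / (2 ^ j)%:R = (k%:R / (2 ^ j)%:R : R)%:C :> Cx R.
  by rewrite add0r rmorphM /= fmorphV /= !rmorph_nat.
apply: cis_neq1; rewrite divr_gt0 ?ltr0n //=.
by rewrite ltr_pdivrMr ?ltr0n // mul1r ltr_nat.
Qed.

(** By periodicity the indices are moved to -2^j <= k < 2^j. The rescaled arguments then have real
    part near [-1/2, 1/2], so that 0 is the only pole in reach. *)
Lemma cubic_sum_window j x : cubic_sum j.+1 x =
  \sum_(0 <= k < 2 ^ j) (cubic (cis ((x + k%:R) / (2 ^ j.+1)%:R)) +
                         cubic (cis ((x - k.+1%:R) / (2 ^ j.+1)%:R))).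
Proof.
rewrite /cubic_sum {1}expnS mul2n -addnn.
rewrite (@big_cat_nat _ _ _ (2 ^ j)) //= ?leq_addr // big_split /=; congr (_ + _).
rewrite -{1}[(2 ^ j)%N]add0n big_addn addnK big_nat_rev /= add0n.
apply: eq_big_nat => k /andP[_ kj]; congr cubic.
have -> : (x - k.+1%:R) / (2 ^ j.+1)%:R =
   (x + (2 ^ j - k.+1 + 2 ^ j)%:R) / (2 ^ j.+1)%:R - 1.
  rewrite natrD natrB // expnS natrM.
  by have := two_expn_neq0 j; move=> h; field.
have -> y : cis (y - 1) = cis y; last by [].
by have := cisD (y - 1) 1; rewrite subrK cis1 mulr1.
Qed.

(** The telescoping series used as the comparison series in place of \sum 1/n^2. *)
Lemma sum_inv_prod n :
  \sum_(0 <= k < n) (k.+1%:R * k.+2%:R)^-1 = 1 - n.+1%:R^-1 :> R.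
Proof.
elim: n => [|n IHn]; first by rewrite big_geq // invr1 subrr.
rewrite big_nat_recr //= IHn -[n.+2%:R]natr1.
have : n.+1%:R != 0 :> R by rewrite pnatr_eq0.
have : n.+1%:R + 1 != 0 :> R by rewrite natr1 pnatr_eq0.
set y := n.+1%:R => h1 h2; field.
by rewrite [1 + n%:R]addrC natr1 h1 h2.
Qed.

Lemma cvg_inv_prod : cvgn (series (fun k => (k.+1%:R * k.+2%:R)^-1 : R)).
Proof.
apply: nondecreasing_is_cvgn.
  apply/nondecreasing_seqP => n; rewrite /series /= big_nat_recr //= lerDl.
  by rewrite invr_ge0 mulr_ge0.
by exists 1 => _ [n _ <-]; rewrite /series /= sum_inv_prod lerBlDr lerDl invr_ge0.
Qed.

Lemma cvg_series_eventually_le (u v : nat -> R) N : (forall n, 0 <= u n) ->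
  (forall n, 0 <= v n) -> (forall n, (N <= n)%N -> u n <= v n) ->
  cvgn (series v) -> cvgn (series u).
Proof.
move=> u0 v0 uv vc; apply: nondecreasing_is_cvgn.
  by apply/nondecreasing_seqP => n; rewrite /series /= big_nat_recr //= lerDl.
exists (series u N + limn (series v)) => _ [n _ <-].
have [nN|Nn] := leqP n N.
  rewrite -[leLHS]addr0; apply: lerD.
    rewrite /series /= (@big_cat_nat _ _ _ n 0 N) //= lerDl.
    by apply: sumr_ge0.
  by apply: le_trans (partial_sum_le_lim 0%N v0 vc); rewrite /series /= big_geq.
rewrite /series /= (@big_cat_nat _ _ _ N 0 n) ?(ltnW Nn) //= lerD2l.
apply: le_trans (partial_sum_le_lim n v0 vc).
rewrite /series /= (@big_cat_nat _ _ _ N 0 n) ?(ltnW Nn) //=.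
apply: ler_wpDl; first exact: sumr_ge0.
by rewrite !big_nat; apply: ler_sum => k /andP[/uv].
Qed.

(** * Passage to the limit: partial fractions of the kernel *)

Lemma cvg_series_inv4 x : cvgn (series (fun k => cabs ((x + k%:R) ^- 4))).
Proof.
(* From N on, |x + n| >= (n + 1)/2; the term is then at most 16 / (n + 1)^4, which 32 / ((n + 1)(n +
   2)) dominates. *)
pose N := (2 * Num.bound (cabs x) + 1)%N.
apply: (@cvg_series_eventually_le _ (fun k => 32 * (k.+1%:R * k.+2%:R)^-1) N).
- by move=> n; apply: cabs_ge0.
- by move=> n; rewrite mulr_ge0 // invr_ge0 mulr_ge0.
- move=> n Nn.
  have xb : cabs x < (Num.bound (cabs x))%:R by apply: archi_boundP; apply: cabs_ge0.
  have nb : 2 * (Num.bound (cabs x))%:R + 1 <= n%:R :> R.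
    by rewrite -natrM natr1 ler_nat -addn1.
  have H : n.+1%:R / 2 <= cabs (x + n%:R).
    have := cabsB (x + n%:R) x; rewrite addrAC subrr add0r cabs_nat -natr1.
    move: xb nb; set b := (Num.bound _)%:R; lra.
  have n1 : 1 <= n.+1%:R :> R by rewrite ler1n.
  rewrite cabsV cabsX.
  apply: le_trans (_ : (n.+1%:R / 2) ^- 4 <= _).
    rewrite lef_pV2 ?posrE ?exprn_gt0 ?divr_gt0 //; last first.
      by apply: lt_le_trans H; rewrite divr_gt0.
    by rewrite lerXn2r ?nnegrE ?cabs_ge0 ?divr_ge0.
  rewrite -[n.+2%:R]natr1; move: n1; set y := n.+1%:R => y1.
  have y0 : 0 < y by lra.
  rewrite -[leLHS]invrK -[leRHS]invrK lef_pV2 ?posrE ?invr_gt0 ?mulr_gt0 ?invr_gt0 ?exprn_gt0 ?divr_gt0 ?mulr_gt0 //; last lra.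
  rewrite invrK invfM invrK.
  have -> : (y / 2) ^+ 4 = y * (y ^+ 3 / 16) by field.
  have -> : 32^-1 * (y * (y + 1)) = y * ((y + 1) / 32) by field.
  rewrite ler_wpM2l ?(ltW y0) //.
  have : 1 <= y ^+ 2 by rewrite expr2; nra.
  by rewrite exprS; nra.
- by apply: (@is_cvg_seriesZ _ (fun k => (k.+1%:R * k.+2%:R)^-1)); exact: cvg_inv_prod.
Qed.

Lemma cvg_invr_pow2 y : (fun j => cabs (y / (2 ^ j)%:R)) @ \oo --> (0 : R).
Proof.
have -> : (fun j => cabs (y / (2 ^ j)%:R)) = (fun j => cabs y * 2^-1 ^+ j).
  by apply/funext => j; rewrite cabsM cabsV cabs_nat natrX exprVn.
rewrite -[X in _ --> X](mulr0 (cabs y)); apply: cvgMr.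
by apply: cvg_expr; rewrite ger0_norm ?invr_ge0 // invf_lt1 // ltr1n.
Qed.

Lemma cvgM_Cx (f g : nat -> Cx R) (l m : Cx R) : f @ \oo --> l -> g @ \oo --> m ->
  (fun k => f k * g k) @ \oo --> l * m.
Proof. exact: cvgM. Qed.

Lemma cvgX_Cx (f : nat -> Cx R) (l : Cx R) n : f @ \oo --> l ->
  (fun k => f k ^+ n) @ \oo --> l ^+ n.
Proof.
move=> fl; elim: n => [|n IHn]; first by rewrite expr0; apply: cvg_cst.
rewrite exprS (_ : (fun k => f k ^+ n.+1) = f \* (fun k => f k ^+ n)).
  exact: cvgM fl IHn.
by apply/funext => k; rewrite exprS.
Qed.

(** Near its pole [cubic t] behaves as 6 / (1 - t)^4, with 6 = 1 + 4 + 1, while 1 - cis(y / 2^j) is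
    equivalent to - 2 pi i y / 2^j, and 16^j is the fourth power of 2^j. For y = 0 both sides are 0
    by the convention on inverses. *)
Lemma cvg_cubic_cis y :
  (fun j => cubic (cis (y / (2 ^ j)%:R)) / 16 ^+ j) @ \oo -->
  6 / two_pi_i ^+ 4 * y ^- 4.
Proof.
have [->|y0] := eqVneq y 0.
  rewrite expr0n invr0 mulr0 (_ : (fun _ => _) = fun=> 0); first exact: cvg_cst.
  by apply/funext => j; rewrite mul0r /cis mulr0 cexp0 cubic1 mul0r.
pose v j : Cx R := two_pi_i * (y / (2 ^ j)%:R).
have v0 j : v j != 0.
  by rewrite mulf_neq0 ?two_pi_i_neq0 // mulf_neq0 // invr_neq0 // two_expn_neq0.
have cv : (fun j => cabs (v j)) @ \oo --> (0 : R).
  have -> : (fun j => cabs (v j)) = (fun j => cabs (two_pi_i * y / (2 ^ j)%:R)).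
    by apply/funext => j; rewrite /v mulrA.
  exact: cvg_invr_pow2.
pose a j := (cis (y / (2 ^ j)%:R) - 1) / v j.
have ca : a @ \oo --> (1 : Cx R).
  apply: (@cvg_cabs_le _ _ _ _ _ _ (fun j => 20 * cabs (v j))).
    have : \forall j \near \oo, cabs (v j) < 1 / 2.
      move/cvgrPdist_lt : cv => /(_ (1 / 2)) []; first by rewrite divr_gt0.
      move=> N _ HN; exists N => // j /HN /=.
      by rewrite sub0r normrN ger0_norm ?cabs_ge0.
    apply: filterS => j /ltW /cexp_quadratic H.
    have -> : a j - 1 = (cexp (v j) - 1 - v j) / v j.
      by rewrite /a /cis -/(v j); have := v0 j; move=> h; field.
    rewrite cabsM cabsV ler_pdivrMr ?cabs_gt0 //.
    by apply: le_trans H _; rewrite expr2 mulrA.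
  by rewrite -[X in _ --> X](mulr0 20); apply: cvgMr.
pose t j : Cx R := 1 + v j * a j.
have tE j : cis (y / (2 ^ j)%:R) = t j.
  by rewrite /t /a mulrCA divff // mulr1 addrC subrK.
have cvv : v @ \oo --> (0 : Cx R).
  by apply/cvg_cabsP; under eq_fun do rewrite subr0.
have ct : t @ \oo --> (1 : Cx R).
  rewrite -[X in _ --> X]addr0; apply: cvgD; first exact: cvg_cst.
  by have := cvgM_Cx cvv ca; rewrite mul0r.
have cg : (fun j => (t j * (1 + 4 * t j + t j ^+ 2)) / a j ^+ 4) @ \oo --> (6 : Cx R).
  have -> : (6 : Cx R) = (1 * (1 + 4 * 1 + 1 ^+ 2)) / 1 ^+ 4 by field.
  apply: cvgM; last first.
    apply: cvgV; first by rewrite expr1n oner_neq0.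
    exact: (@cvgX_Cx a 1 4 ca).
  apply: cvgM_Cx; first exact: ct.
  apply: cvgD; last exact: (@cvgX_Cx t 1 2 ct).
  by apply: cvgD; [exact: cvg_cst|apply: cvgMr; exact: ct].
have -> : 6 / two_pi_i ^+ 4 * y ^- 4 = (two_pi_i * y) ^- 4 * 6.
  by have := two_pi_i_neq0; move=> h; field; rewrite h y0.
have -> : (fun j => cubic (cis (y / (2 ^ j)%:R)) / 16 ^+ j) =
  (fun j => (two_pi_i * y) ^- 4 * ((t j * (1 + 4 * t j + t j ^+ 2)) / a j ^+ 4)).
  apply/funext => j; rewrite tE /cubic.
  (* [a j] vanishes when [cis (y / 2^j)] is exactly 1; both sides are then 0. *)
  have [a0|a0] := eqVneq (a j) 0.
    by rewrite /t a0 mulr0 addr0 subrr !expr0n /= !invr0 !mulr0 mul0r.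
  have -> : 1 - t j = - (v j * a j) by rewrite /t opprD addrA subrr sub0r.
  have -> : (16 : Cx R) ^+ j = ((2 ^ j)%:R) ^+ 4.
    by rewrite natrX -!exprM mulnC exprM; congr (_ ^+ _); ring.
  rewrite /v; have := two_expn_neq0 j; have := two_pi_i_neq0.
  by move=> h1 h2; field; rewrite h1 h2 y0 a0.
exact: cvgMr.
Qed.

(** Halving the angle keeps it below 3 pi / 8, where the cosine is bounded below, and the mean value
    theorem handles the sine of the half angle. The bound 3/4 stays away from the next zero, at u =
    1. *)
Lemma sin_lower_bound : exists2 c : R, 0 < c &
  forall u : R, `|u| <= 3 / 4 -> c * u ^+ 2 <= sin (pi * u) ^+ 2.
Proof.
have pi0 := pi_gt0 R.
pose c8 : R := cos (3 / 8 * pi).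
have c80 : 0 < c8.
  by apply: cos_gt0_pihalf; apply/andP; split; [|]; lra.
exists ((pi * c8 ^+ 2) ^+ 2); first by rewrite exprn_gt0 // mulr_gt0 // exprn_gt0.
move=> u; wlog u0 : u / 0 <= u => [hw|].
  case: (leP 0 u) => [/hw//|u0 u34]; have := hw (- u).
  rewrite normrN oppr_ge0 (ltW u0) => /(_ isT u34).
  by rewrite mulrN sinN !sqrrN.
rewrite ger0_norm // => u34; rewrite -exprMn.
have pu0 : 0 <= pi * u / 2 by rewrite divr_ge0 // mulr_ge0 // ltW.
have pu38 : pi * u / 2 <= 3 / 8 * pi by nra.
have cosl (x : R) : 0 <= x -> x <= 3 / 8 * pi -> c8 <= cos x.
  move=> x0 x1; have hx : 0 <= x <= pi by apply/andP; split; lra.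
  have h8 : (0 <= 3 / 8 * pi :> R) && (3 / 8 * pi <= pi :> R).
    by apply/andP; split; lra.
  by rewrite /c8 leNgt ltr_cos ?in_itv //= -leNgt.
have [xi /andP[xi0 xi1] sE] := sin_mvt pu0.
have -> : pi * u = pi * u / 2 + pi * u / 2 by field.
rewrite sinD sE.
have C1 := cosl _ xi0 (le_trans xi1 pu38); have C2 := cosl _ pu0 pu38.
have P : c8 * c8 <= cos xi * cos (pi * u / 2) by rewrite ler_pM // ltW.
rewrite lerXn2r ?nnegrE //.
- by rewrite !mulr_ge0 ?(ltW pi0) ?exprn_ge0 // ltW.
- have := ltW (lt_le_trans c80 C1); have := ltW (lt_le_trans c80 C2) => h1 h2.
  by apply: addr_ge0; apply: mulr_ge0 => //; apply: mulr_ge0.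
- have -> : pi * u / 2 * cos xi * cos (pi * u / 2) + cos (pi * u / 2) * (pi * u / 2 * cos xi)
    = (pi * u) * (cos xi * cos (pi * u / 2)) by field.
  rewrite mulrAC expr2 ler_wpM2l //; by rewrite mulr_ge0 // ltW.
Qed.

(** With s = 2 pi Im w, the vertical constant [a] comes from exp(-s) <= 1 / (1 + s), and the
    horizontal one [b] from exp(-s) >= exp(- 2 pi V) and the bound on the sine. *)
Lemma cabs_1Bcis_lower (V : R) : 0 <= V -> exists2 c : R, 0 < c &
  forall w, `|complex.Re w| <= 3 / 4 -> 0 <= complex.Im w <= V ->
    c * cabs w ^+ 2 <= cabs (1 - cis w) ^+ 2.
Proof.
move=> V0; have [c c0 Hc] := sin_lower_bound; have pi0 := pi_gt0 R.
pose a := (2 * pi / (1 + 2 * pi * V)) ^+ 2.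
pose b := 4 * expR (- (2 * pi * V)) * c.
have d0 : 0 < 1 + 2 * pi * V by rewrite ltr_wpDr // !mulr_ge0 // ltW.
have a0 : 0 < a by rewrite exprn_gt0 // divr_gt0 // mulr_gt0.
have b0 : 0 < b by rewrite !mulr_gt0 // expR_gt0.
exists (Num.min a b); first by rewrite lt_min a0.
move=> w u34 /andP[v0 vV]; rewrite sqr_cabs_1Bcis cabs_sqr mulrDr addrC.
set u := complex.Re w in u34 *; set v := complex.Im w in v0 vV *.
apply: lerD.
  apply: le_trans (_ : a * v ^+ 2 <= _).
    by rewrite ler_wpM2r ?sqr_ge0 // ge_min lexx.
  rewrite -exprMn; set s := 2 * pi * v.
  have s0 : 0 <= s by rewrite !mulr_ge0 // ltW.
  have sV : s <= 2 * pi * V by rewrite ler_wpM2l // mulr_ge0 // ltW.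
  have -> : 2 * pi / (1 + 2 * pi * V) * v = s / (1 + 2 * pi * V) by rewrite /s mulrAC.
  have E : expR (- s) <= 1 - s / (1 + 2 * pi * V).
    apply: le_trans (_ : (1 + s)^-1 <= _).
      by rewrite expRN lef_pV2 ?posrE ?expR_gt0 ?expR_ge1Dx //; lra.
    have -> : (1 + s)^-1 = 1 - s / (1 + s) by field; lra.
    rewrite lerB // ler_wpM2l // lef_pV2 ?posrE //; lra.
  have q0 : 0 <= s / (1 + 2 * pi * V) by rewrite divr_ge0 // ltW.
  by rewrite lerXn2r ?nnegrE //; lra.
apply: le_trans (_ : b * u ^+ 2 <= _).
  by rewrite ler_wpM2r ?sqr_ge0 // ge_min lexx orbT.
rewrite /b -!mulrA ler_wpM2l //; apply: ler_pM.
- exact: expR_ge0.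
- by rewrite mulr_ge0 ?sqr_ge0 // ltW.
- by rewrite ler_expR lerN2 ler_wpM2l // ler_wpM2l // ltW.
- exact: Hc.
Qed.

(** On this rectangle [cubic (cis w)] is singular only at w = 0, with a pole of order 4. The bound
    provides the domination for the partial fraction limit. *)
Lemma cubic_cis_bound (V : R) : 0 <= V -> exists2 C : R, 0 <= C &
  forall w, `|complex.Re w| <= 3 / 4 -> 0 <= complex.Im w <= V ->
    cabs w ^+ 4 * cabs (cubic (cis w)) <= C.
Proof.
move=> V0; have [c c0 Hc] := cabs_1Bcis_lower V0.
exists (6 / c ^+ 2); first by rewrite divr_ge0 // exprn_ge0 // ltW.
move=> w u34 vV; have H := Hc w u34 vV; have /andP[v0 _] := vV.
have [w0|w0] := eqVneq w 0.
  by rewrite w0 cabs0 expr0n mul0r divr_ge0 // exprn_ge0 // ltW.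
have wp : 0 < cabs w by rewrite cabs_gt0.
have cw0 : 0 < c * cabs w ^+ 2 by rewrite mulr_gt0 // exprn_gt0.
have t0 : 0 < cabs (1 - cis w).
  rewrite lt_neqAle cabs_ge0 andbT eq_sym; apply/eqP => e.
  by move: (lt_le_trans cw0 H); rewrite e expr0n ltxx.
apply: le_trans (ler_wpM2l _ (cabs_cubic_le (cabs_cis_le1 v0))) _.
  by rewrite exprn_ge0 // cabs_ge0.
rewrite mulrA ler_pdivrMr ?exprn_gt0 // [leRHS]mulrAC ler_pdivlMr ?exprn_gt0 //.
have t1 := cabs_cis_le1 v0.
have e4 (y : R) : y ^+ 4 = y ^+ 2 ^+ 2 by rewrite -exprM.
rewrite !e4.
have : (c * cabs w ^+ 2) ^+ 2 <= (cabs (1 - cis w) ^+ 2) ^+ 2.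
  by rewrite lerXn2r ?nnegrE ?(ltW cw0) // exprn_ge0 // ltW.
rewrite exprMn; set A := cabs w ^+ 2 ^+ 2; set B := cabs (1 - _) ^+ 2 ^+ 2.
have A0 : 0 <= A by rewrite exprn_ge0 // exprn_ge0 // ltW.
have c20 : 0 <= c ^+ 2 by rewrite exprn_ge0 // ltW.

have : A * c ^+ 2 * cabs (cis w) <= A * c ^+ 2 by rewrite ler_piMr // mulr_ge0.
set X := A * c ^+ 2 * _; set Y := c ^+ 2 * A => h1 h2.
have -> : A * (6 * cabs (cis w)) * c ^+ 2 = 6 * X by rewrite /X; ring.
by rewrite ler_pM2l //; apply: le_trans h1 _; rewrite mulrC.
Qed.

(* [L] is the value at [cis x] of the cubic Lambert kernel for [x] in the upper
   half-plane, and [1 / 120], that is [zeta(-3)], for [x = 0]. *)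
Lemma lipschitz x (L : Cx R) : 0 <= complex.Im x ->
  (fun j => cubic_sum j x / 16 ^+ j) @ \oo --> L ->
  series (fun k => (x + k%:R) ^- 4 + (x - k.+1%:R) ^- 4) @ \oo -->
  L / (6 / two_pi_i ^+ 4).
Proof.
move=> x0 gL.
have [C C0 HC] := cubic_cis_bound x0.
pose A k := (x + k%:R) ^- 4 + (x - k.+1%:R) ^- 4.
pose b k := cabs ((x + k%:R) ^- 4) + cabs ((x - k.+1%:R) ^- 4).
have bc : cvgn (series b).
  have -> : b = (fun k => cabs ((x + k%:R) ^- 4)) + (fun k => cabs ((1 - x + k%:R) ^- 4)).
    apply/funext => k; rewrite /b /=; congr (_ + _).
    have -> : x - k.+1%:R = - (1 - x + k%:R) by rewrite -[k.+1%:R]natr1; ring.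
    by rewrite !cabsV !cabsX cabsN.
  by apply: is_cvg_seriesD; apply: cvg_series_inv4.
have Ac : cvgn (series A).
  by apply: (dominated_series_cvg bc) => n; apply: cabsD.
pose kappa : Cx R := 6 / two_pi_i ^+ 4.
have kappa0 : kappa != 0.
  by rewrite mulf_neq0 ?pnatr_eq0 // invr_neq0 // expf_neq0 // two_pi_i_neq0.
pose a j k := cubic (cis ((x + k%:R) / (2 ^ j.+1)%:R)) / 16 ^+ j.+1 +
              cubic (cis ((x - k.+1%:R) / (2 ^ j.+1)%:R)) / 16 ^+ j.+1.
have aL : (fun j => \sum_(0 <= k < 2 ^ j) a j k) @ \oo --> L.
  have -> : (fun j => \sum_(0 <= k < 2 ^ j) a j k) =
      (fun j => cubic_sum j.+1 x / 16 ^+ j.+1).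
    apply/funext => j; rewrite cubic_sum_window mulr_suml.
    by apply: eq_bigr => k _; rewrite mulrDl.
  by move: gL; rewrite -(cvg_shiftS (fun j => cubic_sum j x / 16 ^+ j)).
have term (y : Cx R) j : `|complex.Re (y / (2 ^ j)%:R)| <= 3 / 4 ->
     0 <= complex.Im (y / (2 ^ j)%:R) <= complex.Im x ->
     cabs (cubic (cis (y / (2 ^ j)%:R)) / 16 ^+ j) <= C * cabs (y ^- 4).
  move=> h1 h2; have := HC _ h1 h2.
  have [->|y0] := eqVneq y 0.
    by move=> _; rewrite mul0r /cis mulr0 cexp0 cubic1 mul0r cabs0 mulr_ge0 ?cabs_ge0.
  rewrite (cabsM y) (cabsV (_%:R)) cabs_nat exprMn exprVn => H.
  rewrite cabsM !cabsV !cabsX cabs_nat ler_pdivlMr ?exprn_gt0 ?cabs_gt0 //.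
  apply: le_trans H; rewrite le_eqVlt; apply/orP; left; apply/eqP.
  have -> : (16 : R) ^+ j = (2 ^ j)%:R ^+ 4.
    by rewrite natrX -!exprM mulnC exprM; congr (_ ^+ _); ring.
  by ring.
have ReV (y : Cx R) n : complex.Re (y / n%:R) = complex.Re y / n%:R.
  have -> : y / n%:R = y * (n%:R^-1)%:C by rewrite fmorphV rmorph_nat.
  by case: y => u v /=; rewrite mulr0 subr0.
have ImV (y : Cx R) n : complex.Im (y / n%:R) = complex.Im y / n%:R.
  have -> : y / n%:R = y * (n%:R^-1)%:C by rewrite fmorphV rmorph_nat.
  by case: y => u v /=; rewrite mulr0 add0r.
have ImD (y : Cx R) : complex.Im (x + y) = complex.Im x + complex.Im y.
  by case: (x) y => ? ? [].
have ReD (y : Cx R) : complex.Re (x + y) = complex.Re x + complex.Re y.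
  by case: (x) y => ? ? [].
have ReN n : complex.Re (n%:R : Cx R) = n%:R by rewrite -(rmorph_nat (real_complex R)).
have ImN n : complex.Im (n%:R : Cx R) = 0 by rewrite -(rmorph_nat (real_complex R)).
have ReNN n : complex.Re (- n%:R : Cx R) = - n%:R.
  by rewrite -(rmorph_nat (real_complex R)) -rmorphN.
have ImNN n : complex.Im (- n%:R : Cx R) = 0.
  by rewrite -(rmorph_nat (real_complex R)) -rmorphN /=.
(* Once 2^j >= 2 |Re x|, every windowed argument has real part at most (2^j / 2 + 2^j) / 2^(j+1) =
   3/4, inside the rectangle of the uniform bound. *)
have jbig : \forall j \near \oo, `|complex.Re x| * 2 <= (2 ^ j)%:R.
  exists (Num.bound (`|complex.Re x| * 2)) => // j /= bj.
  apply: ltW; apply: lt_le_trans (archi_boundP _) _; first by rewrite mulr_ge0.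
  by rewrite ler_nat; apply: leq_trans bj (ltnW (ltn_expl j (ltnSn 1))).
have bound j k : `|complex.Re x| * 2 <= (2 ^ j)%:R -> (k < 2 ^ j)%N ->
    cabs (a j k) <= C * b k.
  move=> jb kj.
  have j0 : 0 < (2 ^ j)%:R :> R by rewrite ltr0n expn_gt0.
  have jS : (2 ^ j.+1)%:R = 2 * (2 ^ j)%:R :> R by rewrite expnS natrM.
  have kR : k.+1%:R <= (2 ^ j)%:R :> R by rewrite ler_nat.
  have kR' : k%:R <= (2 ^ j)%:R :> R by rewrite ler_nat ltnW.
  have ImB : 0 <= complex.Im x / (2 ^ j.+1)%:R <= complex.Im x.
    by rewrite divr_ge0 //= ler_piMr // invf_le1 ?ler1n ?ltr0n expn_gt0.
  have normB (s : R) : `|s| <= (2 ^ j)%:R ->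
      `|(complex.Re x + s) / (2 ^ j.+1)%:R| <= 3 / 4.
    move=> sj; rewrite normrM (@ger0_norm _ (_^-1)) ?invr_ge0 // ler_pdivrMr jS ?mulr_gt0 //.
    by apply: le_trans (ler_normD _ _) _; lra.
  rewrite /a mulrDr; apply: le_trans (cabsD _ _) _; apply: lerD.
    by apply: term; rewrite ?ReV ?ImV ?ReD ?ImD ?ReN ?ImN ?addr0 // normB // normr_nat.
  apply: term; rewrite ?ReV ?ImV ?ReD ?ImD ?ReNN ?ImNN ?addr0 // normB //.
  by rewrite normrN normr_nat.
have aA : (fun j => \sum_(0 <= k < 2 ^ j) a j k) @ \oo --> kappa * limn (series A).
  apply: (@tannery _ a (fun k => kappa * A k) (fun k => C * b k) (fun j => 2 ^ j)%N).
  - exact: (@is_cvg_seriesZ _ b).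
  - by apply: filterS jbig => j jb k kj; apply: bound.
  - move=> k; rewrite /A mulrDr; apply: cvgD.
      have := @cvg_cubic_cis (x + k%:R).
      by rewrite -(cvg_shiftS (fun j => cubic (cis ((x + k%:R) / (2 ^ j)%:R)) / 16 ^+ j)).
    have := @cvg_cubic_cis (x - k.+1%:R).
    by rewrite -(cvg_shiftS (fun j => cubic (cis ((x - k.+1%:R) / (2 ^ j)%:R)) / 16 ^+ j)).
  - move=> k; exists k => // n /= kn; apply: leq_trans kn _.
    exact: ltnW (ltn_expl n (ltnSn 1)).
  - have -> : series (fun k => kappa * A k) = (fun n => kappa * series A n).
      by apply/funext => n; rewrite /series /= mulr_sumr.
    by apply: cvgMr; exact: Ac.
have E : L = kappa * limn (series A) by exact: (cvg_unique _ aL aA).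
have -> : L / (6 / two_pi_i ^+ 4) = limn (series A).
  by rewrite -/kappa E mulrC mulKf.
exact: Ac.
Qed.

(** * Lattice sums of weight 4 and the inversion of E_4 *)

Definition bilateral (f : int -> Cx R) (M : nat) : Cx R :=
  \sum_(0 <= i < M.*2.+1) f (i%:Z - M%:Z).

Lemma bilateralS f M :
  bilateral f M.+1 = f (- M.+1%:Z) + bilateral f M + f M.+1%:Z.
Proof.
rewrite /bilateral doubleS big_nat_recl // big_nat_recr //= sub0r addrA.
congr (_ + _ + _); last by congr f; lia.
by apply: eq_bigr => i _; congr f; lia.
Qed.

Lemma bilateralE f M : bilateral f M =
  f 0 + \sum_(0 <= k < M) (f k.+1%:Z + f (- k.+1%:Z)).
Proof.
elim: M => [|M IHM].
  by rewrite /bilateral double0 big_nat1 big_geq // subrr addr0.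
by rewrite bilateralS IHM big_nat_recr //=; ring.
Qed.

Lemma bilateralN f M : bilateral (fun i => f (- i)) M = bilateral f M.
Proof.
rewrite !bilateralE oppr0; congr (_ + _); apply: eq_bigr => k _.
by rewrite opprK addrC.
Qed.

Lemma lipschitz_bilateral x (L : Cx R) : 0 <= complex.Im x ->
  (fun j => cubic_sum j x / 16 ^+ j) @ \oo --> L ->
  (fun M => bilateral (fun n => (x + n%:~R) ^- 4) M) @ \oo -->
  L / (6 / two_pi_i ^+ 4).
Proof.
move=> x0 gL; have H := lipschitz x0 gL.
(* The symmetric sum has one term more than the sum of the pairs k, -k-1; that term tends to 0. *)
have E M : bilateral (fun n => (x + n%:~R) ^- 4) M =
   series (fun k => (x + k%:R) ^- 4 + (x - k.+1%:R) ^- 4) M + (x + M%:R) ^- 4.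
  rewrite /series /=; elim: M => [|M IHM].
    by rewrite bilateralE !big_geq // addr0 add0r.
  rewrite bilateralS IHM big_nat_recr //= mulrNz -!pmulrn; ring.
rewrite (funext E) -[X in _ --> X]addr0; apply: cvgD; first exact: H.
have H0 := cvg_series_cvg_0 (@cvg_series_inv4 x).
by apply/cvg_cabsP; under eq_fun do rewrite subr0.
Qed.

(** The square truncation is stable under (m, n) -> (n, -m), so the inversion formula holds exactly
    at every M, before any limit. The term at (0, 0) is 0 by the convention on inverses. *)
Definition eisenstein z M : Cx R :=
  bilateral (fun m => bilateral (fun n => (m%:~R * z + n%:~R) ^- 4) M) M.

Lemma eisenstein_inv z M : z != 0 ->
  eisenstein (- z^-1) M = z ^+ 4 * eisenstein z M.
Proof.
move=> z0; rewrite /eisenstein.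
pose F (m n : int) : Cx R := (m%:~R * z + n%:~R) ^- 4.
transitivity (bilateral (fun m => bilateral (fun n => z ^+ 4 * F n (- m)) M) M).
  apply: eq_bigr => i _; apply: eq_bigr => j _; rewrite /F.
  set m := _ - _ : int; set n := (j%:Z - _ : int).
  have -> : m%:~R * - z^-1 + n%:~R = (n%:~R * z + (- m)%:~R) / z.
    by rewrite mulrNz; field.
  by rewrite expr_div_n invfM invrK mulrC.
rewrite (bilateralN (fun m => bilateral (fun n => z ^+ 4 * F n m) M)).
rewrite /bilateral exchange_big mulr_sumr /=; apply: eq_bigr => i _.
by rewrite mulr_sumr.
Qed.

(** The real part a = m x + n and the imaginary part b = m y of m z + n determine m = b / y and n =
    a - m x. *)
Lemma cabs_lattice z (m n : R) : 0 < complex.Im z ->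
  m ^+ 2 + n ^+ 2 <=
  (2 + (1 + 2 * complex.Re z ^+ 2) / complex.Im z ^+ 2) *
  cabs (m%:C * z + n%:C) ^+ 2.
Proof.
case: z => x y /= y0; rewrite cabs_sqr /= !mul0r subr0 !addr0.
set a := m * x + n; set b := m * y.
have -> : n = a - m * x by rewrite /a addrC addKr.
have -> : m = b / y by rewrite /b mulfK // gt_eqF.
have y20 : 0 < y ^+ 2 by rewrite exprn_gt0.
rewrite mulrDl.
have -> : (1 + 2 * x ^+ 2) / y ^+ 2 * (a ^+ 2 + b ^+ 2) =
  (1 + 2 * x ^+ 2) / y ^+ 2 * a ^+ 2 + (b / y) ^+ 2 + 2 * (b / y * x) ^+ 2.
  by field; rewrite gt_eqF.
have : 0 <= (1 + 2 * x ^+ 2) / y ^+ 2 * a ^+ 2.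
  rewrite mulr_ge0 ?sqr_ge0 // divr_ge0 ?sqr_ge0 // addr_ge0 // mulr_ge0 //.
  exact: sqr_ge0.
set p := b / y * x; have := sqr_ge0 (a + p); have := sqr_ge0 b.
set s := _ * a ^+ 2; set t := (b / y) ^+ 2.
clearbody s t p; nra.
Qed.

Lemma bilateral_le (f : int -> Cx R) (g : int -> R) M :
  (forall n, cabs (f n) <= g n) ->
  cabs (bilateral f M) <= g 0 + \sum_(0 <= k < M) (g k.+1%:Z + g (- k.+1%:Z)).
Proof.
move=> fg; rewrite bilateralE; apply: le_trans (cabsD _ _) _; apply: lerD => //.
apply: le_trans (cabs_sum _ _ _) _; apply: ler_sum => k _.
by apply: le_trans (cabsD _ _) _; apply: lerD.
Qed.

Lemma inv_1Dsqr_le k : (1 + k%:R ^+ 2)^-1 <= 4 * (k.+1%:R * k.+2%:R)^-1 :> R.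
Proof.
have k0 : 0 <= k%:R :> R by [].
rewrite -[leLHS]mul1r ler_pdivrMr; last by rewrite ltr_pwDl // sqr_ge0.
rewrite mulrAC ler_pdivlMr ?mulr_gt0 // mul1r -[k.+2%:R]natr1 -[k.+1%:R]natr1.
by set y := k%:R in k0 *; have := sqr_ge0 (y - 1); nra.
Qed.

(** For m >= 1, m^2 + n^2 is at least m^2 and at least 1 + n^2, so |m z + n|^4 is bounded below by a
    multiple of m^2 (1 + n^2) and the variables separate. *)
Lemma inner_sum_bound z : 0 < complex.Im z -> exists2 C : R, 0 <= C &
  forall k M, cabs (bilateral (fun n => (k.+1%:Z%:~R * z + n%:~R) ^- 4) M) <=
     C * (k.+1%:R * k.+2%:R)^-1.
Proof.
move=> z0; set D := (2 + (1 + 2 * complex.Re z ^+ 2) / complex.Im z ^+ 2).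
have D0 : 0 < D.
  rewrite ltr_wpDr // divr_ge0 ?sqr_ge0 // addr_ge0 // mulr_ge0 // sqr_ge0 //.
have rI (n : int) : (n%:~R : Cx R) = (n%:~R : R)%:C by rewrite rmorph_int.
have term (k : nat) (n : int) : cabs ((k.+1%:Z%:~R * z + n%:~R) ^- 4) <=
   D ^+ 2 * ((k.+1%:R ^+ 2)^-1 * (1 + n%:~R ^+ 2)^-1).
  have := cabs_lattice (k.+1%:R) (n%:~R) z0; rewrite -/D.
  rewrite !rI -pmulrn; set w : Cx R := _%:C * z + _; set m := k.+1%:R; set N := n%:~R.
  have m1 : 1 <= m by rewrite ler1n.
  have N0 : 0 <= N ^+ 2 by rewrite sqr_ge0.
  have m20 : 1 <= m ^+ 2 by rewrite expr2; nra.
  move=> H; have w0 : 0 < cabs w ^+ 2.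
    by rewrite -(pmulr_rgt0 _ D0); apply: lt_le_trans H; lra.
  rewrite cabsV cabsX -invfM.
  have -> : cabs w ^+ 4 = (cabs w ^+ 2) ^+ 2 by rewrite -exprM.
  rewrite ler_pdivlMr; last by rewrite mulr_gt0 //; lra.
  have HH : m ^+ 2 * (1 + N ^+ 2) <= (D * cabs w ^+ 2) ^+ 2.
    by rewrite [leRHS]expr2; apply: ler_pM; rewrite ?addr_ge0 ?sqr_ge0 //; lra.
  rewrite exprMn in HH; rewrite [leLHS]mulrC ler_pdivrMr; first exact: HH.
  by rewrite exprn_gt0.
(* 9 = 1 + 2 * 4 bounds the sum of 1 / (1 + n^2) over the integers, and 2 comes from 1 / m^2 <= 2 /
   (m (m + 1)). *)
exists (D ^+ 2 * 2 * 9); first by rewrite !mulr_ge0 // ltW.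
move=> k M.
apply: le_trans (bilateral_le M (term k)) _.
have -> : D ^+ 2 * ((k.+1%:R ^+ 2)^-1 * (1 + 0%:~R ^+ 2)^-1) +
  \sum_(0 <= k0 < M)
     (D ^+ 2 * ((k.+1%:R ^+ 2)^-1 * (1 + k0.+1%:Z%:~R ^+ 2)^-1) +
      D ^+ 2 * ((k.+1%:R ^+ 2)^-1 * (1 + (- k0.+1%:Z)%:~R ^+ 2)^-1)) =
  D ^+ 2 * (k.+1%:R ^+ 2)^-1 * (1 + 2 * \sum_(0 <= i < M) (1 + i.+1%:R ^+ 2)^-1).
  rewrite mulrDr mulrA expr0n addr0 invr1; congr (_ + _).
  rewrite [2 * _]mulr_sumr mulr_sumr; apply: eq_bigr => i _.
  by rewrite mulrNz sqrrN -!pmulrn; ring.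
have s4 : \sum_(0 <= i < M) (1 + i.+1%:R ^+ 2)^-1 <= 4 :> R.
  apply: le_trans (_ : \sum_(0 <= i < M.+1) (1 + i%:R ^+ 2)^-1 <= _).
    by rewrite big_nat_recl //= ler_wpDl // invr_ge0 addr_ge0 // sqr_ge0.
  apply: le_trans (_ : \sum_(0 <= i < M.+1) 4 * (i.+1%:R * i.+2%:R)^-1 <= _).
    by apply: ler_sum => i _; apply: inv_1Dsqr_le.
  by rewrite -mulr_sumr sum_inv_prod ler_piMr // lerBlDr lerDl invr_ge0.
have kk : (k.+1%:R ^+ 2)^-1 <= 2 * (k.+1%:R * k.+2%:R)^-1 :> R.
  rewrite -[leLHS]mul1r ler_pdivrMr ?exprn_gt0 // mulrAC ler_pdivlMr ?mulr_gt0 //.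
  rewrite mul1r -[k.+2%:R]natr1; have : 1 <= k.+1%:R :> R by rewrite ler1n.
  nra.
have -> : D ^+ 2 * 2 * 9 * (k.+1%:R * k.+2%:R)^-1 =
   D ^+ 2 * (2 * (k.+1%:R * k.+2%:R)^-1) * 9 by ring.
apply: ler_pM; last lra.
- by rewrite mulr_ge0 ?sqr_ge0 // invr_ge0 sqr_ge0.
- rewrite addr_ge0 // mulr_ge0 //; apply: sumr_ge0 => i _.
  by rewrite invr_ge0 addr_ge0 // sqr_ge0.
- by rewrite ler_wpM2l ?sqr_ge0.
Qed.

(** The row m = 0 is the case x = 0 of the partial fractions and gives 1/120; the rows m and -m
    agree and give twice [cubic (q^m)], in total twice S_3, whence 240. Rows and row index are cut
    at the same M, and one dominated limit treats both. *)
Lemma cvg_eisenstein z : 0 < complex.Im z ->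
  eisenstein z @ \oo -->
  (1 + 240 * lambert_sum 3 (cis z)) / (120 * (6 / two_pi_i ^+ 4)).
Proof.
move=> z0; pose kappa : Cx R := 6 / two_pi_i ^+ 4.
have kappa0 : kappa != 0.
  by rewrite mulf_neq0 ?pnatr_eq0 // invr_neq0 // expf_neq0 // two_pi_i_neq0.
pose A (m : int) M := bilateral (fun n => (m%:~R * z + n%:~R) ^- 4) M.
have AN m M : A (- m) M = A m M.
  rewrite /A -[RHS]bilateralN; apply: eq_bigr => i _.
  set n : int := _ - _.
  have -> : (- m)%:~R * z + n%:~R = - (m%:~R * z + (- n)%:~R) by rewrite !mulrNz; ring.
  by congr (_^-1); ring.
have E M : eisenstein z M = A 0 M + \sum_(0 <= k < M) 2 * A k.+1%:Z M.
  rewrite /eisenstein bilateralE; congr (_ + _); apply: eq_bigr => k _.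
  by rewrite -/(A _ M) -/(A _ M) AN mulr_natl mulr2n.
have -> : (1 + 240 * lambert_sum 3 (cis z)) / (120 * kappa) =
   1 / 120 / kappa + 2 / kappa * lambert_sum 3 (cis z) by field.
rewrite (funext E); apply: cvgD.
  have := @lipschitz_bilateral 0 (1 / 120) (lexx _).
  have -> : (fun M => bilateral (fun n => (0 + n%:~R) ^- 4) M) = A 0.
    by apply/funext => M; rewrite /A mul0r.
  apply.
  have -> : (fun j => cubic_sum j 0 / 16 ^+ j) =
     (fun j => 1 / 120 - 1 / 120 * (16^-1) ^+ j).
    apply/funext => j; rewrite cubic_sum0 exprVn.
    have : 16 ^+ j != 0 :> Cx R by rewrite expf_neq0 // pnatr_eq0.
    by move=> h; field.
  rewrite -[X in _ --> X]subr0; apply: cvgB; first exact: cvg_cst.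
  rewrite -[X in _ --> X](mulr0 (1 / 120)); apply: cvgMr.
  have q16 : cabs (16^-1 : Cx R) < 1 by rewrite cabsV cabs_nat invf_lt1 // ltr1n.
  have := @cvg_natX_geometric0 0 _ q16.
  by under eq_fun do rewrite expr0 mul1r.
have [C C0 HC] := inner_sum_bound z0.
have q1 := cabs_cis_lt1 z0.
apply: (@tannery _ (fun M k => 2 * A k.+1%:Z M)
   (fun k => 2 / kappa * cubic (cis z ^+ k.+1))
   (fun k => (2 * C) * (k.+1%:R * k.+2%:R)^-1) id).
- apply: (@is_cvg_seriesZ _ (fun k => (k.+1%:R * k.+2%:R)^-1)); exact: cvg_inv_prod.
- apply: nearW => M k _; rewrite cabsM cabs_nat -mulrA ler_wpM2l //; exact: HC.
- move=> k; rewrite -mulrA [kappa^-1 * _]mulrC; apply: cvgMr.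
  have kz0 : 0 < complex.Im (k.+1%:R * z : Cx R).
    have -> : (k.+1%:R : Cx R) = (k.+1%:R : R)%:C by rewrite rmorph_nat.
    by case: z z0 {AN E HC q1} @A => x y /= y0; rewrite mul0r addr0 mulr_gt0.
  have := @lipschitz_bilateral (k.+1%:R * z) (cubic (cis z ^+ k.+1)) (ltW kz0).
  apply.
  have -> : (fun j => cubic_sum j (k.+1%:R * z) / 16 ^+ j) = (fun=> cubic (cis z ^+ k.+1)).
    apply/funext => j; rewrite cubic_sum_upper ?cis_neq1_upper // cisMn.
    by rewrite mulrC mulKf // expf_neq0 // pnatr_eq0.
  exact: cvg_cst.
- by move=> k; exact: nbhs_infty_ge.
- have -> : series (fun k => 2 / kappa * cubic (cis z ^+ k.+1)) =
     (fun n => 2 / kappa * series (fun k => cubic (cis z ^+ k.+1)) n).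
    by apply/funext => n; rewrite /series /= mulr_sumr.
  by apply: cvgMr; apply: cubic_lambert.
Qed.

Lemma E4_inv z : 0 < complex.Im z ->
  1 + 240 * lambert_sum 3 (cis (- z^-1)) =
  z ^+ 4 * (1 + 240 * lambert_sum 3 (cis z)).
Proof.
move=> z0; have zn0 : z != 0 by apply: contraTneq z0 => ->; rewrite ltxx.
have Iz : 0 < complex.Im (- z^-1).
  case: z z0 {zn0} => x y /= y0.
  by rewrite opprK divr_gt0 // ltr_wpDl ?sqr_ge0 // exprn_gt0.
have k0 : 120 * (6 / two_pi_i ^+ 4) != 0 :> Cx R.
  by rewrite !mulf_neq0 ?pnatr_eq0 // invr_neq0 // expf_neq0 // two_pi_i_neq0.
have H1 := cvg_eisenstein Iz.
have H2 : eisenstein (- z^-1) @ \oo -->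
   z ^+ 4 * ((1 + 240 * lambert_sum 3 (cis z)) / (120 * (6 / two_pi_i ^+ 4))).
  rewrite (funext (fun M => eisenstein_inv M zn0)).
  by apply: cvgMr; apply: cvg_eisenstein.
apply: (mulIf (invr_neq0 k0)); rewrite -mulrA.
exact: (cvg_unique _ H1 H2).
Qed.

End EisensteinSeries.

Lemma is_derive_comp (K : numFieldType) (f g : K -> K) (x a b : K) :
  is_derive (g x) 1 f a -> is_derive x 1 g b -> is_derive x 1 (f \o g) (a * b).
Proof.
move=> [fgx <-] [gx <-].
move/derivable1_diffP : (fgx) => df; move/derivable1_diffP : (gx) => dg.
have dfg : differentiable (f \o g) x by exact: differentiable_comp.
apply: DeriveDef; first exact/derivable1_diffP.
rewrite -[LHS]derive1E derive1E' // diff_comp //= deriv1E // deriv1E //.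
by rewrite -!derive1E /GRing.scale /= mul1r mulrC.
Qed.

(** * Rules of complex differentiation *)

Section ComplexDerivative.
Context {R : realType}.
Implicit Types (f g : Cx R -> Cx R) (x a b : Cx R).

Definition has_derivative f x a := is_derive x (1 : Cx R) f a.

Lemma has_derivative_eq f x a b : has_derivative f x a -> a = b -> has_derivative f x b.
Proof. by move=> fa <-. Qed.

Lemma has_derivative_cst c x : has_derivative (fun=> c) x 0.
Proof. exact: is_derive_cst. Qed.

Lemma has_derivative_id x : has_derivative (fun w => w) x 1.
Proof. exact: is_derive_id. Qed.

Lemma has_derivativeD f g x a b : has_derivative f x a -> has_derivative g x b ->
  has_derivative (fun w => f w + g w) x (a + b).
Proof. exact: is_deriveD. Qed.

Lemma has_derivativeN f x a : has_derivative f x a ->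
  has_derivative (fun w => - f w) x (- a).
Proof. exact: is_deriveN. Qed.

Lemma has_derivativeB f g x a b : has_derivative f x a -> has_derivative g x b ->
  has_derivative (fun w => f w - g w) x (a - b).
Proof. exact: is_deriveB. Qed.

Lemma has_derivativeM f g x a b : has_derivative f x a -> has_derivative g x b ->
  has_derivative (fun w => f w * g w) x (a * g x + f x * b).
Proof.
move=> fa gb; have := @is_deriveM _ _ f g x 1 a b fa gb.
move=> H; apply: has_derivative_eq H _.
by rewrite /GRing.scale /= addrC [g x * a]mulrC.
Qed.

Lemma has_derivativeZ f x a (c : Cx R) : has_derivative f x a ->
  has_derivative (fun w => c * f w) x (c * a).
Proof.
move=> fa; apply: has_derivative_eq (has_derivativeM (has_derivative_cst c x) fa) _.
by rewrite mul0r add0r.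
Qed.

Lemma has_derivativeV f x a : f x != 0 -> has_derivative f x a ->
  has_derivative (fun w => (f w)^-1) x (- a / f x ^+ 2).
Proof.
move=> f0 [df <-]; apply: DeriveDef; first exact: derivableV.
by rewrite deriveV // /GRing.scale /= mulNr mulrC mulNr.
Qed.

Lemma has_derivativeX f x a n : has_derivative f x a ->
  has_derivative (fun w => f w ^+ n) x (n%:R * f x ^+ n.-1 * a).
Proof.
move=> fa; elim: n => [|n IHn].
  by rewrite !mul0r; apply: has_derivative_cst.
have := has_derivativeM fa IHn.
rewrite (_ : (fun w => f w ^+ n.+1) = fun w => f w * f w ^+ n); last first.
  by apply/funext => w; rewrite exprS.
move=> H; apply: has_derivative_eq H _; case: n {IHn} => [|n] /=.
  by rewrite expr0 !mul0r mulr0 addr0 mulr1 !mul1r.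
by rewrite -[n.+2%:R]natr1 (exprS _ n); ring.
Qed.

Lemma has_derivative_comp f g x a b : has_derivative f (g x) a ->
  has_derivative g x b -> has_derivative (fun w => f (g w)) x (a * b).
Proof.
exact: is_derive_comp.
Qed.

Lemma has_derivative_near f g x a : (\near x, f x = g x) ->
  has_derivative f x a -> has_derivative g x a.
Proof. exact: near_eq_is_derive. Qed.

Lemma has_derivative_cis x : has_derivative (@cis R) x (two_pi_i * cis x).
Proof.
have H := has_derivative_comp (@is_derive_cexp R (two_pi_i * x))
  (has_derivativeZ two_pi_i (has_derivative_id x)).
by apply: has_derivative_eq H _; rewrite mulr1 mulrC.
Qed.

End ComplexDerivative.

(** * Derivatives on the upper half-plane, Moebius action and slash operators *)

Section UpperHalfPlane.
Context {R : realType}.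
Implicit Types (f g : hfun R) (z : upper R) (a b : 'M[R]_2).

Lemma upper_Im_gt0 z : 0 < complex.Im (val z : R[i]).
Proof. exact: (valP z). Qed.

Lemma upper_neq0 z : (val z : Cx R) != 0.
Proof. by apply: contraTneq (upper_Im_gt0 z) => ->; rewrite ltxx. Qed.

Lemma ext0_val f z : ext0 f (val z) = f z.
Proof. by rewrite /ext0 valK. Qed.

Lemma near_upper z : \forall w \near (val z : Cx R), 0 < complex.Im (w : R[i]).
Proof.
have z0 := upper_Im_gt0 z.
have H := near_cabs_lt z0; rewrite (near_shift (val z : Cx R)) in H.
apply: filterS H => w /=; rewrite sub0r => H.
have := le_lt_trans (cabs_Im _) H.
have ImB : complex.Im (w - val z : R[i]) = complex.Im (w : R[i]) - complex.Im (val z : R[i]).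
  by case: (w) (val z) => u v [x y].
by rewrite ImB ltr_norml => /andP[h _]; lra.
Qed.

Definition hderiv f z (d : Cx R) := has_derivative (ext0 f) (val z) d.

(** The upper half-plane is open, so near z the extension by zero agrees with any F that restricts
    to f. *)
Lemma hderiv_restrict f (F : Cx R -> Cx R) z d :
  (forall w : upper R, f w = F (val w)) -> has_derivative F (val z) d -> hderiv f z d.
Proof.
move=> fF; apply: has_derivative_near; have := near_upper z.
by apply: filterS => w w0; rewrite /ext0 insubT fF.
Qed.

Lemma hderivE f z d : hderiv f z d -> deriv_upper f z = d.
Proof. by move=> [_ <-]; rewrite /deriv_upper derive1E. Qed.

Lemma holomorphicP f : holomorphic f <-> forall z, exists d, hderiv f z d.
Proof.
split=> [fh z|fh z]; first by exists ('D_1 (ext0 f) (val z)); apply: DeriveDef.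
by have [d [H _]] := fh z.
Qed.

Lemma hderivM f g z c d : hderiv f z c -> hderiv g z d ->
  hderiv (fun w => f w * g w) z (c * g z + f z * d).
Proof.
move=> fc gd; rewrite -(ext0_val f z) -(ext0_val g z).
by apply: hderiv_restrict (has_derivativeM fc gd) => w; rewrite !ext0_val.
Qed.

Lemma hderivD f g z c d : hderiv f z c -> hderiv g z d ->
  hderiv (fun w => f w + g w) z (c + d).
Proof.
move=> fc gd.
by apply: hderiv_restrict (has_derivativeD fc gd) => w; rewrite !ext0_val.
Qed.

Lemma det2 (K : comNzRingType) (a : 'M[K]_2) :
  \det a = a 0 0 * a 1 1 - a 0 1 * a 1 0.
Proof.
rewrite (expand_det_row _ 0) !big_ord_recl big_ord0 /cofactor !det_mx11 !mxE /=.
have -> : lift 0 0 = 1 :> 'I_2 by apply/val_inj.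
have -> : lift 1 0 = 0 :> 'I_2 by apply/val_inj.
by rewrite /= expr0 expr1 -[ord0]/(0 : 'I_2); ring.
Qed.

Lemma autfactor_neq0 a z : 0 < \det a -> autfactor a z != 0.
Proof.
rewrite det2; apply: contraTneq; rewrite /autfactor; have := upper_Im_gt0 z.
case: (val z) => x y /= y0 /eqP; rewrite eq_complex /= !mul0r subr0 !addr0.
move=> /andP[/eqP h1 /eqP h2].
have c0 : a 1 0 = 0 by apply/eqP; move/eqP: h2; rewrite mulf_eq0 (gt_eqF y0) orbF.
by move: h1; rewrite c0 mul0r add0r => ->; rewrite !mulr0 subr0 ltxx.
Qed.

Lemma Im_moebius a z :
  complex.Im (((a 0 0)%:C * val z + (a 0 1)%:C) / autfactor a z : R[i]) =
  \det a * complex.Im (val z : R[i]) / cabs (autfactor a z) ^+ 2.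
Proof.
rewrite det2 cabs_sqr /autfactor; case: (val z) => x y /=.
by rewrite !mul0r !subr0 !addr0; ring.
Qed.

Lemma val_moebius a z : 0 < \det a ->
  val (moebius a z) = ((a 0 0)%:C * val z + (a 0 1)%:C) / autfactor a z.
Proof.
move=> a0; rewrite /moebius val_insubd Im_moebius.
rewrite divr_gt0 ?exprn_gt0 ?cabs_gt0 ?autfactor_neq0 // mulr_gt0 //.
exact: upper_Im_gt0.
Qed.

Lemma autfactorM a b z : 0 < \det b ->
  autfactor (a *m b) z = autfactor a (moebius b z) * autfactor b z.
Proof.
move=> b0; have j0 := autfactor_neq0 z b0.
rewrite /autfactor in j0 *; rewrite val_moebius // /autfactor mulrDl.
rewrite mulrA divfK // !mxE !big_ord_recl !big_ord0 !addr0 /=.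
rewrite !(rmorphD, rmorphM) /=.
have -> : lift ord0 ord0 = 1 :> 'I_2 by apply/val_inj.
by ring.
Qed.

Lemma moebiusM a b z : 0 < \det a -> 0 < \det b ->
  moebius (a *m b) z = moebius a (moebius b z).
Proof.
move=> a0 b0; apply: val_inj.
rewrite (val_moebius (moebius b z)) // val_moebius ?det_mulmx ?mulr_gt0 //.
have jb := autfactor_neq0 z b0; have ja := autfactor_neq0 (moebius b z) a0.
rewrite autfactorM // (val_moebius z) //.
apply: (mulIf (mulf_neq0 ja jb)); rewrite mulfVK ?mulf_neq0 //.
rewrite mulrA mulfVK // mulrDl mulrA mulfVK //.
rewrite !mxE !big_ord_recl !big_ord0 !addr0 /=.
have -> : lift ord0 ord0 = 1 :> 'I_2 by apply/val_inj.
by rewrite !(rmorphD, rmorphM) /autfactor /= -[ord0]/(0 : 'I_2); ring.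
Qed.

Lemma slash_mulmx k a b f : 0 < \det a -> 0 < \det b ->
  slash k (a *m b) f = slash k b (slash k a f).
Proof.
move=> a0 b0; apply/funext => z; rewrite /slash moebiusM // autfactorM //.
rewrite det_mulmx powRM ?(ltW a0) ?(ltW b0) // rmorphM /=.
have jb := autfactor_neq0 z b0; have ja := autfactor_neq0 (moebius b z) a0.
by rewrite exprMn; field; rewrite !expf_neq0.
Qed.

Lemma slash_mul k l a f g : 0 < \det a ->
  slash (k + l) a (fun z => f z * g z) = fun z => slash k a f z * slash l a g z.
Proof.
move=> a0; apply/funext => z; rewrite /slash natrD mulrDl powRD; last first.
  by apply/implyP => _; exact: lt0r_neq0.
have ja := autfactor_neq0 z a0.
by rewrite rmorphM /= exprD; field; rewrite !expf_neq0.
Qed.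

Lemma slash_even k a f z : 0 < \det a ->
  slash k.*2 a f z = (\det a)%:C ^+ k * f (moebius a z) / autfactor a z ^+ k.*2.
Proof.
move=> a0; rewrite /slash -rmorphXn /=; congr (_%:C * _ / _).
by rewrite -powR_mulrn ?ltW // -muln2 natrM mulfK // pnatr_eq0.
Qed.

Lemma slash1 k f : slash k 1%:M f = f.
Proof.
apply/funext => z; have d1 : 0 < \det (1%:M : 'M[R]_2) by rewrite det1.
have m1 : moebius 1%:M z = z.
  apply: val_inj; rewrite val_moebius // /autfactor !mxE /=.
  by rewrite !rmorph0 mul0r add0r !rmorph1 mul1r addr0 divr1.
rewrite /slash m1 det1 powR1 /autfactor !mxE /= rmorph0 rmorph1 mul0r add0r.
by rewrite expr1n mul1r divr1.
Qed.

Lemma has_derivative_moebius a z : 0 < \det a ->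
  has_derivative (fun w : Cx R => ((a 0 0)%:C * w + (a 0 1)%:C) /
     ((a 1 0)%:C * w + (a 1 1)%:C)) (val z)
    ((\det a)%:C / autfactor a z ^+ 2).
Proof.
move=> a0; have j0 := autfactor_neq0 z a0; rewrite /autfactor in j0.
have lin (c d : Cx R) (x : Cx R) : has_derivative (fun w => c * w + d) x c.
  apply: has_derivative_eq (has_derivativeD (has_derivativeZ c (has_derivative_id x))
    (has_derivative_cst d x)) _.
  by rewrite mulr1 addr0.
have H := has_derivativeM (lin (a 0 0)%:C (a 0 1)%:C (val z))
  (@has_derivativeV _ (fun w => (a 1 0)%:C * w + (a 1 1)%:C) _ _ j0
    (lin (a 1 0)%:C (a 1 1)%:C (val z))).
apply: has_derivative_eq H _; rewrite det2 /autfactor rmorphB !rmorphM /=.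
by field.
Qed.

Lemma hderiv_moebius f a z d : 0 < \det a -> hderiv f (moebius a z) d ->
  hderiv (fun w => f (moebius a w)) z (d * ((\det a)%:C / autfactor a z ^+ 2)).
Proof.
move=> a0 fd; rewrite /hderiv val_moebius // in fd.
pose G (w : Cx R) := ((a 0 0)%:C * w + (a 0 1)%:C) / ((a 1 0)%:C * w + (a 1 1)%:C).
have H := @has_derivative_comp _ (ext0 f) G _ _ _ fd (has_derivative_moebius z a0).
apply: (@hderiv_restrict _ _ _ _ _ H) => w.
by rewrite -(ext0_val f) val_moebius.
Qed.

Lemma hderiv_autfactor a z : hderiv (autfactor a) z (a 1 0)%:C.
Proof.
apply: (@hderiv_restrict _ (fun w => (a 1 0)%:C * w + (a 1 1)%:C)) => //.
apply: has_derivative_eq (has_derivativeD (has_derivativeZ _ (has_derivative_id _))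
    (has_derivative_cst _ _)) _.
by rewrite mulr1 addr0.
Qed.

Lemma hderiv_cst c z : hderiv (fun=> c) z 0.
Proof. exact: (@hderiv_restrict _ (fun=> c)) (has_derivative_cst _ _). Qed.

Lemma hderivV f z d : f z != 0 -> hderiv f z d ->
  hderiv (fun w => (f w)^-1) z (- d / f z ^+ 2).
Proof.
rewrite -(ext0_val f z) => f0 fd.
by apply: hderiv_restrict (has_derivativeV f0 fd) => w; rewrite !ext0_val.
Qed.

Lemma hderivX f z d n : hderiv f z d ->
  hderiv (fun w => f w ^+ n) z (n%:R * f z ^+ n.-1 * d).
Proof.
rewrite -(ext0_val f z) => fd.
by apply: hderiv_restrict (has_derivativeX n fd) => w; rewrite !ext0_val.
Qed.

Lemma hderiv_eq f z c d : hderiv f z c -> c = d -> hderiv f z d.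
Proof. exact: has_derivative_eq. Qed.

Lemma hderivN f z d : hderiv f z d -> hderiv (fun w => - f w) z (- d).
Proof.
move=> fd; apply: hderiv_restrict (has_derivativeN fd) => w.
by rewrite ext0_val.
Qed.

Lemma hderivB f g z c d : hderiv f z c -> hderiv g z d ->
  hderiv (fun w => f w - g w) z (c - d).
Proof. by move=> fc gd; apply: hderivD fc (hderivN gd). Qed.

Lemma hderivZ f z d (c : Cx R) : hderiv f z d -> hderiv (fun w => c * f w) z (c * d).
Proof.
move=> fd; apply: hderiv_eq (hderivM (hderiv_cst c z) fd) _.
by rewrite mul0r add0r.
Qed.

End UpperHalfPlane.

(** * The rational identities left once all derivatives are computed *)

Section FieldIdentities.
Context {K : numFieldType}.

(** Here t = 2 pi i, D is the determinant, c the lower left entry, J the automorphy factor; P, E are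
    the values of [phi], [eta4] at the image point and p, e those at z. Below, W and w are the two
    values of omega_4. *)
Lemma dlog_slash_identity (t D c J P E e p : K) : t != 0 -> J != 0 -> e != 0 ->
  D * (t * P * E * (D / J ^+ 2) * (J ^+ 2)^-1 +
       E * (- (2 * J ^+ 2.-1 * c) / J ^+ 2 ^+ 2)) * e^-1 +
  D * (E * (J ^+ 2)^-1) * (- (t * p * e) / e ^+ 2) =
  D * E / J ^+ 2 / e * (t * (P * D / J ^+ 2 - 2 * c / t / J - p)).
Proof. by move=> t0 J0 e0 /=; field; rewrite t0 J0 e0. Qed.

Lemma deriv_mu_identity (t D c J P W w : K) : t != 0 -> J != 0 ->
  t * W * (D / J ^+ 2) * (D * (J ^+ 2)^-1) +
  P * (D * (- (2 * J ^+ 2.-1 * c) / J ^+ 2 ^+ 2)) -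
  2 * c / t * (- c / J ^+ 2) - t * w =
  t * (W * D ^+ 2 / J ^+ 4 - P * D * (2 * c / t) / J ^+ 3 +
       (2 * c / t) ^+ 2 / 2 / J ^+ 2 - w).
Proof. by move=> t0 J0 /=; field; rewrite t0 J0. Qed.

(** The correction k = 2 c / (t J) satisfies k'/t = - k^2 / 2, which makes psi = phi|g - k a
    solution of psi'/t = psi^2 / 2 + omega_4|g, the equation of [phi] with omega_4 transformed. For
    psi - phi, which is mu_g, all quadratic terms then cancel. *)
Lemma schwarzian_field_identity (t D c J P p W w : K) : t != 0 -> J != 0 ->
  t^-1 * (t * ((P ^+ 2 / 2 + W) * D ^+ 2 / J ^+ 4 - P * D * (2 * c / t) / J ^+ 3 +
       (2 * c / t) ^+ 2 / 2 / J ^+ 2 - (p ^+ 2 / 2 + w)))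
  - p * (P * D / J ^+ 2 - 2 * c / t / J - p)
  - (P * D / J ^+ 2 - 2 * c / t / J - p) ^+ 2 / 2 =
  D ^+ 2 * W / J ^+ 4 - w.
Proof. by move=> t0 J0; field; rewrite t0 J0. Qed.

End FieldIdentities.

(** * Logarithmic derivative of eta and the Schwarzian identity *)

Section SchwarzianIdentity.
Context {R : realType}.
Implicit Types (z : upper R) (a : 'M[R]_2).

Lemma cabs_nome_lt1 z : cabs (cis (val z : Cx R)) < 1.
Proof. exact/cabs_cis_lt1/upper_Im_gt0. Qed.

Lemma etaE z : eta z = cis (val z / 24) * euler_prod (cis (val z)).
Proof. by rewrite /eta /nome -mulrA. Qed.

Lemma E4E z : E4 z = 1 + 240 * lambert_sum 3 (cis (val z)).
Proof.
rewrite /E4 (_ : (fun m => _) = series (fun n => n%:R ^+ 3 * lambert (cis (val z)) n)) //.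
apply/funext => -[|m]; first by rewrite /series /= !big_geq.
rewrite /series /= [RHS]big_ltn // expr0n mul0r add0r.
by apply: eq_bigr => n _; rewrite /lambert mulrA.
Qed.

Lemma eta_neq0 z : eta z != 0.
Proof. by rewrite etaE mulf_neq0 ?cis_neq0 ?euler_prod_neq0 ?cabs_nome_lt1. Qed.

Lemma eta4_neq0 z : eta4 z != 0.
Proof. by rewrite expf_neq0 // eta_neq0. Qed.

(* [phi] is E_2/6, the logarithmic derivative of [eta4] up to [2 i pi]. *)
Definition phi : hfun R := fun z => 1 / 6 - 4 * lambert_sum 1 (cis (val z)).

Lemma hderiv_eta z : hderiv eta z (two_pi_i * (phi z / 4) * eta z).
Proof.
apply: (@hderiv_restrict _ _ (fun w => cis (w / 24) * euler_prod (cis w))).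
  exact: etaE.
have q1 := cabs_nome_lt1 z; set q := cis (val z) in q1.
have H24 : has_derivative (fun w : Cx R => w / 24) (val z) 24^-1.
  apply: has_derivative_eq (has_derivativeM (has_derivative_id _)
    (has_derivative_cst (24^-1) _)) _.
  by rewrite mul1r mulr0 addr0.
have Hc := @has_derivative_comp _ _ (fun w => w / 24) _ _ _
  (has_derivative_cis (val z / 24)) H24.
have HP := has_derivative_comp (is_derive_euler_prod q1) (has_derivative_cis (val z)).
apply: has_derivative_eq (has_derivativeM Hc HP) _.
rewrite -/q etaE -/q /phi -/q -mul_euler_dlog //.
by field.
Qed.

Lemma hderiv_eta4 z : hderiv eta4 z (two_pi_i * phi z * eta4 z).
Proof.
apply: hderiv_eq (hderivX 4 (hderiv_eta z)) _.
by rewrite /eta4 /=; field.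
Qed.

Lemma dlog_eta4 z : two_pi_i^-1 * dlog eta4 z = phi z.
Proof.
rewrite /dlog (hderivE (hderiv_eta4 z)).
by field; rewrite eta4_neq0 two_pi_i_neq0.
Qed.

(** Substituting E_2 = 6 phi in Ramanujan's identity turns it into a Riccati equation; the
    denominator 72 = 6 * 12 of omega_4 originates here. *)
Lemma hderiv_phi z :
  hderiv phi z (two_pi_i * (phi z ^+ 2 / 2 + omega4_fun z)).
Proof.
have q1 := cabs_nome_lt1 z; set q := cis (val z) in q1.
have H := has_derivative_comp (is_derive_lambert_sum 1 q1) (has_derivative_cis (val z)).
apply: (@hderiv_restrict _ _ (fun w => 1 / 6 - 4 * lambert_sum 1 (cis w))).
  by move=> w.
apply: has_derivative_eq (has_derivativeB (has_derivative_cst _ _) (has_derivativeZ 4 H)) _.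
have -> : 0 - 4 * (lambert_dsum 1 q * (two_pi_i * cis (val z))) =
   two_pi_i * (- 4 * (q * lambert_dsum 1 q)) by rewrite -/q; ring.
rewrite ramanujan_E2 // /phi /omega4_fun E4E -/q.
by field.
Qed.

Lemma slash2E a f z : 0 < \det a ->
  slash 2 a f z = (\det a)%:C * f (moebius a z) / autfactor a z ^+ 2.
Proof. exact: (@slash_even _ 1). Qed.

Lemma slash4E a f z : 0 < \det a ->
  slash 4 a f z = (\det a)%:C ^+ 2 * f (moebius a z) / autfactor a z ^+ 4.
Proof. exact: (@slash_even _ 2). Qed.

(** [mu_fun] for an arbitrary real matrix, since the analytic identities depend only on the entries
    and the sign of the determinant. *)
Definition mu_real a : hfun R := fun z =>
  two_pi_i^-1 * dlog (fun w => slash 2 a eta4 w / eta4 w) z.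

Lemma hderiv_quotient a z : 0 < \det a ->
  hderiv (fun w => slash 2 a eta4 w / eta4 w) z
    (slash 2 a eta4 z / eta4 z * (two_pi_i *
     (phi (moebius a z) * (\det a)%:C / autfactor a z ^+ 2
      - 2 * (a 1 0)%:C / two_pi_i / autfactor a z - phi z))).
Proof.
move=> a0; have j0 := autfactor_neq0 z a0; have e0 := eta4_neq0 z.
have H1 := hderiv_moebius a0 (hderiv_eta4 (moebius a z)).
have H2 := hderivV (expf_neq0 2 j0) (hderivX 2 (hderiv_autfactor a z)).
have H3 := hderivZ (\det a)%:C (hderivM H1 H2).
have H4 := hderivM H3 (hderivV e0 (hderiv_eta4 z)).
rewrite (_ : (fun w => slash 2 a eta4 w / eta4 w) = (fun w =>
  (\det a)%:C * (eta4 (moebius a w) * (autfactor a w ^+ 2)^-1) * (eta4 w)^-1)).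
  apply: hderiv_eq H4 _; rewrite slash2E //.
  exact: dlog_slash_identity (@two_pi_i_neq0 R) j0 e0.
by apply/funext => w; rewrite slash2E // !mulrA.
Qed.

Lemma mu_realE a z : 0 < \det a -> mu_real a z =
  phi (moebius a z) * (\det a)%:C / autfactor a z ^+ 2
    - 2 * (a 1 0)%:C / two_pi_i / autfactor a z - phi z.
Proof.
move=> a0; rewrite /mu_real /dlog (hderivE (hderiv_quotient z a0)).
have e0 := eta4_neq0 z; have s0 : slash 2 a eta4 z != 0.
  rewrite slash2E //; apply: mulf_neq0.
    apply: mulf_neq0; last exact: eta4_neq0.
    by rewrite fmorph_eq0 gt_eqF.
  by rewrite invr_neq0 // expf_neq0 // autfactor_neq0.
set X := _ - phi z; set Q := slash 2 a eta4 z / eta4 z.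
have Q0 : Q != 0 by apply: mulf_neq0 => //; apply: invr_neq0.
by rewrite [Q * _]mulrC mulfK // mulKf // two_pi_i_neq0.
Qed.

Lemma hderiv_mu a z : 0 < \det a -> hderiv (mu_real a) z
  (two_pi_i * ((phi (moebius a z) ^+ 2 / 2 + omega4_fun (moebius a z)) *
     (\det a)%:C ^+ 2 / autfactor a z ^+ 4
   - phi (moebius a z) * (\det a)%:C * (2 * (a 1 0)%:C / two_pi_i) / autfactor a z ^+ 3
   + (2 * (a 1 0)%:C / two_pi_i) ^+ 2 / 2 / autfactor a z ^+ 2
   - (phi z ^+ 2 / 2 + omega4_fun z))).
Proof.
move=> a0; have j0 := autfactor_neq0 z a0.
rewrite (_ : mu_real a = (fun w => phi (moebius a w) * ((\det a)%:C * (autfactor a w ^+ 2)^-1)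
    - 2 * (a 1 0)%:C / two_pi_i * (autfactor a w)^-1 - phi w)); last first.
  by apply/funext => w; rewrite mu_realE // !mulrA.
have H1 := hderiv_moebius a0 (hderiv_phi (moebius a z)).
have H2 := hderivZ (\det a)%:C
  (hderivV (expf_neq0 2 j0) (hderivX 2 (hderiv_autfactor a z))).
have H3 := hderivZ (2 * (a 1 0)%:C / two_pi_i) (hderivV j0 (hderiv_autfactor a z)).
have H := hderivB (hderivB (hderivM H1 H2) H3) (hderiv_phi z).
apply: hderiv_eq H _.
exact: deriv_mu_identity (@two_pi_i_neq0 R) j0.
Qed.

Lemma schwarzian_identity a z : 0 < \det a ->
  two_pi_i^-1 * deriv_upper (mu_real a) z - phi z * mu_real a z
    - mu_real a z ^+ 2 / 2 =
  slash 4 a omega4_fun z - omega4_fun z.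
Proof.
move=> a0; rewrite (hderivE (hderiv_mu z a0)) mu_realE //.
rewrite slash4E //.
exact: schwarzian_field_identity (@two_pi_i_neq0 R) (autfactor_neq0 z a0).
Qed.

End SchwarzianIdentity.

Section Matrices2.
Context {K : comNzRingType}.
Implicit Types A B : 'M[K]_2.

Definition mx2 (a b c d : K) : 'M[K]_2 :=
  \matrix_(i, j) if i == 0 then (if j == 0 then a else b) else (if j == 0 then c else d).

Lemma mx2E a b c d : (mx2 a b c d 0 0 = a) * (mx2 a b c d 0 1 = b) *
  (mx2 a b c d 1 0 = c) * (mx2 a b c d 1 1 = d).
Proof. by rewrite !mxE. Qed.

Lemma mulmx2E A B i j : (A *m B) i j = A i 0 * B 0 j + A i 1 * B 1 j.
Proof.
rewrite mxE !big_ord_recl big_ord0 addr0.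
by have -> : lift ord0 ord0 = 1 :> 'I_2 by apply/val_inj.
Qed.

Lemma mx2_ext A B : A 0 0 = B 0 0 -> A 0 1 = B 0 1 -> A 1 0 = B 1 0 ->
  A 1 1 = B 1 1 -> A = B.
Proof.
move=> h1 h2 h3 h4; apply/matrixP => i j.
have I2 (k : 'I_2) : k = 0 \/ k = 1.
  by case: k => -[|[|//]] ?; [left|right]; apply/val_inj.
by case: (I2 i) => ->; case: (I2 j) => ->.
Qed.

End Matrices2.

(** * omega_4 is a modular form of level 1 *)

Section EisensteinModular.
Context {R : realType}.
Implicit Types (f : hfun R) (z : upper R) (g : 'M[int]_2).

Local Notation real g := (map_mx intr g : 'M[R]_2).

Lemma det_real g : \det g = 1 -> \det (real g) = 1.
Proof. by rewrite det_map_mx => ->. Qed.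

Lemma det_real_gt0 g : \det g = 1 -> 0 < \det (real g).
Proof. by move=> /det_real ->. Qed.

Lemma real_intC (n : int) : (n%:~R : R)%:C = n%:~R :> Cx R.
Proof. by rewrite rmorph_int. Qed.

Lemma cis_int (n : int) : cis (n%:~R : Cx R) = 1.
Proof.
case: n => n; first exact: cisn.
rewrite NegzE mulrNz; have := cisD (n.+1%:R : Cx R) (- n.+1%:R).
by rewrite subrr cisn mul1r /cis mulr0 cexp0 => <-.
Qed.

Lemma omega4E z : omega4_fun z = - ((1 + 240 * lambert_sum 3 (cis (val z))) / 72).
Proof. by rewrite /omega4_fun E4E. Qed.

Lemma omega4_inversion g z : g 0 0 = 0 -> g 0 1 = 1 -> g 1 0 = -1 -> g 1 1 = 0 ->
  slash 4 (real g) omega4_fun z = omega4_fun z.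
Proof.
move=> g00 g01 g10 g11.
have dg : \det g = 1 by rewrite det2 g00 g01 g10 g11.
have jE : autfactor (real g) z = - val z.
  by rewrite /autfactor !mxE g10 g11 !real_intC mulrN1z mulN1r addr0.
rewrite slash4E ?det_real_gt0 // det_real // rmorph1 expr1n mul1r jE !omega4E.
have -> : val (moebius (real g) z) = - (val z)^-1.
  rewrite val_moebius ?det_real_gt0 // jE !mxE g00 g01 !real_intC mul0r add0r.
  by rewrite mul1r invrN.
have E := E4_inv (upper_Im_gt0 z); have z0 := upper_neq0 z.
have key (A B w : Cx R) : w != 0 -> A = w ^+ 4 * B -> - (A / 72) / (- w) ^+ 4 = - (B / 72).
  by move=> w0 ->; field.
exact: key z0 E.
Qed.

Lemma omega4_triangular g z : \det g = 1 -> g 1 0 = 0 ->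
  slash 4 (real g) omega4_fun z = omega4_fun z.
Proof.
move=> dg g10; have := dg; rewrite det2 g10 mulr0 subr0 => ad1.
(* The diagonal entries are equal to the same sign: g acts as an integral translation, and the
   fourth power of its automorphy factor is 1. *)
have dd1 : g 1 1 * g 1 1 = 1 /\ g 0 0 = g 1 1.
  have : muln (absz (g 0 0)) (absz (g 1 1)) == 1%N by rewrite -abszM ad1.
  rewrite muln_eq1 => /andP[_ /eqP d1].
  have [d1'|d1'] : g 1 1 = 1 \/ g 1 1 = -1 by move: d1; clear; lia.
    by move: ad1; rewrite d1' !mulr1.
  by move: ad1; rewrite d1' !mulrN1 opprK => /eqP; rewrite eqr_oppLR => /eqP.
have [d2 ad] := dd1.
have dC : (g 1 1)%:~R * (g 1 1)%:~R = 1 :> Cx R by rewrite -intrM d2.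
have d0 : (g 1 1)%:~R != 0 :> Cx R.
  by apply/eqP => h; move: dC; rewrite h mul0r => /eqP; rewrite eq_sym oner_eq0.
have jE : autfactor (real g) z = (g 1 1)%:~R.
  by rewrite /autfactor !mxE g10 !real_intC mul0r add0r.
rewrite slash4E ?det_real_gt0 // det_real // rmorph1 expr1n mul1r jE !omega4E.
have -> : val (moebius (real g) z) = val z + (g 0 1 * g 1 1)%:~R.
  rewrite val_moebius ?det_real_gt0 // jE !mxE !real_intC ad intrM.
  apply: (mulIf d0); rewrite mulfVK // mulrDl -[_ * _ * (g 1 1)%:~R]mulrA dC mulr1.
  by rewrite mulrC.
rewrite cisD cis_int mulr1.
have -> : (g 1 1)%:~R ^+ 4 = 1 :> Cx R.
  by rewrite (exprM _ 2 2) (expr2 (_%:~R)) dC expr1n.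
by rewrite divr1.
Qed.

(* Euclid's algorithm on the bottom row, the [SL(2,Z)] generators being the
   inversion and the triangular matrices. *)
Lemma omega4_SL2Z g : \det g = 1 -> slash 4 (real g) omega4_fun = omega4_fun.
Proof.
move=> dg; have [n] := ubnP (absz (g 1 0)); elim: n g dg => // n IHn g dg.
rewrite ltnS => gn; have [g10|g10] := eqVneq (g 1 0) 0.
  by apply/funext => z; apply: omega4_triangular.
set c := g 1 0 in g10 gn *; set d := g 1 1.
pose q := (d %/ c)%Z; pose r := (d %% c)%Z.
have dE : d = q * c + r by exact: divz_eq.
have r0 : 0 <= r by apply: modz_ge0.
have rc : (absz r < absz c)%N.
  by rewrite -ltz_nat abszE ger0_norm //; apply: ltz_mod.
pose T := mx2 (1 : int) q 0 1; pose S := mx2 (0 : int) 1 (-1) 0.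
(* On bottom rows, (r, -c) S = (c, r) and (c, r) T = (c, q c + r) = (c, d); the top row is that of g
   T^-1 S^-1. *)
pose g' := mx2 (g 0 1 - q * g 0 0) (- g 0 0) r (- c).
have dg' : \det g' = 1.
  rewrite -dg !det2 !mx2E -/c -/d dE; ring.
have gE : g = g' *m S *m T.
  apply: mx2_ext; rewrite !mulmx2E !mx2E -/c -/d ?dE; ring.
have dS : \det S = 1 by rewrite det2 !mx2E.
have dT : \det T = 1 by rewrite det2 !mx2E; ring.
have g'n : (absz (g' 1%R 0%R) < n)%N by rewrite mx2E; apply: leq_trans rc gn.
have -> : real g = real g' *m real S *m real T by rewrite gE !map_mxM.
rewrite !slash_mulmx ?det_real_gt0 ?det_mulmx ?mulr_gt0 ?det_real_gt0 //.
rewrite IHn //; have -> : slash 4 (real S) omega4_fun = omega4_fun.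
  by apply/funext => z; apply: omega4_inversion; rewrite mx2E.
by apply/funext => z; apply: omega4_triangular; rewrite ?mx2E.
Qed.

Lemma omega4_holomorphic : holomorphic (@omega4_fun R).
Proof.
apply/holomorphicP => z; have q1 := cabs_nome_lt1 z.
have H := has_derivative_comp (is_derive_lambert_sum 3 q1) (has_derivative_cis (val z)).
have H1 := has_derivativeD (has_derivative_cst 1 (val z)) (has_derivativeZ 240 H).
have H2 := has_derivativeN (has_derivativeM H1 (has_derivative_cst 72^-1 (val z))).
by eexists; apply: (hderiv_restrict _ H2); exact: omega4E.
Qed.

(** Above height 1 the nome has modulus at most 1/2, and the series is bounded by its majorant at
    radius 1/2; the factor 2 in [B] is 1 / (1 - 1/2). *)
Lemma omega4_bounded : bounded_at_infty (@omega4_fun R).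
Proof.
pose B := limn (series (fun n => 2 * (n%:R ^+ 3 * (2^-1 : R) ^+ n))).
have h01 : 0 <= (2^-1 : R) < 1 by rewrite invr_ge0 ler0n invf_lt1 ?ltr1n.
have cB : cvgn (series (fun n => 2 * (n%:R ^+ 3 * (2^-1 : R) ^+ n))).
  by apply: (@is_cvg_seriesZ _ (fun n => n%:R ^+ 3 * 2^-1 ^+ n));
     exact: cvg_series_natX_geometric.
exists ((1 + 240 * B) / 72), 1 => z z1.
have q1 := cabs_nome_lt1 z.
have q2 : cabs (cis (val z : Cx R)) <= 2^-1.
  rewrite cabs_cis expRN lef_pV2 ?posrE ?expR_gt0 //.
  apply: le_trans (expR_ge1Dx _); have := @pi_ge2 R.
  by move: z1; set y := complex.Im _; nra.
have lB : cabs (lambert_sum 3 (cis (val z))) <= B.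
  apply: (cabs_lim_le (@cvg_lambert _ 3 _ q1)); apply: nearW => N.
  apply: le_trans (cabs_sum _ _ _) _; apply: le_trans (partial_sum_le_lim N _ cB).
    rewrite /series /=; apply: ler_sum => n _.
    rewrite cabsM cabsX cabs_nat mulrCA ler_wpM2l ?exprn_ge0 //.
    apply: le_trans (lambert_bound n q2 _) _; first by case/andP: h01.
    rewrite mulrC; have -> : (1 - 2^-1)^-1 = 2 :> R by field.
    by [].
  by move=> n; rewrite mulr_ge0 // mulr_ge0 ?exprn_ge0 // invr_ge0.
rewrite cabsE lecR omega4E cabsN cabsM cabsV cabs_nat ler_wpM2r ?invr_ge0 //.
apply: le_trans (cabsD _ _) _; rewrite cabs1 lerD2l cabsM cabs_nat.
by rewrite ler_wpM2l.
Qed.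

Lemma modular_form_omega4 : modular_form 1 4 (@omega4_fun R).
Proof.
split; first exact: omega4_holomorphic.
  by move=> g [dg _]; exact: omega4_SL2Z.
by move=> g [dg _]; rewrite omega4_SL2Z //; exact: omega4_bounded.
Qed.

End EisensteinModular.

(** * Products of modular forms and the slash action of rational matrices *)

Section ModularAlgebra.
Context {R : realType}.
Implicit Types (f h : hfun R) (z : upper R) (g : 'M[int]_2).

Local Notation real g := (map_mx intr g : 'M[R]_2).

Lemma real_mulmx (A B : 'M[int]_2) : real (A *m B) = real A *m real B.
Proof. exact: map_mxM. Qed.

Lemma Gamma_det N g : Gamma N g -> \det g = 1.
Proof. by case. Qed.

Lemma Gamma_dvd N M g : (N %| M)%N -> Gamma M g -> Gamma N g.
Proof.
move=> NM [dg gM]; split=> // i j; apply: dvdz_trans (gM i j).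
by rewrite dvdzE.
Qed.

Lemma Gamma1 g : \det g = 1 -> Gamma 1 g.
Proof. by move=> dg; split=> // i j; rewrite dvd1z. Qed.

Lemma modular_form_dvd N M k f : (N %| M)%N -> modular_form N k f -> modular_form M k f.
Proof. by move=> NM [fh fi fb]; split=> // g /(Gamma_dvd NM); apply: fi. Qed.

Lemma slash_cst0 k (a : 'M[R]_2) : slash k a (0 : hfun R) = 0.
Proof. by apply/funext => z; rewrite /slash mulr0 mul0r. Qed.

Lemma slashB k (a : 'M[R]_2) f h : slash k a (f - h) = slash k a f - slash k a h.
Proof.
by apply/funext => z; rewrite /slash [(f - h) _]/(f _ - h _) mulrBr mulrBl.
Qed.

Lemma slashM k l (a : 'M[R]_2) f h : 0 < \det a ->
  slash (k + l) a (f * h) = slash k a f * slash l a h.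
Proof. exact: slash_mul. Qed.

Lemma modular_form0 N k : modular_form N k (0 : hfun R).
Proof.
split=> [|g _|g _]; rewrite ?slash_cst0 //.
  by apply/holomorphicP => z; exists 0; apply: hderiv_cst.
by exists 0, 0 => z _; rewrite normr0.
Qed.

Lemma bounded_at_inftyB f h : bounded_at_infty f -> bounded_at_infty h ->
  bounded_at_infty (f - h).
Proof.
move=> [B [Y fB]] [C [W hC]]; exists (B + C), (Num.max Y W) => z.
rewrite gt_max => /andP[/fB h1 /hC h2]; rewrite rmorphD.
by apply: le_trans (ler_normB _ _) _; apply: lerD.
Qed.

Lemma bounded_at_inftyM f h : bounded_at_infty f -> bounded_at_infty h ->
  bounded_at_infty (f * h).
Proof.
move=> [B [Y fB]] [C [W hC]]; exists (B * C), (Num.max Y W) => z.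
rewrite gt_max => /andP[/fB h1 /hC h2]; rewrite rmorphM.
by rewrite [(f * h) z]/(f z * h z) normrM; apply: ler_pM.
Qed.

Lemma modular_formB N k f h : modular_form N k f -> modular_form N k h ->
  modular_form N k (f - h).
Proof.
move=> [fh fi fb] [hh hi hb]; split.
- apply/holomorphicP => z; have [c fc] := (holomorphicP _).1 fh z.
  have [d hd] := (holomorphicP _).1 hh z; exists (c - d); exact: hderivB.
- by move=> g gN; rewrite slashB fi // hi.
- by move=> g g1; rewrite slashB; apply: bounded_at_inftyB; [apply: fb|apply: hb].
Qed.

Lemma modular_formM N k l f h : modular_form N k f -> modular_form N l h ->
  modular_form N (k + l) (f * h).
Proof.
move=> [fh fi fb] [hh hi hb]; split.
- apply/holomorphicP => z; have [c fc] := (holomorphicP _).1 fh z.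
  have [d hd] := (holomorphicP _).1 hh z; eexists; exact: hderivM fc hd.
- by move=> g gN; rewrite slashM ?(det_real_gt0 (Gamma_det gN)) // fi // hi.
- move=> g g1; rewrite slashM ?(det_real_gt0 (Gamma_det g1)) //.
  by apply: bounded_at_inftyM; [apply: fb|apply: hb].
Qed.

(** An upper triangular matrix fixes i oo: its automorphy factor is constant, and it multiplies
    imaginary parts by det / d^2, where d is its lower right entry. *)
Lemma bounded_at_infty_triangular k (a : 'M[R]_2) f : 0 < \det a -> a 1 0 = 0 ->
  bounded_at_infty f -> bounded_at_infty (slash k a f).
Proof.
move=> a0 a10 [B [Y fB]]; have := a0; rewrite det2 a10 mulr0 subr0 => ad0.
have d0 : a 1 1 != 0 by apply: contraTneq ad0 => ->; rewrite mulr0 ltxx.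
pose D := `|\det a `^ (k%:R / 2)| * (B / `|a 1 1| ^+ k).
exists D, (Y * a 1 1 ^+ 2 / \det a) => z zY.
have jE : autfactor a z = (a 1 1)%:C by rewrite /autfactor a10 mul0r add0r.
have Im : complex.Im (val (moebius a z) : R[i]) =
    \det a * complex.Im (val z : R[i]) / a 1 1 ^+ 2.
  by rewrite val_moebius // Im_moebius jE cabs_real real_normK ?num_real.
have /fB : Y < complex.Im (val (moebius a z) : R[i]).
  rewrite Im ltr_pdivlMr; last by rewrite lt_neqAle sqr_ge0 andbT eq_sym sqrf_eq0.
  by rewrite [ltRHS]mulrC -ltr_pdivrMr.
rewrite !cabsE !lecR => H.
rewrite /slash jE !(cabsM, cabsV, cabsX) !cabs_real -mulrA ler_wpM2l //.
by rewrite ler_wpM2r // invr_ge0 exprn_ge0.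
Qed.

Lemma GLQ_integral (q : 'M[rat]_2) : exists2 m : int, 0 < m &
  exists A : 'M[int]_2, map_mx intr A = m%:~R *: q.
Proof.
pose m := denq (q 0 0) * denq (q 0 1) * denq (q 1 0) * denq (q 1 1).
exists m; first by rewrite !mulr_gt0 ?denq_gt0.
exists (mx2 (numq (q 0 0) * denq (q 0 1) * denq (q 1 0) * denq (q 1 1))
  (denq (q 0 0) * numq (q 0 1) * denq (q 1 0) * denq (q 1 1))
  (denq (q 0 0) * denq (q 0 1) * numq (q 1 0) * denq (q 1 1))
  (denq (q 0 0) * denq (q 0 1) * denq (q 1 0) * numq (q 1 1))).
by apply: mx2_ext; rewrite !mxE /= /m !intrM !numqE; ring.
Qed.

(** The normalisation det^(k/2) cancels the factor c^k of the automorphy factor; this is what allows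
    denominators to be cleared. *)
Lemma slash_scale k (c : R) (a : 'M[R]_2) f : 0 < c -> 0 < \det a ->
  slash k (c *: a) f = slash k a f.
Proof.
move=> c0 a0; have dE : \det (c *: a) = c ^+ 2 * \det a by rewrite detZ.
have d0 : 0 < \det (c *: a) by rewrite dE mulr_gt0 // exprn_gt0.
have cC : c%:C != 0 :> Cx R by rewrite fmorph_eq0 gt_eqF.
apply/funext => z; have j0 := autfactor_neq0 z a0.
have jE : autfactor (c *: a) z = c%:C * autfactor a z.
  by rewrite /autfactor !mxE !rmorphM /= mulrDr mulrA.
have mE : moebius (c *: a) z = moebius a z.
  apply: val_inj; rewrite !val_moebius // jE !mxE !rmorphM /=.
  by rewrite -mulrA -mulrDr -mulf_div divff // mul1r.
rewrite /slash mE jE dE powRM ?exprn_ge0 ?(ltW c0) ?(ltW a0) // rmorphM /=.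
have -> : (c ^+ 2) `^ (k%:R / 2) = c ^+ k.
  by rewrite -powR_mulrn ?(ltW c0) // -powRrM mulrCA divff ?mulr1 ?pnatr_eq0 // powR_mulrn // ltW.
rewrite rmorphXn /= exprMn.
have c1 := expf_neq0 k cC; have j1 := expf_neq0 k j0.
by field; rewrite c1 j1.
Qed.

Lemma holomorphic_slash k (a : 'M[R]_2) f : 0 < \det a -> holomorphic f ->
  holomorphic (slash k a f).
Proof.
move=> a0 /holomorphicP fh; apply/holomorphicP => z.
have [d fd] := fh (moebius a z).
have j0 := expf_neq0 k (autfactor_neq0 z a0).
have H := hderivM (hderivZ (\det a `^ (k%:R / 2))%:C (hderiv_moebius a0 fd))
   (hderivV j0 (hderivX k (hderiv_autfactor a z))).
by eexists; exact: H.
Qed.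

(** A Bezout relation u a + v c = e for the first column (a, c) of A completes (a/e, c/e) to a
    matrix g of SL(2,Z), and g^-1, which is the adjugate, sends (a, c) to (e, 0). *)
Lemma int_matrix_triangularization (A : 'M[int]_2) : \det A != 0 ->
  exists2 g : 'M[int]_2, \det g = 1 & (\adj g *m A) 1 0 = 0.
Proof.
move=> A0; pose a := A 0 0; pose c := A 1 0; pose e := gcdz a c.
have e0 : e != 0.
  rewrite gcdz_eq0; apply: contra A0 => /andP[/eqP a0 /eqP c0].
  by rewrite det2 -/a -/c a0 c0 mul0r mulr0 subr0.
have [u [v uv]] := Bezoutz a c.
have aE : a = (a %/ e)%Z * e by rewrite divzK // dvdz_gcdl.
have cE : c = (c %/ e)%Z * e by rewrite divzK // dvdz_gcdr.
set a' := (a %/ e)%Z in aE; set c' := (c %/ e)%Z in cE.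
have uv1 : u * a' + v * c' = 1.
  apply: (mulIf e0); rewrite mul1r; transitivity (u * a + v * c); last exact: uv.
  by rewrite {1}aE {1}cE; ring.
have g1 : \det (mx2 a' (- v) c' u) = 1 by rewrite det2 !mx2E -uv1; ring.
exists (mx2 a' (- v) c' u) => //.
pose B := mx2 u v (- c') a'.
have -> : \adj (mx2 a' (- v) c' u) = B.
  have H : B *m mx2 a' (- v) c' u = 1%:M.
    by apply: mx2_ext; rewrite mulmx2E !mx2E !mxE /= -?uv1; ring.
  rewrite -[LHS]mul1mx -H -mulmxA mul_mx_adj g1 mulmx1 //.
rewrite mulmx2E !mx2E -/a -/c {1}aE {1}cE; ring.
Qed.

(** If g = 1 + det(A) B then A g A^-1 = 1 + A B adj(A) is integral of determinant 1, so it fixes f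
    and g fixes f|A. *)
Lemma slash_conj_level k f (A : 'M[int]_2) g : 0 < \det A ->
  (forall g, \det g = 1 -> slash k (real g) f = f) ->
  Gamma (absz (\det A)) g -> slash k (real g) (slash k (real A) f) = slash k (real A) f.
Proof.
move=> A0 fi [dg gN].
have rA0 : 0 < \det (real A) by rewrite det_map_mx ltr0z.
pose B := \matrix_(i, j) ((g i j - (1%:M : 'M[int]_2) i j) %/ \det A)%Z.
have gE : g = 1%:M + \det A *: B.
  apply/matrixP => i j; rewrite mxE [(\det A *: B) i j]mxE [B i j]mxE mulrC divzK.
    by rewrite addrC subrK.
  by have := gN i j; rewrite !dvdzE.
pose h := 1%:M + A *m B *m \adj A.
have hA : h *m A = A *m g.
  rewrite /h gE mulmxDl mulmxDr mul1mx mulmx1; congr (_ + _).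
  by rewrite -!mulmxA mul_adj_mx scalar_mxC -scalemxAr mul_scalar_mx scalemxAr.
have dh : \det h = 1.
  have := congr1 (fun M => \det M) hA; rewrite !det_mulmx dg mulr1.
  by move/eqP; rewrite -[X in _ == X]mul1r (inj_eq (mulIf (lt0r_neq0 A0))) => /eqP.
rewrite -slash_mulmx ?(det_real_gt0 dg) // -real_mulmx -hA real_mulmx.
by rewrite slash_mulmx ?(det_real_gt0 dh) // fi.
Qed.

Lemma modular_form_slash_int k f (A : 'M[int]_2) : 0 < \det A -> modular_form 1 k f ->
  modular_form (absz (\det A)) k (slash k (real A) f).
Proof.
move=> A0 [fh fi fb].
have rA0 : 0 < \det (real A) by rewrite det_map_mx ltr0z.
have fi' g : \det g = 1 -> slash k (real g) f = f by move=> /Gamma1; exact: fi.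
split; first exact: holomorphic_slash.
  by move=> g; apply: slash_conj_level.
move=> g [dg _]; rewrite -slash_mulmx ?(det_real_gt0 dg) // -real_mulmx.
have Ag0 : 0 < \det (A *m g) by rewrite det_mulmx dg mulr1.
(* A g = h U with h in SL(2,Z) and U upper triangular. As f|h = f, only boundedness of f at i oo is
   at stake. *)
have [h dh h10] := int_matrix_triangularization (lt0r_neq0 Ag0).
have dadj : \det (\adj h) = 1.
  have := congr1 (fun M => \det M) (mul_mx_adj h).
  by rewrite det_mulmx dh mul1r det1.
have -> : A *m g = h *m (\adj h *m (A *m g)) by rewrite mulmxA mul_mx_adj dh mul1mx.
have U0 : 0 < \det (\adj h *m (A *m g)) by rewrite det_mulmx dadj mul1r.
rewrite real_mulmx slash_mulmx ?(det_real_gt0 dh) ?det_map_mx ?ltr0z // fi' //.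
apply: bounded_at_infty_triangular.
- by rewrite det_map_mx ltr0z.
- by rewrite mxE h10.
- by have := fb 1%:M (Gamma1 (det1 _ _)); rewrite map_mx1 slash1.
Qed.

Lemma GLQ_real_gt0 (q : GLQ) : 0 < \det (@GLQ_real R q).
Proof. by rewrite det_map_mx ltr0q; exact: (valP q). Qed.

Lemma modular_form_slash_GLQ k f (q : GLQ) : modular_form 1 k f ->
  exists2 N : nat, (0 < N)%N & modular_form N k (slash k (GLQ_real q) f).
Proof.
move=> fm; have [m m0 [A AE]] := GLQ_integral (val q).
have A0 : 0 < \det A.
  rewrite -(ltr0z rat) -det_map_mx AE detZ mulr_gt0 ?exprn_gt0 ?ltr0z //.
  exact: (valP q).
exists (absz (\det A)); first by rewrite absz_gt0 lt0r_neq0.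
have -> : slash k (GLQ_real q) f = slash k (real A) f.
  have -> : real A = m%:~R *: GLQ_real q.
    have := congr1 (map_mx (@ratr R)) AE; rewrite -map_mx_comp => H.
    rewrite /GLQ_real -[RHS](_ : map_mx ratr (m%:~R *: val q) = _).
      rewrite -H; apply/matrixP => i j; rewrite !mxE /= ratr_int //.
    by apply/matrixP => i j; rewrite !mxE rmorphM /= ratr_int.
  by rewrite slash_scale ?ltr0z ?GLQ_real_gt0.
exact: modular_form_slash_int.
Qed.

End ModularAlgebra.

(** * The graded algebra and the multiplier of the derivation *)

Section GradedAlgebra.
Context {R : realType}.
Implicit Types (p q : graded R) (f h : hfun R) (a b : 'M[R]_2).

(** [hfun R] and [graded R] are declared as plain rings; commutativity is what moves omega_4 from
    one side of a coefficient to the other. *)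
Lemma hfun_mulC f h : f * h = h * f.
Proof. by apply/funext => z; rewrite [LHS]/(f z * h z) mulrC. Qed.

Lemma graded_mulC p q : p * q = q * p.
Proof.
apply/polyP => n; rewrite coefM coefMr.
by apply: eq_bigr => i _; rewrite hfun_mulC.
Qed.

Lemma graded_mulCA p q s : p * (q * s) = q * (p * s).
Proof. by rewrite mulrA [p * q]graded_mulC -mulrA. Qed.

(** An operator that kills 0 is unaffected by the truncation at [size p], so slash, X and Y can be
    computed coefficient by coefficient. *)
Lemma coef_poly_size (E : nat -> hfun R -> hfun R) p k : E k 0 = 0 ->
  (\poly_(j < size p) E j p`_j)`_k = E k p`_k.
Proof.
move=> E0; rewrite coef_poly; case: ltnP => // ks.
by rewrite (nth_default _ ks).
Qed.

Lemma coef_of_weight k f n : (of_weight k f)`_n = if n == k then f else 0.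
Proof. by rewrite /of_weight coefZ coefXn; case: eqP => _; rewrite ?mulr1 ?mulr0. Qed.

Lemma coef_of_weightM k f p n :
  (of_weight k f * p)`_n = if (n < k)%N then 0 else f * p`_(n - k).
Proof.
rewrite /of_weight -mul_polyC -mulrA coefCM -commr_polyXn coefMXn.
by case: ifP => _; rewrite ?mulr0.
Qed.

Lemma of_weightB k f h : of_weight k (f - h) = of_weight k f - of_weight k h.
Proof. exact: scalerBl. Qed.

Lemma of_weightM k l f h : of_weight k f * of_weight l h = of_weight (k + l) (f * h).
Proof.
apply/polyP => n; rewrite coef_of_weightM !coef_of_weight.
case: ltnP => [nk|kn]; first by case: eqP nk => // ->; rewrite ltnNge leq_addr.
by rewrite -(eqn_add2l k) subnKC //; case: eqP; rewrite ?mulr0.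
Qed.

Lemma slashD k a f h : slash k a (f + h) = slash k a f + slash k a h.
Proof.
by apply/funext => z; rewrite /slash [(f + h) _]/(f _ + h _) mulrDr mulrDl.
Qed.

Lemma coef_gslash a p k : (gslash a p)`_k = slash k a p`_k.
Proof. by apply: (coef_poly_size (E := fun k => slash k a)); apply: slash_cst0. Qed.

Lemma gslashB a p q : gslash a (p - q) = gslash a p - gslash a q.
Proof. by apply/polyP => k; rewrite coefB !coef_gslash coefB slashB. Qed.

Lemma gslashM a p q : 0 < \det a -> gslash a (p * q) = gslash a p * gslash a q.
Proof.
move=> a0; apply/polyP => k; rewrite coef_gslash !coefM.
have slash_sum (I : Type) (r : seq I) (F : I -> hfun R) :
    slash k a (\sum_(i <- r) F i) = \sum_(i <- r) slash k a (F i).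
  elim: r => [|i r IHr]; first by rewrite !big_nil slash_cst0.
  by rewrite !big_cons slashD IHr.
rewrite slash_sum; apply: eq_bigr => i _; rewrite !coef_gslash -slashM //.
by rewrite subnKC // -ltnS.
Qed.

Lemma gslash_mulmx a b p : 0 < \det a -> 0 < \det b ->
  gslash (a *m b) p = gslash b (gslash a p).
Proof. by move=> a0 b0; apply/polyP => k; rewrite !coef_gslash slash_mulmx. Qed.

Lemma gslash1 p : gslash 1%:M p = p.
Proof. by apply/polyP => k; rewrite coef_gslash slash1. Qed.

Lemma gslash_of_weight k a f : gslash a (of_weight k f) = of_weight k (slash k a f).
Proof.
apply/polyP => n; rewrite coef_gslash !coef_of_weight.
by case: eqP => [->//|_]; rewrite slash_cst0.
Qed.

Lemma deriv_upper0 : deriv_upper (0 : hfun R) = 0.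
Proof. by apply/funext => z; rewrite (hderivE (hderiv_cst 0 z)). Qed.

Lemma Xop_of_weight k f : Xop (of_weight k f) = of_weight (k + 2)
  (const_hfun two_pi_i^-1 * deriv_upper f -
   const_hfun two_pi_i^-1 * dlog eta4 * (const_hfun (k%:R / 2) * f)).
Proof.
rewrite /Xop of_weightB mulrBl; congr (_ - _).
  have -> : \poly_(j < size (of_weight k f))
      (const_hfun two_pi_i^-1 * deriv_upper (of_weight k f)`_j) =
      of_weight k (const_hfun two_pi_i^-1 * deriv_upper f).
    apply/polyP => n.
    rewrite (coef_poly_size (E := fun _ f => const_hfun two_pi_i^-1 * deriv_upper f)).
      by rewrite !coef_of_weight; case: eqP => // _; rewrite deriv_upper0 mulr0.
    by rewrite deriv_upper0 mulr0.
  by rewrite /of_weight -scalerAl -exprD.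
have -> : Yop (of_weight k f) = of_weight k (const_hfun (k%:R / 2) * f).
  apply/polyP => n.
  rewrite (coef_poly_size (E := fun k f => const_hfun (k%:R / 2) * f)) ?mulr0 //.
  by rewrite !coef_of_weight; case: eqP => [->//|_]; rewrite mulr0.
by rewrite /of_weight scalerA -scalerAl -exprD.
Qed.

(** The factor by which [delta2'] multiplies the coefficient at U_g^*. *)
Definition schwarzian (g : GLQ) : graded R :=
  Xop (mu g) - (const_hfun (2^-1 : Cx R))%:P * mu g ^+ 2.

Lemma schwarzianE (g : GLQ) :
  schwarzian g = gslash (GLQ_real g) (@omega4 R) - omega4.
Proof.
rewrite gslash_of_weight -of_weightB /schwarzian /mu Xop_of_weight expr2 of_weightM.
have -> : (const_hfun 2^-1)%:P * of_weight (2 + 2) (mu_fun g * mu_fun g) =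
   of_weight 4 (const_hfun (2^-1 : Cx R) * (mu_fun g * mu_fun g)).
  by rewrite mul_polyC /of_weight scalerA.
rewrite -of_weightB; congr of_weight; apply/funext => z.
have := schwarzian_identity z (@GLQ_real_gt0 R g).
rewrite -(dlog_eta4 z) -[mu_real _]/(@mu_fun R g) => H.
rewrite [LHS]/(two_pi_i^-1 * deriv_upper (mu_fun g) z -
  two_pi_i^-1 * dlog eta4 z * (2%:R / 2 * mu_fun g z) -
  2^-1 * (mu_fun g z * mu_fun g z)).
(* mu_g has weight 2, so Y acts on it as 2/2 = 1. *)
by rewrite divff ?pnatr_eq0 // mul1r [2^-1 * _]mulrC -expr2.
Qed.

Lemma modular_forms_omega4 : modular_forms (@omega4 R).
Proof.
exists 1%N => // k; rewrite coef_of_weight.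
by case: eqP => [->|_]; [exact: modular_form_omega4|exact: modular_form0].
Qed.

(** Modularity is read off the form omega_4|g - omega_4: it has some level M, p has a level N, and
    the product is taken at level M N. Components of weight below 4 vanish. *)
Lemma modular_forms_schwarzian (g : GLQ) p : modular_forms p ->
  modular_forms (schwarzian g * p).
Proof.
move=> [N N0 pN]; rewrite schwarzianE gslash_of_weight -of_weightB.
have [M M0 wM] := modular_form_slash_GLQ g (@modular_form_omega4 R).
exists (M * N)%N; first by rewrite muln_gt0 M0.
move=> k; rewrite coef_of_weightM; case: ltnP => k4; first exact: modular_form0.
rewrite -{1}(subnKC k4); apply: modular_formM.
  apply: modular_form_dvd (dvdn_mulr N (dvdnn M)) _; apply: modular_formB => //.
  exact: modular_form_dvd (dvd1n M) (@modular_form_omega4 R).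
exact: modular_form_dvd (dvdn_mull M (dvdnn N)) (pN _).
Qed.

End GradedAlgebra.

Lemma mcoeff_sumU (K : choiceType) (G : zmodType) (a : monalg.malg K G)
    (F : K -> G -> G) k : F k 0 = 0 ->
  (\sum_(g <- monalg.msupp a) << F g a@_g *g g >>)@_k = F k a@_k.
Proof.
move=> F0; rewrite raddf_sum /=; have [kg|kn] := boolP (k \in monalg.msupp a).
  rewrite (big_fsetD1 k) //= monalg.mcoeffUU big1_fset ?addr0 // => g.
  by rewrite in_fsetD1 monalg.mcoeffU; case: eqP.
rewrite big_seq big1 => [|g ga]; first by rewrite (monalg.mcoeff_outdom kn) F0.
by rewrite monalg.mcoeffU; case: eqP => // gk; rewrite -gk ga in kn.
Qed.

(** * The derivation on the crossed product *)

Section CrossedProductAlgebra.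
Context {R : realType}.
Implicit Types (a b c : @precrossed R) (p q : graded R) (g h : GLQ).

Lemma mcoeff_delta2' a k : (delta2' a)@_k = schwarzian k * a@_k.
Proof. by apply: (@mcoeff_sumU _ _ a (fun g p => schwarzian g * p)); rewrite mulr0. Qed.

Lemma delta2'D a b : delta2' (a + b) = delta2' a + delta2' b.
Proof.
by apply/monalg.malgP => k; rewrite monalg.mcoeffD !mcoeff_delta2' monalg.mcoeffD mulrDr.
Qed.

(** Larger index sets add only zero terms. This allows for supports that shrink, such as that of
    [delta2' a], or that of [inclM q] when q = 0. *)
Lemma cmulEw (A B : {fset GLQ}) a b : (monalg.msupp a `<=` A)%fset ->
  (monalg.msupp b `<=` B)%fset ->
  cmul a b = \sum_(g <- A) \sum_(h <- B)
     << a@_g * gslash (GLQ_real g) b@_h *g GLQ_mul h g >>.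
Proof.
move=> aA bB; rewrite /cmul (big_fset_incl _ aA) /=; last first.
  move=> g _ ga; apply: big1 => h _.
  by rewrite (monalg.mcoeff_outdom ga) mul0r monalg.monalgU0.
apply: eq_bigr => g _; apply: big_fset_incl bB _ => h _ hb.
by rewrite (monalg.mcoeff_outdom hb) gslash0 mulr0 monalg.monalgU0.
Qed.

Lemma GLQ_mul1g g : GLQ_mul GLQ_one g = g.
Proof. by apply: val_inj; rewrite /= mul1mx. Qed.

Lemma GLQ_mulg1 g : GLQ_mul g GLQ_one = g.
Proof. by apply: val_inj; rewrite /= mulmx1. Qed.

Lemma GLQ_real1 : GLQ_real GLQ_one = 1%:M :> 'M[R]_2.
Proof. by rewrite /GLQ_real map_mx1. Qed.

Lemma GLQ_realM g h : GLQ_real (GLQ_mul g h) = GLQ_real g *m GLQ_real h :> 'M[R]_2.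
Proof. exact: map_mxM. Qed.

Lemma mcoeff_cmul_inclMr a q k :
  (cmul a (inclM q))@_k = a@_k * gslash (GLQ_real k) q.
Proof.
rewrite (@cmulEw (monalg.msupp a) [fset GLQ_one]%fset) ?fsubset_refl //; last first.
  exact: monalg.msuppU_le.
under eq_bigr => g _ do rewrite big_seq_fset1 GLQ_mul1g monalg.mcoeffUU.
by apply: (@mcoeff_sumU _ _ a (fun g p => p * gslash (GLQ_real g) q)); rewrite mul0r.
Qed.

Lemma mcoeff_cmul_inclMl a q k : (cmul (inclM q) a)@_k = q * a@_k.
Proof.
rewrite (@cmulEw [fset GLQ_one]%fset (monalg.msupp a)) ?fsubset_refl //; last first.
  exact: monalg.msuppU_le.
rewrite big_seq_fset1 monalg.mcoeffUU GLQ_real1.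
under eq_bigr => h _ do rewrite GLQ_mulg1 gslash1.
by apply: (@mcoeff_sumU _ _ a (fun g p => q * p)); rewrite mulr0.
Qed.

Lemma delta2'_inner a : delta2' a = commutator a (inclM omega4).
Proof.
apply/monalg.malgP => k; rewrite monalg.mcoeffB mcoeff_cmul_inclMr mcoeff_cmul_inclMl.
by rewrite mcoeff_delta2' schwarzianE mulrBl graded_mulC.
Qed.

Lemma msupp_delta2' a : (monalg.msupp (delta2' a) `<=` monalg.msupp a)%fset.
Proof.
apply/fsubsetP => k; rewrite -!monalg.mcoeff_neq0 mcoeff_delta2'.
by apply: contraNneq => ->; rewrite mulr0.
Qed.

(** The multiplier s is a coboundary, so s(h g) = s(g) + s(h)|g. Multiplied by p (q|g), this is the
    Leibniz rule on the product of p U_g^* and q U_h^*. *)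
Lemma schwarzianM g h p q :
  schwarzian (GLQ_mul h g) * (p * gslash (GLQ_real g) q) =
  schwarzian g * p * gslash (GLQ_real g) q +
  p * gslash (GLQ_real g) (schwarzian h * q).
Proof.
rewrite !schwarzianE GLQ_realM gslash_mulmx ?GLQ_real_gt0 //.
rewrite gslashM ?GLQ_real_gt0 // gslashB.
by rewrite (graded_mulCA p) -[_ * p * _]mulrA -mulrDl [_ - _ + _]addrC subrKA.
Qed.

Lemma delta2'M a b : delta2' (cmul a b) = cmul (delta2' a) b + cmul a (delta2' b).
Proof.
(* All three products are expanded over the supports of a and b themselves, so that the terms match
   pair by pair. *)
rewrite (cmulEw (msupp_delta2' a) (fsubset_refl _)).
rewrite (cmulEw (fsubset_refl _) (msupp_delta2' b)) /cmul.
have d0 : delta2' (0 : @precrossed R) = 0.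
  by apply/monalg.malgP => k; rewrite mcoeff_delta2' monalg.mcoeff0 mulr0.
rewrite (big_morph _ delta2'D d0) -big_split; apply: eq_bigr => g _ /=.
rewrite (big_morph _ delta2'D d0) -big_split; apply: eq_bigr => h _ /=.
by rewrite delta2'U !mcoeff_delta2' -monalg.monalgUD -schwarzianM.
Qed.

Lemma mcoeff_cscale (c : Cx R) a k :
  (Defs.cscale c a)@_k = (const_hfun c)%:P * a@_k.
Proof. exact: monalg.mcoeffZ. Qed.

Lemma delta2'Z (c : Cx R) a : delta2' (Defs.cscale c a) = Defs.cscale c (delta2' a).
Proof.
apply/monalg.malgP => k; rewrite [LHS]mcoeff_delta2' [RHS]mcoeff_cscale.
rewrite [X in _ * X = _]mcoeff_cscale [X in _ = _ * X]mcoeff_delta2'.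
exact: graded_mulCA.
Qed.

Lemma crossed_inclM_omega4 : crossed (inclM (@omega4 R)).
Proof.
move=> g; rewrite monalg.mcoeffU; case: eqP => _; first exact: modular_forms_omega4.
by exists 1%N => // k; rewrite coef0; exact: modular_form0.
Qed.

End CrossedProductAlgebra.

Theorem proposition10 (R : realType) :
  [/\ derivation_of (@crossed R) delta2',
      modular_form 1 4 (@omega4_fun R),
      crossed (inclM (@omega4 R))
    & forall a : @precrossed R, crossed a ->
        delta2' a = commutator a (inclM omega4)].
Proof.
split; [split| | |] => [a aM g|a b _ _|c a _|a b _ _|||a _].
- by rewrite mcoeff_delta2'; apply: modular_forms_schwarzian.
- exact: delta2'D.
- exact: delta2'Z.
- exact: delta2'M.
- exact: modular_form_omega4.
- exact: crossed_inclM_omega4.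
- exact: delta2'_inner.
Qed.
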